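(* Consider the gradient flow and the $k$-step IMEX-LMM described in the context, where the nonlinearity satisfies the Lipschitz condition with constant $\ell_f>0$ and where there exist constants $\zeta>0$ and $0<\eta\le 1$ such that $\|v\|\le\zeta\|(-\mathcal{M})^{-1/2}v\|^{\eta}\|\mathcal{L}^{1/2}v\|^{1-\eta}$ for all $v\in S$. Let $\boldsymbol{a}^{(k)},\boldsymbol{B}^{(k)},\hat{\boldsymbol{b}}^{(k)}$ be the coefficient vectors of the scheme and let $\boldsymbol{\mu}\in\mathbb{R}^k$ with $\sum_{i=0}^{k-1}\mu_i=1$ be the multiplier vector, with associated vector $\boldsymbol{\nu}\in\mathbb{R}^{k+1}$. Suppose that $\deg M(z;\boldsymbol{a}^{(k)})=\deg M(z;\boldsymbol{\mu})=k-1$ and $\deg M(z;\boldsymbol{B}^{(k)})=k$; that $M(z;\boldsymbol{a}^{(k)})$ is relatively prime to $M(z;\boldsymbol{\mu})$ and $M(z;\boldsymbol{B}^{(k)})$ is relatively prime to $M(z;\boldsymbol{\nu})$; and that $M(z;\boldsymbol{\mu})\neq 0$ for $|z|>1$. Assume further that there exist constants $\alpha,\beta>0$ such that for all $\theta\in[0,\pi]$, $$\operatorname{Re}\{M(\mathrm{e}^{\mathrm{i}\theta};\boldsymbol{a}^{(k)})M(\mathrm{e}^{-\mathrm{i}\theta};\boldsymbol{\mu})\}\ge\alpha,\qquad \operatorname{Re}\{M(\mathrm{e}^{\mathrm{i}\theta};\boldsymbol{B}^{(k)})M(\mathrm{e}^{-\mathrm{i}\theta};\boldsymbol{\nu})\}\ge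 2\beta(1-\cos\theta).$$ Then there exist positive definite matrices $G_a\in\mathbb{R}^{(k-1)\times(k-1)}$ and $G_B\in\mathbb{R}^{k\times k}$ such that $$\boldsymbol{x}^\top U_a\boldsymbol{x}\ge\alpha x_1^2,\qquad \boldsymbol{y}^\top U_B\boldsymbol{y}\ge\beta(y_1-y_2)^2$$ for all $\boldsymbol{x}=[x_1,\ldots,x_k]^\top\in\mathbb{R}^k$ and $\boldsymbol{y}=[y_1,\ldots,y_{k+1}]^\top\in\mathbb{R}^{k+1}$, with $U_a,U_B$ defined from $G_a,G_B$ as in the context. For these matrices, the modified energy $E_G^n$ satisfies $E_G^{n+1}\le E_G^n$ (for $k-1\le n\le N-1$) whenever $$0<\tau\le\tau_{\max},\qquad \tau_{\max}=\frac{\alpha\beta^{\bar\eta}}{(\ell_f\hat c_0/2)^{1+\bar\eta}\,\eta\,(1-\eta)^{\bar\eta}\,\zeta^{2+2\bar\eta}},\qquad \bar\eta=\frac{1-\eta}{\eta}.$$ Moreover, let $\lambda_a,\lambda_B>0$ be constants with $\boldsymbol{x}^\top G_a\boldsymbol{x}\ge\lambda_a\boldsymbol{x}^\top\boldsymbol{x}$ for all $\boldsymbol{x}\in\mathbb{R}^{k-1}$ and $\boldsymbol{y}^\top G_B\boldsymbol{y}\ge\lambda_B\boldsymbol{y}^\top\boldsymbol{y}$ for all $\boldsymbol{y}\in\mathbb{R}^k$; let $$\bar c_i=\sum_{q=0}^{k-1}|\mu_q|\sum_{m=0}^{i-1}\sum_{j=i}^{k-1}|\mu_m||\mu_j|(j-m)\quad(1\le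 i\le k-1),\qquad c_{\min}=\min_{1\le i\le k-1}\left(\frac{\hat c_i}{2}-\bar c_i\right),$$ and let $\bar\tau_{\max}=+\infty$ if $c_{\min}\ge 0$ and $$\bar\tau_{\max}=\frac{\lambda_a4^{-\bar\eta}\lambda_B^{\bar\eta}}{(\ell_f|c_{\min}|)^{1+\bar\eta}\,\eta\,(1-\eta)^{\bar\eta}\,\zeta^{2+2\bar\eta}}\quad\text{if }c_{\min}<0.$$ Then $E_G^n$ is dissipative ($E_G^{n+1}\le E_G^n$) and nonnegative ($E_G^n\ge 0$) whenever $0<\tau\le\min\{\tau_{\max},\bar\tau_{\max}\}$.
   Context: Abstract setting. $\Omega=(-\pi,\pi)^d$, $d\in\{1,2,3\}$, with periodic boundary conditions; $(v,w)=\int_\Omega vw\,\mathrm{d}\boldsymbol{x}$, $\|v\|=(v,v)^{1/2}$. $H$ is a Hilbert space with inner product $(\cdot,\cdot)$ and norm $\|\cdot\|$; $S,V$ are Hilbert spaces with $S\hookrightarrow V\hookrightarrow H$ (continuous and compact embeddings); $V'$ is the dual of $V$ and $V\subset H\subset V'$ is a Gelfand triple with duality pairing $\langle\cdot,\cdot\rangle_{V',V}$. $\mathcal{L}:S\to V$ is linear with $(\mathcal{L}u,v)=(u,\mathcal{L}v)$ and $(\mathcal{L}v,v)\ge 0$ for $u,v\in S$; $\|\mathcal{L}^{1/2}u\|:=(\mathcal{L}u,u)^{1/2}$. $\mathcal{M}:V\to V'$ is linear and self-adjoint, $\langle\mathcal{M}u,v\rangle_{V',V}=\langle\mathcal{M}v,u\rangle_{V',V}$,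 and there are constants $C_{\mathcal M},c_{\mathcal M}>0$ with $|\langle\mathcal{M}u,v\rangle_{V',V}|\le C_{\mathcal M}\|u\|_V\|v\|_V$ and $-\langle\mathcal{M}v,v\rangle_{V',V}\ge c_{\mathcal M}\|v\|_V^2$ for all $u,v\in V$; hence $\mathcal{M}^{-1}:V'\to V$ is bounded, self-adjoint and negative definite. For $v\in H$, $\|(-\mathcal{M})^{-1/2}v\|:=(v,-\mathcal{M}^{-1}v)^{1/2}$. Nonlinearity. $f(u)=F'(u)$ for a potential $F$, with $(F(u),1):=\int_\Omega F(u)\,\mathrm{d}\boldsymbol{x}\ge 0$. $f:S\to V$ is globally Lipschitz: $\|f(u)-f(v)\|\le\ell_f\|u-v\|$ for all $u,v\in S$, and (as a consequence) $|(F(u)-F(v),1)-(f(v),u-v)|\le\frac{\ell_f}{2}\|u-v\|^2$ for all $u,v\in S$. Gradient flow: $u_t=\mathcal{M}[\mathcal{L}u+f(u)]$, $u(0)=u^0$, on $(0,T]$. Scheme. Let $k\ge 2$, $\tau=T/N$, $t_n=n\tau$. Given $u^0,\ldots,u^{k-1}\in S$, the $k$-step IMEX-LMM is, for $k-1\le n\le N-1$ (with solution $u^{n+1}\in S$), $$\sum_{i=0}^kA_i^{(k)}u^{n+1-i}=\tau\mathcal{M}\Big[\sum_{i=0}^kB_i^{(k)}\mathcal{L}u^{n+1-i}+\sum_{i=1}^k\hat B_i^{(k)}f(u^{n+1-i})\Big],$$ with real coefficients satisfying the order conditions $\sum_{i=0}^kA_i^{(k)}=0$ and, for $0\le m\le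 k-1$, $\sum_{i=0}^kA_i^{(k)}(-i)^{m+1}=(m+1)\sum_{i=0}^kB_i^{(k)}(-i)^m=(m+1)\sum_{i=1}^k\hat B_i^{(k)}(-i)^m$, and the normalization $\sum_{i=0}^kA_i^{(k)}(-i)=\sum_{i=0}^kB_i^{(k)}=\sum_{i=1}^k\hat B_i^{(k)}=1$. Convention: $0^0=1$ throughout. With $\delta u^j=u^j-u^{j-1}$, $\delta f(u^j)=f(u^j)-f(u^{j-1})$, $a_i^{(k)}=\sum_{j=0}^iA_j^{(k)}$ ($0\le i\le k-1$) and $\hat b_i^{(k)}=\sum_{j=1}^i\hat B_j^{(k)}-1$ ($1\le i\le k-1$), the scheme is equivalent to $$\frac1\tau\sum_{i=0}^{k-1}a_i^{(k)}\mathcal{M}^{-1}(\delta u^{n+1-i})-\sum_{i=0}^kB_i^{(k)}\mathcal{L}u^{n+1-i}=f(u^n)+\sum_{i=1}^{k-1}\hat b_i^{(k)}\delta f(u^{n+1-i}).$$ Vectors: $\boldsymbol{a}^{(k)}=[a_0^{(k)},\ldots,a_{k-1}^{(k)}]^\top$, $\boldsymbol{B}^{(k)}=[B_0^{(k)},\ldots,B_k^{(k)}]^\top$, $\hat{\boldsymbol{b}}^{(k)}=[\hat b_1^{(k)},\ldots,\hat b_{k-1}^{(k)},0]^\top$. Multiplier. $\boldsymbol{\mu}=[\mu_0,\ldots,\mu_{k-1}]^\top$ with $\sum_i\mu_i=1$; $\boldsymbol{\nu}=[\nu_0,\ldots,\nu_k]^\top$ with $\nu_0=\mu_0$, $\nu_k=-\mu_{k-1}$,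 $\nu_i=\mu_i-\mu_{i-1}$ ($1\le i\le k-1$), so that $\sum_{i=0}^{k-1}\mu_i\delta u^{n+1-i}=\sum_{i=0}^k\nu_iu^{n+1-i}$. Generating polynomial: for $\boldsymbol{s}=[s_0,\ldots,s_r]^\top$, $M(z;\boldsymbol{s})=\sum_{i=0}^rs_iz^{r-i}$. Matrices ($\boldsymbol{0}_m$ is the zero vector in $\mathbb{R}^m$): $$U_a=\tfrac12\big(\boldsymbol{\mu}(\boldsymbol{a}^{(k)})^\top+\boldsymbol{a}^{(k)}\boldsymbol{\mu}^\top\big)-\begin{bmatrix}G_a&\boldsymbol{0}_{k-1}\\ \boldsymbol{0}_{k-1}^\top&0\end{bmatrix}+\begin{bmatrix}0&\boldsymbol{0}_{k-1}^\top\\ \boldsymbol{0}_{k-1}&G_a\end{bmatrix},$$ $$U_B=\tfrac12\big(\boldsymbol{\nu}(\boldsymbol{B}^{(k)})^\top+\boldsymbol{B}^{(k)}\boldsymbol{\nu}^\top\big)-\begin{bmatrix}G_B&\boldsymbol{0}_{k}\\ \boldsymbol{0}_{k}^\top&0\end{bmatrix}+\begin{bmatrix}0&\boldsymbol{0}_{k}^\top\\ \boldsymbol{0}_{k}&G_B\end{bmatrix}.$$ Modified energy. For vectors of functions and a matrix $G=(g_{ij})$, $(\boldsymbol{w},\boldsymbol{v})_G=\sum_{i,j}g_{ij}(w^i,v^j)$; linear operators act componentwise. With $\boldsymbol{v}_n=[\delta u^n,\delta u^{n-1},\ldots,\delta u^{n+2-k}]^\top$ and $\boldsymbol{u}_n=[u^n,\ldots,u^{n+1-k}]^\top$,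 $$E_G^n=-\frac1\tau(\boldsymbol{v}_n,\mathcal{M}^{-1}\boldsymbol{v}_n)_{G_a}+(\boldsymbol{u}_n,\mathcal{L}\boldsymbol{u}_n)_{G_B}+\sum_{i=0}^{k-1}\mu_i(F(u^{n-i}),1)+\frac{\ell_f}{2}\sum_{i=1}^{k-1}\hat c_i\|\delta u^{n+1-i}\|^2,$$ where $\hat c_i=\sum_{j=i}^{k-1}\tilde c_j$ ($0\le i\le k-1$) and, with $\delta_{i,0}$ the Kronecker delta, $$\tilde c_i=(1-\delta_{i,0})|\hat b_i^{(k)}|\sum_{j=0}^{k-1}|\mu_j|+|\mu_i|\sum_{j=1}^{k-1}|\hat b_j^{(k)}|+|\mu_i|+\Big(|\mu_i|+\sum_{j=i}^{k-1}j|\mu_j|\Big)(1-\delta_{i,0}).$$ *)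

(* Defs.v *)
From HB Require Import structures.
From mathcomp Require Import all_boot all_order all_algebra.
From mathcomp Require Import complex.
From mathcomp Require Import all_classical all_reals all_analysis.
Set Implicit Arguments.
Unset Strict Implicit.
Unset Printing Implicit Defensive.
Import Order.TTheory GRing.Theory Num.Theory.
Import numFieldNormedType.Exports.
Local Open Scope classical_set_scope.
Local Open Scope ring_scope.

HB.mixin Record CompleteNormedModule_isHilbert (R : realType) V
    of CompleteNormedModule R V := {
  dotp : V -> V -> R;
  dotpC : forall u v, dotp u v = dotp v u;
  dotpDl : forall (a : R) u v w,
    dotp (a *: u + v) w = a * dotp u w + dotp v w;
  normr_dotp : forall v : V, `|v| ^+ 2 = dotp v v
}.

#[short(type="hilbertType")]
HB.structure Definition Hilbert (R : realType) :=
  {V of CompleteNormedModule R V & CompleteNormedModule_isHilbert R V}.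

Lemma product_sigma_finite d1 d2 (T1 : measurableType d1)
    (T2 : measurableType d2) (R : realType)
    (m1 : {sigma_finite_measure set T1 -> \bar R})
    (m2 : {sigma_finite_measure set T2 -> \bar R}) :
  sigma_finite setT (m1 \x m2)%E.
Proof.
have /sigma_finiteP[F [TF ndF Foo]] := sigma_finiteT m1.
have /sigma_finiteP[G [TG ndG Goo]] := sigma_finiteT m2.
exists (fun n => F n `*` G n).
  rewrite -setXTT TF TG predeqE => -[x y]; split.
    move=> [/= [n _ Fnx] [k _ Gky]]; exists (maxn n k) => //; split.
    - by move: x Fnx; exact/subsetPset/ndF/leq_maxl.
    - by move: y Gky; exact/subsetPset/ndG/leq_maxr.
  by move=> [n _ []/= ? ?]; split; exists n.
move=> k; have [? ?] := Foo k; have [? ?] := Goo k.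
split; first exact: measurableX.
by rewrite product_measure1E// lte_mul_pinfty// ge0_fin_numE.
Qed.

Section lebesgue_tuple.
Context (R : realType).

Definition cons2 n (p : R * n.-tuple R) : n.+1.-tuple R := [tuple of p.1 :: p.2].

Lemma measurable_cons2 n : measurable_fun [set: R * n.-tuple R] (@cons2 n).
Proof. exact: measurable_cons. Qed.

Section lebesgue_cons.
Context n (mu : {sigma_finite_measure set (n.-tuple R) -> \bar R}).

Definition lebesgue_cons : set (n.+1.-tuple R) -> \bar R :=
  pushforward (@lebesgue_measure R \x mu)%E (@cons2 n).

Let meas := measure_function_pushforward__canonical__measure_function_Measure
  (@lebesgue_measure R \x mu)%E (@measurable_cons2 n).

Let lebesgue_cons0 : lebesgue_cons set0 = 0%E.
Proof. exact: (measure0 meas). Qed.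

Let lebesgue_cons_ge0 A : (0 <= lebesgue_cons A)%E.
Proof. exact: (measure_ge0 meas). Qed.

Let lebesgue_cons_semi_sigma_additive : semi_sigma_additive lebesgue_cons.
Proof. exact: (@measure_semi_sigma_additive _ _ _ meas). Qed.

HB.instance Definition _ := isMeasure.Build _ _ _ lebesgue_cons
  lebesgue_cons0 lebesgue_cons_ge0 lebesgue_cons_semi_sigma_additive.

Let lebesgue_cons_sigma_finite : sigma_finite setT lebesgue_cons.
Proof.
have [F FT Ffin] := product_sigma_finite (@lebesgue_measure R) mu.
pose g (t : n.+1.-tuple R) : R * n.-tuple R := (thead t, [tuple of behead t]).
have mg : measurable_fun setT g.
  apply/measurable_fun_pair; first exact: measurable_tnth.
  exact: measurable_behead.
have cg : cancel (@cons2 n) g.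
  by case=> x t; congr pair => //; exact/val_inj.
exists (fun i => g @^-1` F i).
  by rewrite -preimage_bigcup -FT preimage_setT.
move=> i; have [mF Foo] := Ffin i; split.
  by rewrite -[X in measurable X]setTI; exact: mg.
rewrite /lebesgue_cons /pushforward -comp_preimage.
by rewrite (_ : g \o _ = id)//; apply/funext => p /=; rewrite cg.
Qed.

HB.instance Definition _ := Measure_isSigmaFinite.Build _ _ _ lebesgue_cons
  lebesgue_cons_sigma_finite.

End lebesgue_cons.

(* Lebesgue measure on R^n, realised on n-tuples as the iterated product of
   the one-dimensional Lebesgue measure. *)
Fixpoint lebesgue_tuple n : {sigma_finite_measure set (n.-tuple R) -> \bar R} :=
  match n with
  | 0 => \d_([tuple] : 0.-tuple R)
  | n'.+1 => lebesgue_cons (lebesgue_tuple n')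
  end.

End lebesgue_tuple.

Section function_spaces.
Context (R : realType).

Definition torus_box d : set (d.-tuple R) :=
  [set x | forall i, - pi < tnth x i < pi].

(* [rep v] is a representative of the class v, so linearity can only be asked
   almost everywhere. *)
Record L2_function_space d (H : hilbertType R) (rep : H -> d.-tuple R -> R) :
    Prop := {
  rep_measurable : forall v, measurable_fun (@torus_box d) (rep v);
  rep_square_integrable : forall v, (lebesgue_tuple R d).-integrable
    (@torus_box d) (fun x => ((rep v x) ^+ 2)%:E);
  rep_linear : forall (a : R) u v, {ae lebesgue_tuple R d, forall x,
    torus_box x -> rep (a *: u + v) x = a * rep u x + rep v x};
  rep_dotp : forall u v, dotp u v =
    \int[lebesgue_tuple R d]_(x in @torus_box d) (rep u x * rep v x)
}.

Record compact_embedding (U W : hilbertType R) (j : {linear U -> W}) :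
    Prop := {
  embedding_injective : injective j;
  embedding_continuous : continuous j;
  embedding_compact : forall B : set U, bounded_set B -> precompact (j @` B)
}.

Definition dual_space (V : hilbertType R) : set (V -> R) :=
  [set phi | (forall (a : R) v w, phi (a *: v + w) = a * phi v + phi w) /\
             continuous phi].

End function_spaces.

Section gradient_flow.
Context (R : realType) (d : nat) (H V S : hilbertType R).
Context (iSV : {linear S -> V}) (iVH : {linear V -> H}).

Definition iSH (u : S) : H := iVH (iSV u).

(* The image of h in V' under the Gelfand embedding H -> V'. *)
Definition gelfand (h : H) : V -> R := fun v => dotp h (iVH v).

Record gelfand_triple : Prop := {
  gelfand_SV : compact_embedding iSV;
  gelfand_VH : compact_embedding iVH;
  gelfand_dense : dense (range iVH)
}.

Record symmetric_nonneg (L : {linear S -> V}) : Prop := {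
  L_sym : forall u v, dotp (iVH (L u)) (iSH v) = dotp (iSH u) (iVH (L v));
  L_ge0 : forall v, 0 <= dotp (iVH (L v)) (iSH v)
}.

(* [M u v] is the duality pairing < M u, v >_{V', V}. *)
Record negative_operator (M : V -> V -> R) : Prop := {
  M_dual : forall u, dual_space (M u);
  M_linear : forall (a : R) u v w, M (a *: u + v) w = a * M u w + M v w;
  M_sym : forall u v, M u v = M v u;
  M_bounded : exists2 C : R, 0 < C & forall u v, `|M u v| <= C * `|u| * `|v|;
  M_coercive : exists2 c : R, 0 < c & forall v, c * `|v| ^+ 2 <= - M v v
}.

Definition potential_energy (F : S -> d.-tuple R -> R) (u : S) : R :=
  \int[lebesgue_tuple R d]_(x in @torus_box R d) F u x.

(* f = F' is the variational derivative: the derivative of u |-> (F(u), 1) at u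
   in the direction v is (f(u), v). *)
Record lipschitz_gradient (F : S -> d.-tuple R -> R) (f : S -> V) (lf : R) :
    Prop := {
  F_integrable : forall u, (lebesgue_tuple R d).-integrable
    (@torus_box R d) (EFin \o F u);
  F_ge0 : forall u, 0 <= potential_energy F u;
  F_derive : forall u v : S,
    is_derive u v (potential_energy F : S -> R^o) (dotp (iVH (f u)) (iSH v));
  f_lipschitz : forall u v,
    `|iVH (f u) - iVH (f v)| <= lf * `|iSH u - iSH v|
}.

Context (L : {linear S -> V}) (M : V -> V -> R).

Definition Minv (phi : V -> R) : V := xget 0 [set w | M w = phi].

Definition MinvH (h : H) : H := iVH (Minv (gelfand h)).

Definition norm_Minv_half (h : H) : R := Num.sqrt (dotp h (- MinvH h)).

Definition norm_L_half (u : S) : R := Num.sqrt (dotp (iVH (L u)) (iSH u)).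

Definition delta (u : nat -> S) (j : nat) : S := u j - u j.-1.

(* The equation holds in V', that is, when tested against every v in V. *)
Definition imex_lmm (k : nat) (A B Bh : nat -> R) (f : S -> V) (tau : R)
    (N : nat) (u : nat -> S) : Prop :=
  forall n, (k.-1 <= n < N)%N -> forall v : V,
    gelfand (iSH (\sum_(i < k.+1) A i *: u (n.+1 - i)%N)) v =
    tau * M (\sum_(i < k.+1) B i *: L (u (n.+1 - i)%N) +
             \sum_(1 <= i < k.+1) Bh i *: f (u (n.+1 - i)%N)) v.

End gradient_flow.

Section coefficients.
Context (R : realType).
Implicit Types (A B Bh mu s : nat -> R) (k n r i : nat).

(* The coefficient vectors are sequences nat -> R of which only the entries in
   the index ranges below matter. *)
Record order_conditions k A B Bh : Prop := {
  sum_A : \sum_(i < k.+1) A i = 0;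
  order_AB : forall m, (m < k)%N ->
    \sum_(i < k.+1) A i * (- i%:R) ^+ m.+1 =
    m.+1%:R * \sum_(i < k.+1) B i * (- i%:R) ^+ m;
  order_ABh : forall m, (m < k)%N ->
    \sum_(i < k.+1) A i * (- i%:R) ^+ m.+1 =
    m.+1%:R * \sum_(1 <= i < k.+1) Bh i * (- i%:R) ^+ m;
  normal_A : \sum_(i < k.+1) A i * (- i%:R) = 1;
  normal_B : \sum_(i < k.+1) B i = 1;
  normal_Bh : \sum_(1 <= i < k.+1) Bh i = 1
}.

Definition coef_a A i : R := \sum_(j < i.+1) A j.

Definition coef_bh Bh i : R := \sum_(1 <= j < i.+1) Bh j - 1.

Definition nu k mu i : R :=
  if i == 0%N then mu 0%N else if i == k then - mu k.-1 else mu i - mu i.-1.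

Definition genpoly r s : {poly R} := \sum_(i < r.+1) s i *: 'X^(r - i).

Definition evalC (p : {poly R}) (z : R[i]) : R[i] :=
  (map_poly (real_complex R) p).[z].

Definition expi (theta : R) : R[i] := (cos theta +i* sin theta)%C.

Definition quad n (G : 'M[R]_n) (x : 'cV[R]_n) : R := (x^T *m G *m x) 0 0.

Definition posdefmx n (G : 'M[R]_n) : Prop :=
  G^T = G /\ forall x : 'cV[R]_n, x != 0 -> 0 < quad G x.

Definition col_of n s : 'cV[R]_n := \col_(i < n) s i.

Definition pad_upper n (G : 'M[R]_n) : 'M[R]_n.+1 :=
  castmx (addn1 n, addn1 n) (block_mx G 0 0 (0 : 'M[R]_1)).

Definition pad_lower n (G : 'M[R]_n) : 'M[R]_n.+1 :=
  block_mx (0 : 'M[R]_1) 0 0 G.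

(* U_a is [Umx k.-1 mu a G_a] and U_B is [Umx k nu B G_B]. *)
Definition Umx n s t (G : 'M[R]_n) : 'M[R]_n.+1 :=
  2^-1 *: (col_of n.+1 s *m (col_of n.+1 t)^T
           + col_of n.+1 t *m (col_of n.+1 s)^T)
  - pad_upper G + pad_lower G.

Definition ctilde k Bh mu i : R :=
  (i != 0%N)%:R * `|coef_bh Bh i| * \sum_(j < k) `|mu j|
  + `|mu i| * \sum_(1 <= j < k) `|coef_bh Bh j|
  + `|mu i|
  + (`|mu i| + \sum_(i <= j < k) j%:R * `|mu j|) * (i != 0%N)%:R.

Definition chat k Bh mu i : R := \sum_(i <= j < k) ctilde k Bh mu j.

Definition cbar k mu i : R :=
  \sum_(q < k) `|mu q| *
  \sum_(m < i) \sum_(i <= j < k) `|mu m| * `|mu j| * (j%:R - m%:R).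

Definition cmin k Bh mu : R :=
  let c i := chat k Bh mu i / 2 - cbar k mu i in
  \big[Num.min/c 1%N]_(1 <= i < k) c i.

Definition etabar (eta : R) : R := (1 - eta) / eta.

Definition tau_max k Bh mu (lf alpha beta zeta eta : R) : R :=
  alpha * beta `^ etabar eta /
  ((lf * chat k Bh mu 0%N / 2) `^ (1 + etabar eta) * eta *
   (1 - eta) `^ etabar eta * zeta `^ (2 + 2 * etabar eta)).

Definition taubar_max k Bh mu (lf lambda_a lambda_B zeta eta : R) : \bar R :=
  if 0 <= cmin k Bh mu then +oo%E else
  (lambda_a * 4 `^ (- etabar eta) * lambda_B `^ etabar eta /
   ((lf * `|cmin k Bh mu|) `^ (1 + etabar eta) * eta *
    (1 - eta) `^ etabar eta * zeta `^ (2 + 2 * etabar eta)))%:E.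

End coefficients.

Section modified_energy.
Context (R : realType) (d : nat) (H V S : hilbertType R).
Context (iSV : {linear S -> V}) (iVH : {linear V -> H}).

Definition dotpG m (G : 'M[R]_m) (w v : nat -> H) : R :=
  \sum_(i < m) \sum_(j < m) G i j * dotp (w i) (v j).

Definition modified_energy (L : {linear S -> V}) (M : V -> V -> R)
    (F : S -> d.-tuple R -> R) (lf : R) (k : nat) (Bh mu : nat -> R)
    (Ga : 'M[R]_k.-1) (GB : 'M[R]_k) (tau : R) (u : nat -> S) (n : nat) : R :=
  - tau^-1 * dotpG Ga (fun i => iSH iSV iVH (delta u (n - i)%N))
               (fun i => MinvH iVH M (iSH iSV iVH (delta u (n - i)%N)))
  + dotpG GB (fun i => iSH iSV iVH (u (n - i)%N))
             (fun i => iVH (L (u (n - i)%N)))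
  + \sum_(i < k) mu i * potential_energy F (u (n - i)%N)
  + lf / 2 * \sum_(1 <= i < k)
      chat k Bh mu i * `|iSH iSV iVH (delta u (n.+1 - i)%N)| ^+ 2.

End modified_energy.

(* Main.v *)
Require Import Defs.
From mathcomp Require Import all_boot all_order all_algebra.
From mathcomp Require Import complex zify ring lra.
From mathcomp Require Import polyrcf.
From mathcomp Require Import all_classical all_reals all_analysis.
Import Order.TTheory GRing.Theory Num.Theory.
Set Implicit Arguments.
Unset Strict Implicit.
Unset Printing Implicit Defensive.
Import numFieldNormedType.Exports.
Local Open Scope classical_set_scope.
Local Open Scope ring_scope.

(** The theorem combines a matrix statement with an energy estimate.

The matrices.  In both cases a vector [s] (the multiplier) meets a vector [t]
(the scheme), and the hypothesis on the unit circle says that the cosine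
polynomial [sum_ij s_i t_j cos ((i - j) theta)] dominates the one of a rank one
penalty [c d d^T].  By [Fejer_Riesz] the difference is the squared modulus of a
real polynomial with coefficient vector [g], so that the symmetric matrix
[(s t^T + t s^T) / 2 - c d d^T - g g^T] has vanishing diagonal sums.  Such a
matrix is a padded matrix [G] minus its own diagonal shift
([spectral_telescope]), and this [G] is the matrix of the theorem:
[(s.x) (t.x) = G(new) - G(old) + c (d.x)^2 + (g.x)^2], where [x] is a window of
a sequence, and [new] and [old] are its two subwindows.

Positivity of [G] is a Lyapunov argument.  Along a solution of the recurrence
[s.x = 0] the left side is zero, so [G] decreases; solutions tend to zero for
[s = mu], whose roots are in the open disc ([root_in_disc]: the unit circle is
excluded by the first positivity hypothesis), and become nearly constant for
[s = nu], that is [mu] times [z - 1], where [G(1,...,1) = 1/2].  Hence [G >= 0]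
([quad_form_ge0]).  At a null vector the quadratic polynomial in the free new
entry is nonnegative with a root, so the solution of the first recurrence also
solves the second one, and no penalty is paid; its new entries vanish (for [nu]
they are constant, and the coefficients of [B] sum to one), and
coprimality, in the form [s_r != 0] or [t_r != 0], makes the old ones vanish too
([quad_form_definite]).

The energy.  The balance identity is linear in the numbers [x_i x_j], so it also
holds for the Gram numbers of a symmetric form.  It is applied to the form
[(u, -M^-1 v)], where [M^-1] is given by [Riesz_representation], and to
[(L u, v)].  Testing the scheme with [sum_i mu_i delta u^(n+1-i)] then gives the
decay of the quadratic part of the energy, with the gain
[alpha / tau |(-M)^(-1/2) v|^2 + beta |L^(1/2) v|^2] for [v = delta u^(n+1)].
The explicit terms are compared with the increments of the potential by the
Lipschitz bound ([nonlinear_bound]); after the telescoping of the weights what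
remains is [lf chat_0 / 2 |v|^2], which the gain absorbs by interpolation and the
weighted inequality of the means ([interpolation_absorb]).  The threshold
[tau_max] is exactly the step at which the constants match.

For the sign of the energy, [sum_i mu_i F(u^(n-i))] is compared with [F] at the
affine combination [sum_i mu_i u^(n-i)], where first-order terms cancel
([affine_potential_ge]); the quadratic error is a weighted variance, bounded by
the increments with the weights [cbar_i] ([variance_le]).  What is missing
when [c_min < 0] is absorbed by the lower bounds of the two matrices, with
[lambda_B / 4] because [|L^(1/2) (u - v)|^2] is at most
[2 |L^(1/2) u|^2 + 2 |L^(1/2) v|^2] and each value enters two increments. *)

(** * Sums of squares on the unit circle *)

(** [P(cos theta) = |g(e^(i theta))|^2], written with the Joukowski variable
    [(z + 1/z) / 2] of a nonzero real [z]: a Laurent polynomial is determined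
    by these values, which keeps the arithmetic real. *)
Definition autocorrelates (R : realType) (P g : {poly R}) : Prop :=
  forall z : R, z != 0 -> P.[(z + z^-1) / 2] = g.[z] * g.[z^-1].

Lemma autocorrelates_mul (R : realType) (P1 P2 g1 g2 : {poly R}) :
  autocorrelates P1 g1 -> autocorrelates P2 g2 ->
  autocorrelates (P1 * P2) (g1 * g2).
Proof. by move=> h1 h2 z z0; rewrite !hornerM h1// h2//; ring. Qed.

Lemma autocorrelates_const (R : realType) (c : R) : 0 <= c ->
  autocorrelates c%:P (Num.sqrt c)%:P.
Proof. by move=> c0 z _; rewrite !hornerC -expr2 sqr_sqrtr. Qed.

(** [x = (z + 1/z) / 2] turns [(z - w) (1/z - w)] into [1 + w^2 - 2 w x], which
    vanishes at [x = a] when [w + 1/w = 2 a]; a real [w] exists since [|a| >= 1].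
    The sign [e] makes the factor nonnegative between [-1] and [1]. *)
Lemma autocorrelates_linear (R : realType) (a e : R) : e ^+ 2 = 1 -> 1 <= e * a ->
  exists g : {poly R}, size g = 2%N /\ autocorrelates (e *: (a%:P - 'X)) g.
Proof.
move=> e2 ea; pose w := e * a + Num.sqrt ((e * a) ^+ 2 - 1).
have d0 : 0 <= (e * a) ^+ 2 - 1 by nra.
have sd := sqr_sqrtr d0.
have w0 : 0 < w by rewrite /w ltr_wpDr ?sqrtr_ge0//; lra.
have ww : w ^+ 2 + 1 = 2 * w * (e * a).
  by rewrite /w; set s := Num.sqrt _ in sd *; nra.
set c := Num.sqrt (2 * w)^-1.
have c0 : c != 0 by rewrite sqrtr_eq0 -ltNge invr_gt0; lra.
have c2 : c ^+ 2 = (2 * w)^-1 by rewrite sqr_sqrtr// invr_ge0; lra.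
exists (c *: ('X - (e * w)%:P)); split; first by rewrite size_scale// size_XsubC.
move=> z z0; rewrite !(hornerE) /=.
transitivity (c ^+ 2 * (e ^+ 2 * w ^+ 2 + 1 - e * w * (z + z^-1))); last by field.
by rewrite c2 e2 mul1r ww; field; rewrite z0; lra.
Qed.

(** With [g = z^2 - s z + p], [g(z) g(1/z)] is a quadratic polynomial in [x] with
    leading coefficient [4 p].  Matching the root [a + i b] requires
    [s (1 + p) = 4 p a], and then [m = (1 + p)^2 / (4 p)] has to solve
    [m^2 - (1 + a^2 + b^2) m + a^2 = 0]; its larger root is at least 1, which makes
    [p] real and positive.  The case [b = 0] serves the double real roots. *)
Lemma autocorrelates_quadratic (R : realType) (a b : R) :
  exists g : {poly R}, size g = 3%N /\
    autocorrelates (('X - a%:P) ^+ 2 + (b ^+ 2)%:P) g.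
Proof.
pose t := 1 + a ^+ 2 + b ^+ 2.
have D0 : 0 <= t ^+ 2 - 4 * a ^+ 2.
  rewrite /t; have -> : (1 + a ^+ 2 + b ^+ 2) ^+ 2 - 4 * a ^+ 2 =
    (1 + b ^+ 2 - a ^+ 2) ^+ 2 + 4 * a ^+ 2 * b ^+ 2 by ring.
  by rewrite addr_ge0 ?sqr_ge0// mulr_ge0 ?sqr_ge0// mulr_ge0 ?sqr_ge0.
pose m := (t + Num.sqrt (t ^+ 2 - 4 * a ^+ 2)) / 2.
have mE : m ^+ 2 = t * m - a ^+ 2.
  have := sqr_sqrtr D0; rewrite /m; set s := Num.sqrt _ => sE.
  by lra.
have m1 : 1 <= m.
  have s0 : `|1 + b ^+ 2 - a ^+ 2| <= Num.sqrt (t ^+ 2 - 4 * a ^+ 2).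
    rewrite -sqrtr_sqr ler_sqrt// /t.
    by have := sqr_ge0 (a * b); rewrite exprMn; nra.
  have := ler_norm (- (1 + b ^+ 2 - a ^+ 2)).
  rewrite normrN => h; have := sqr_ge0 b.
  have := ler_norm ((1 + b ^+ 2 - a ^+ 2)).
  by rewrite /m /t; rewrite /t in s0; lra.
have E0 : 0 <= m ^+ 2 - m by nra.
pose p := 2 * m - 1 + 2 * Num.sqrt (m ^+ 2 - m).
have p1 : 1 <= p by rewrite /p; have := sqrtr_ge0 (m ^+ 2 - m); lra.
have pE : (1 + p) ^+ 2 = 4 * p * m.
  by have := sqr_sqrtr E0; rewrite /p; set s := Num.sqrt _ => sE; nra.
pose s := 4 * p * a / (1 + p).
have p1' : 1 + p != 0 by lra.
have m0 : m != 0 by lra.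
have sE : s * (1 + p) = 4 * p * a by rewrite /s; field.
have s2E : (1 - p) ^+ 2 + s ^+ 2 = 4 * p * (a ^+ 2 + b ^+ 2).
  apply: (mulIf m0); apply: (mulIf (_ : 4 * p != 0)); first by lra.
  have h1 : s ^+ 2 * (4 * p * m) = (4 * p * a) ^+ 2 by rewrite -pE -sE; ring.
  have h2 : (1 - p) ^+ 2 = 4 * p * m - 4 * p by rewrite -pE; ring.
  rewrite h2.
  transitivity (16 * p ^+ 2 * (m ^+ 2 - m) + s ^+ 2 * (4 * p * m)); first by ring.
  by rewrite h1 mE /t; ring.
clearbody s; clearbody p.
set c := Num.sqrt (4 * p)^-1.
have c0 : c != 0 by rewrite sqrtr_eq0 -ltNge invr_gt0; lra.
have c2 : c ^+ 2 = (4 * p)^-1 by rewrite sqr_sqrtr// invr_ge0; lra.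
exists (c *: ('X ^+ 2 + (- s *: 'X + p%:P))); split.
  rewrite size_scale// size_polyDl ?size_polyXn//.
  rewrite (leq_ltn_trans (size_polyD _ _))// gtn_max.
  rewrite (leq_ltn_trans (size_scale_leq _ _)) ?size_polyX//=.
  by rewrite (leq_ltn_trans (size_polyC_leq1 _)).
move=> z z0; rewrite !hornerE /=.
transitivity (c ^+ 2 * (p * (z + z^-1) ^+ 2 + ((1 - p) ^+ 2 + s ^+ 2)
                        - (s * (1 + p)) * (z + z^-1))); last by field.
by rewrite c2 sE s2E; field; rewrite z0; lra.
Qed.

Lemma poly_neg_nbhd (R : realType) (p : {poly R}) (a : R) : p.[a] < 0 ->
  exists2 d, 0 < d & forall y, `|y - a| < d -> p.[y] < 0.
Proof.
move=> pa; have [|d d0 h] := poly_cont a p (e := - p.[a]); first by lra.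
exists d => // y /h /ltr_normlW; lra.
Qed.

(** A nonreal root of a real polynomial brings its conjugate; the remainder of
    the division by the real quadratic has degree at most one and a nonreal root,
    so it is zero. *)
Lemma real_poly_factor (R : realType) (P : {poly R}) : (1 < size P)%N ->
  (exists a, root P a) \/
  exists a b, b != 0 /\ (('X - a%:P) ^+ 2 + (b ^+ 2)%:P) %| P.
Proof.
move=> P1; have : size (map_poly (real_complex R) P) != 1%N.
  by rewrite size_map_poly gtn_eqF.
move=> /closed_rootP[[a b]] Pw.
have [b0|b0] := eqVneq b 0.
  by left; exists a; rewrite b0 in Pw; rewrite -(fmorph_root (real_complex R)).
right; exists a, b; split=> //.
pose q : {poly R} := ('X - a%:P) ^+ 2 + (b ^+ 2)%:P.
have qw : (map_poly (real_complex R) q).[(a +i* b)%C] = 0.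
  rewrite /q rmorphD /= rmorphXn /= rmorphB /= map_polyX !map_polyC /=.
  rewrite !hornerE /=.
  by apply/eqP; rewrite eq_complex /=; apply/andP; split; apply/eqP; ring.
have q3 : size q = 3%N.
  rewrite size_polyDl ?size_exp_XsubC//.
  by rewrite (leq_ltn_trans (size_polyC_leq1 _)).
have : (map_poly (real_complex R) (P %% q)).[(a +i* b)%C] = 0.
  move: Pw; rewrite /root {1}(divp_eq P q) rmorphD rmorphM /= hornerD hornerM.
  by rewrite qw mulr0 add0r => /eqP.
have r3 : (size (P %% q)%R < 3)%N by rewrite -q3 ltn_modp -size_poly_eq0 q3.
have rE : P %% q = (P %% q)`_1 *: 'X + ((P %% q)`_0)%:P.
  apply/polyP => -[|[|i]]; rewrite !coefE /= ?mulr0 ?mulr1 ?add0r ?addr0//.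
  by rewrite nth_default ?(leq_trans (ltnSE r3)) ?addn0 ?mulr0 ?addr0 // mulr0.
rewrite rE rmorphD /= linearZ /= map_polyX map_polyC /= !hornerE /=.
move/eqP; rewrite eq_complex /= => /andP[/eqP h1 /eqP h2].
have c1 : (P %% q)`_1 = 0.
  apply/eqP; have /eqP : (P %% q)`_1 * b = 0 by lra.
  by rewrite mulf_eq0 (negbTE b0) orbF.
have c0 : (P %% q)`_0 = 0 by rewrite c1 in h1; lra.
by rewrite /dvdp rE c1 c0 scale0r add0r.
Qed.

(** Factors of [P] are removed one at a time: a pair of conjugate roots, a real
    root outside ]-1, 1[, or a real root inside, which is double because [P] does
    not change sign.  Positivity is asked on the open interval, so that it passes
    to the quotient without a limit at the end points. *)
Lemma Fejer_Riesz (R : realType) (P : {poly R}) :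
  (forall x, -1 < x < 1 -> 0 <= P.[x]) ->
  exists g : {poly R}, (size g <= size P)%N /\ autocorrelates P g.
Proof.
have [n] := ubnP (size P); elim: n P => // n IHn P /ltnSE Pn P0.
have [szP|szP] := leqP (size P) 1%N.
  have PC := size1_polyC szP; have c0 : 0 <= P`_0.
    by have := P0 0; rewrite PC hornerC coefC; apply; lra.
  exists (Num.sqrt P`_0)%:P; split; last by rewrite {1}PC; exact: autocorrelates_const.
  rewrite {2}PC !size_polyC; have [->|_] := eqVneq P`_0 0; last exact: leq_b1.
  by rewrite sqrtr0 eqxx.
have Pn0 : P != 0 by rewrite -size_poly_gt0 (ltn_trans _ szP).
have step (P1 q g : {poly R}) m : P = P1 * q -> (1 < size q)%N -> size q = m ->
    size g = m -> autocorrelates q g ->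
    (forall x, -1 < x < 1 -> 0 <= P1.[x]) ->
    exists g : {poly R}, (size g <= size P)%N /\ autocorrelates P g.
  move=> PE q1 qm gm qg P10.
  have P1n0 : P1 != 0 by apply: contraNneq Pn0; rewrite PE => ->; rewrite mul0r.
  have qn0 : q != 0 by rewrite -size_poly_gt0 (ltn_trans _ q1).
  have sP : size P = (size P1 + size q).-1 by rewrite PE size_mul.
  have [|g1 [g1P1 g1E]] := IHn P1 _ P10.
    by move: Pn; rewrite sP; case: (size q) q1 => [|[|k]] //= _; lia.
  exists (g1 * g); split; last by rewrite PE; exact: autocorrelates_mul.
  rewrite sP (leq_trans (size_polyMleq _ _))// gm qm; lia.
have step2 (P1 : {poly R}) (a b : R) : P = P1 * (('X - a%:P) ^+ 2 + (b ^+ 2)%:P) ->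
    (forall x, -1 < x < 1 -> 0 <= P1.[x]) ->
    exists g : {poly R}, (size g <= size P)%N /\ autocorrelates P g.
  have [g [g3 gE]] := autocorrelates_quadratic a b.
  have q3 : size (('X - a%:P) ^+ 2 + (b ^+ 2)%:P) = 3%N.
    rewrite size_polyDl ?size_exp_XsubC//.
    by rewrite (leq_ltn_trans (size_polyC_leq1 _)).
  by move=> PE P10; apply: (step P1 _ g 3%N PE) => //; rewrite q3.
have step1 (P1 : {poly R}) (a e : R) :
    P = P1 * (e *: (a%:P - 'X)) -> e ^+ 2 = 1 -> 1 <= e * a ->
    exists g : {poly R}, (size g <= size P)%N /\ autocorrelates P g.
  move=> PE e2 ea; have [g [g2 gE]] := autocorrelates_linear e2 ea.
  have e0 : e != 0 by apply: contra_eq_neq e2 => ->; rewrite expr0n /= eq_sym oner_eq0.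
  have q2 : size (e *: (a%:P - 'X)) = 2%N.
    by rewrite size_scale// -opprB size_polyN size_XsubC.
  apply: (step P1 _ g 2%N PE) => //; first by rewrite q2.
  move=> x x1; have := P0 x x1.
  rewrite PE hornerM hornerZ hornerD hornerN hornerX hornerC.
  rewrite pmulr_lge0//; have : (e == 1) || (e == -1) by rewrite -sqrf_eq1 e2.
  case/andP: x1 => x1 x2; case/orP => /eqP eE; move: ea; rewrite eE; lra.
have [[a aP]|[a [b [b0 /dvdpP[P1' PE]]]]] := real_poly_factor szP; last first.
  apply: (step2 P1' a b PE) => x x1; have := P0 x x1; rewrite PE !hornerE /=.
  rewrite pmulr_lge0// ltr_wpDl ?sqr_ge0//.
  by rewrite lt_neqAle sqr_ge0 eq_sym sqrf_eq0 b0.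
have /factor_theorem[P1' PE] := aP.
have [a1|a1] := leP 1 a.
  by apply: (step1 (- P1') a 1); rewrite ?expr1n ?mul1r// PE scale1r; ring.
have [a2|a2] := leP a (-1).
  apply: (step1 P1' a (-1)).
  - by rewrite PE scaleN1r opprB.
  - by rewrite sqrrN expr1n.
  - by rewrite mulN1r lerNr.
(* [P1'] changes sign where [X - a] does, since [P] is nonnegative. *)
have rootP1 : P1'.[a] = 0.
  have [h|h|//] := ltgtP P1'.[a] 0.
    have [d d0 dP] := poly_neg_nbhd h.
    pose y := Num.min (a + d / 2) ((a + 1) / 2).
    have ya : a < y by rewrite /y lt_min; apply/andP; split; lra.
    have yd : y <= a + d / 2 by rewrite /y ge_min lexx.
    have y1 : y <= (a + 1) / 2 by rewrite /y ge_min lexx orbT.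
    have /dP : `|y - a| < d by rewrite gtr0_norm; lra.
    have : 0 <= P.[y] by apply: P0; lra.
    by rewrite PE !hornerE pmulr_lge0; lra.
  have h' : (- P1').[a] < 0 by rewrite hornerN; lra.
  have [d d0 dP] := poly_neg_nbhd h'.
  pose y := Num.max (a - d / 2) ((a - 1) / 2).
  have ya : y < a by rewrite /y gt_max; apply/andP; split; lra.
  have yd : a - d / 2 <= y by rewrite /y le_max lexx.
  have y1 : (a - 1) / 2 <= y by rewrite /y le_max lexx orbT.
  have /dP : `|y - a| < d by rewrite ltr0_norm; lra.
  have : 0 <= P.[y] by apply: P0; lra.
  by rewrite PE !hornerE => ? ?; nra.
have /factor_theorem[P2 P1E] : root P1' a by apply/rootP.
have PE2 : P = P2 * (('X - a%:P) ^+ 2 + (0 ^+ 2)%:P).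
  by rewrite PE P1E expr0n /= addr0 -mulrA.
apply: (step2 P2 a 0 PE2) => x x1.
have P2off y : -1 < y < 1 -> y != a -> 0 <= P2.[y].
  move=> y1 ya; have := P0 y y1; rewrite PE2 !hornerE /= expr0n /= addr0.
  by rewrite pmulr_lge0// lt_neqAle sqr_ge0 eq_sym sqrf_eq0 subr_eq0 ya.
have [xa|] := eqVneq x a; last exact: P2off.
rewrite xa leNgt; apply/negP => /poly_neg_nbhd[d d0 dP].
pose y := Num.min (a + d / 2) ((a + 1) / 2).
have ya : a < y by rewrite /y lt_min; apply/andP; split; lra.
have yd : y <= a + d / 2 by rewrite /y ge_min lexx.
have y1 : y <= (a + 1) / 2 by rewrite /y ge_min lexx orbT.
have /dP : `|y - a| < d by rewrite gtr0_norm; lra.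
by apply/negP; rewrite -leNgt P2off ?gt_eqF//; lra.
Qed.

(** * Matrices with vanishing diagonal sums *)

Fixpoint chebyshev (R : realType) n : {poly R} :=
  if n is n'.+1 then
    if n' is n''.+1 then 2 *: ('X * chebyshev R n') - chebyshev R n'' else 'X
  else 1.

Lemma chebyshev_rec (R : realType) n :
  chebyshev R n.+2 = 2 *: ('X * chebyshev R n.+1) - chebyshev R n.
Proof. by []. Qed.

Lemma size_chebyshev (R : realType) n : (size (chebyshev R n) <= n.+1)%N.
Proof.
elim/ltn_ind: n => -[|[|n]] IH; rewrite ?size_poly1 ?size_polyX//.
have h0 := IH n (leqnSn n.+1); have h1 := IH n.+1 (leqnn _).
have h2 : (size ('X * chebyshev R n.+1)%R <= n.+3)%N.
  by rewrite (leq_trans (size_polyMleq _ _))// size_polyX.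
rewrite chebyshev_rec (leq_trans (size_polyD _ _))// geq_max size_polyN.
by rewrite (leq_trans (size_scale_leq _ _) h2) (leq_trans h0 (leqW (leqnSn _))).
Qed.

Lemma chebyshev_joukowski (R : realType) n (z : R) : z != 0 ->
  (chebyshev R n).[(z + z^-1) / 2] = (z ^+ n + z^-1 ^+ n) / 2.
Proof.
move=> z0; elim/ltn_ind: n => -[|[|n]] IH.
- by rewrite hornerC !expr0; field.
- by rewrite hornerX !expr1.
rewrite chebyshev_rec hornerD hornerN hornerZ hornerM hornerX !IH//.
by rewrite !exprSr; field.
Qed.

Lemma chebyshev_cos (R : realType) n (theta : R) :
  (chebyshev R n).[cos theta] = cos (n%:R * theta).
Proof.
elim/ltn_ind: n => -[|[|n]] IH.
- by rewrite hornerC mul0r cos0.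
- by rewrite hornerX mul1r.
rewrite chebyshev_rec hornerD hornerN hornerZ hornerM hornerX !IH//.
have -> : n.+2%:R * theta = n.+1%:R * theta + theta by rewrite -natr1; ring.
have -> : n%:R * theta = n.+1%:R * theta - theta by rewrite -natr1; ring.
by rewrite cosB cosD; ring.
Qed.

(** The polynomial whose value at [cos theta] is
    [sum_ij Q_ij cos ((i - j) theta)]. *)
Definition symbol (R : realType) r (Q : nat -> nat -> R) : {poly R} :=
  \sum_(i < r.+1) \sum_(j < r.+1) Q i j *: chebyshev R ((i - j) + (j - i)).

Lemma symbol_cos (R : realType) r (Q : nat -> nat -> R) (theta : R) :
  (symbol r Q).[cos theta] =
  \sum_(i < r.+1) \sum_(j < r.+1) Q i j * cos ((i%:R - j%:R) * theta).
Proof.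
rewrite /symbol horner_sum; apply: eq_bigr => i _.
rewrite horner_sum; apply: eq_bigr => j _; rewrite hornerZ chebyshev_cos.
have [ij|/ltnW ij] := leqP i j.
  rewrite (eqP (_ : i - j == 0)%N)// add0n natrB// -cosN.
  by congr (_ * cos _); ring.
by rewrite (eqP (_ : j - i == 0)%N)// addn0 natrB.
Qed.

Lemma poly_nonzero_roots (R : realType) (p : {poly R}) :
  (forall z, z != 0 -> p.[z] = 0) -> p = 0.
Proof.
move=> p0; apply/eqP; apply: contraT => pn0.
have := max_poly_roots (rs := [seq i.+1%:R | i <- iota 0 (size p)]) pn0.
rewrite size_map size_iota ltnn; apply; last first.
  by rewrite map_inj_uniq ?iota_uniq// => i j /eqP; rewrite eqr_nat => /eqP[].
by apply/allP => _ /mapP[i _ ->]; apply/rootP/p0; rewrite pnatr_eq0.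
Qed.

(** The sums over the diagonals of [Q] are the coefficients of the Laurent
    polynomial [sum_ij Q_ij z^(i - j)]. *)
Lemma diagonal_sums0 (R : realType) r (Q : nat -> nat -> R) :
  (forall i j, Q i j = Q j i) ->
  (forall z : R, z != 0 -> \sum_(i < r.+1) \sum_(j < r.+1)
     Q i j * ((z ^+ i * z^-1 ^+ j + z ^+ j * z^-1 ^+ i) / 2) = 0) ->
  forall i, (i <= r)%N -> \sum_(l < i.+1) Q (i - l)%N (r - l)%N = 0.
Proof.
move=> Qsym Q0 i0 i0r.
pose D : {poly R} := \sum_(i < r.+1) \sum_(j < r.+1) Q i j *: 'X^(r + i - j).
have D0 : D = 0.
  apply: poly_nonzero_roots => z z0; rewrite -[RHS](mulr0 (z ^+ r)) -(Q0 z z0).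
  rewrite /D horner_sum.
  have -> : \sum_(i < r.+1) (\sum_(j < r.+1) Q i j *: 'X^(r + i - j)).[z] =
      z ^+ r * \sum_(i < r.+1) \sum_(j < r.+1) Q i j * (z ^+ i * z^-1 ^+ j).
    rewrite mulr_sumr; apply: eq_bigr => i _; rewrite horner_sum mulr_sumr.
    apply: eq_bigr => j _; rewrite hornerZ hornerXn.
    have jr : (j <= r + i)%N by rewrite (leq_trans (ltnSE (ltn_ord j)))// leq_addr.
    by rewrite expfB_cond ?(negbTE z0)// exprD exprVn; ring.
  congr (_ * _).
  pose S := \sum_(i < r.+1) \sum_(j < r.+1) Q i j * (z ^+ i * z^-1 ^+ j).
  have SE : \sum_(i < r.+1) \sum_(j < r.+1) Q i j * (z ^+ j * z^-1 ^+ i) = S.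
    rewrite exchange_big /=; apply: eq_bigr => i _; apply: eq_bigr => j _.
    by rewrite Qsym.
  transitivity (2^-1 * (S + S)); first by rewrite -/S; field.
  rewrite -{2}SE /S -big_split mulr_sumr; apply: eq_bigr => i _ /=.
  by rewrite -big_split mulr_sumr; apply: eq_bigr => j _ /=; field.
have : D`_i0 = 0 by rewrite D0 coef0.
rewrite /D coef_sum.
under eq_bigr => i _ do rewrite coef_sum.
rewrite exchange_big /= (reindex_inj rev_ord_inj) /= => D00.
rewrite -[RHS]D00; apply: esym.
rewrite (big_ord_widen r.+1 (fun l => Q (i0 - l)%N (r - l)%N))//.
rewrite [LHS](bigID (fun l : 'I_r.+1 => (l < i0.+1)%N)) /= [X in _ + X]big1 ?addr0.
  apply: eq_bigr => l li0; have lr := ltn_ord l.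
  have ir : (i0 - l < r.+1)%N by lia.
  rewrite (bigD1 (Ordinal ir))//= big1 ?addr0.
    rewrite coefZ coefXn subSS (_ : i0 == _) ?mulr1//; apply/eqP; lia.
  move=> i /eqP il; rewrite coefZ coefXn subSS (_ : (i0 == _) = false) ?mulr0//.
  apply/eqP => h; apply: il; apply/val_inj => /=; have := ltn_ord i; lia.
move=> l li0; rewrite big1// => i _; rewrite coefZ coefXn subSS.
have := ltn_ord l => lr.
by rewrite (_ : (i0 == _) = false) ?mulr0//; apply/eqP; lia.
Qed.

(** The solution of [G_ij - G_(i-1)(j-1) = Q_ij]: the partial sum of [Q] along the
    diagonal through [(i, j)]. *)
Definition diag_sum (R : realType) (Q : nat -> nat -> R) i j : R :=
  \sum_(l < (minn i j).+1) Q (i - l)%N (j - l)%N.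

Lemma sum_corner (V : nmodType) r (f : nat -> nat -> V) :
  \sum_(i < r.+1) \sum_(j < r.+1) f i j =
  f 0%N 0%N + \sum_(j < r) f 0%N j.+1 + \sum_(i < r) f i.+1 0%N +
  \sum_(i < r) \sum_(j < r) f i.+1 j.+1.
Proof.
under eq_bigr => i _ do rewrite big_ord_recl.
rewrite big_split /= big_ord_recl.
by rewrite [X in _ + X = _]big_ord_recl /= addrACA -!addrA.
Qed.

(** The identity is linear in the weights [k], which are arbitrary so that they can
    be products [x_i x_j] as well as scalar products of vectors. *)
Lemma diag_sum_telescope (R : realType) r (Q k : nat -> nat -> R) :
  (forall i, (i <= r)%N -> diag_sum Q i r = 0 /\ diag_sum Q r i = 0) ->
  \sum_(i < r.+1) \sum_(j < r.+1) Q i j * k i j =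
  \sum_(i < r) \sum_(j < r) diag_sum Q i j * k i j -
  \sum_(i < r) \sum_(j < r) diag_sum Q i j * k i.+1 j.+1.
Proof.
move=> Q0.
have rec i j : diag_sum Q i.+1 j.+1 = Q i.+1 j.+1 + diag_sum Q i j.
  by rewrite /diag_sum minnSS big_ord_recl.
have row0 j : diag_sum Q 0 j = Q 0%N j.
  by rewrite /diag_sum min0n big_ord1 !subn0.
have col0 i : diag_sum Q i 0 = Q i 0%N.
  by rewrite /diag_sum minn0 big_ord1 !subn0.
have -> : \sum_(i < r) \sum_(j < r) diag_sum Q i j * k i j =
    \sum_(i < r.+1) \sum_(j < r.+1) diag_sum Q i j * k i j.
  rewrite big_ord_recr /= [X in _ + X]big1 ?addr0; last first.
    by move=> j _; rewrite (Q0 j _).2 ?mul0r// -ltnS.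
  apply: eq_bigr => i _; rewrite big_ord_recr /= (Q0 i _).1 ?mul0r ?addr0//.
  exact/ltnW.
rewrite (sum_corner r (fun i j => Q i j * k i j)).
rewrite (sum_corner r (fun i j => diag_sum Q i j * k i j)) /= -[RHS]addrA -sumrB.
congr (_ + _ + _).
- by congr (_ + _); [rewrite row0 | apply: eq_bigr => j _; rewrite row0].
- by apply: eq_bigr => i _; rewrite col0.
apply: eq_bigr => i _; rewrite -sumrB; apply: eq_bigr => j _.
by rewrite rec mulrDl addrK.
Qed.

(** The spectral factor [g] removes exactly the diagonal sums of [Q], and what is
    left telescopes. *)
Lemma spectral_telescope (R : realType) r (Q : nat -> nat -> R) :
  (forall i j, Q i j = Q j i) ->
  (forall theta, 0 <= theta <= pi -> 0 <= (symbol r Q).[cos theta]) ->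
  exists (G : nat -> nat -> R) (g : nat -> R), (forall i j, G i j = G j i) /\
    forall k : nat -> nat -> R,
      \sum_(i < r.+1) \sum_(j < r.+1) Q i j * k i j =
      \sum_(i < r) \sum_(j < r) G i j * k i j -
      \sum_(i < r) \sum_(j < r) G i j * k i.+1 j.+1 +
      \sum_(i < r.+1) \sum_(j < r.+1) g i * g j * k i j.
Proof.
move=> Qsym Q0.
have [|p [szp pE]] := Fejer_Riesz (P := symbol r Q).
  move=> x /andP[x1 x2]; rewrite -(acosK (x := x)) ?in_itv /= ?(ltW x1) ?(ltW x2)//.
  by apply: Q0; rewrite acos_ge0 ?acos_lepi ?(ltW x1) ?(ltW x2).
have szr : (size p <= r.+1)%N.
  rewrite (leq_trans szp)// /symbol.
  apply: (big_ind (fun q : {poly R} => size q <= r.+1)%N); rewrite ?size_poly0//.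
    by move=> q1 q2 h1 h2; rewrite (leq_trans (size_polyD _ _))// geq_max h1.
  move=> i _; apply: (big_ind (fun q : {poly R} => size q <= r.+1)%N); rewrite ?size_poly0//.
    by move=> q1 q2 h1 h2; rewrite (leq_trans (size_polyD _ _))// geq_max h1.
  move=> j _; rewrite (leq_trans (size_scale_leq _ _))//.
  rewrite (leq_trans (size_chebyshev _ _))//.
  by have := ltn_ord i; have := ltn_ord j; lia.
pose Q' i j := Q i j - p`_i * p`_j.
have Q'sym i j : Q' i j = Q' j i by rewrite /Q' Qsym mulrC.
have Q'0 : forall i, (i <= r)%N -> \sum_(l < i.+1) Q' (i - l)%N (r - l)%N = 0.
  apply: diagonal_sums0 => // z z0.
  pose w i j : R := (z ^+ i * z^-1 ^+ j + z ^+ j * z^-1 ^+ i) / 2.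
  transitivity (\sum_(i < r.+1) \sum_(j < r.+1) Q i j * w i j -
                \sum_(i < r.+1) \sum_(j < r.+1) p`_i * p`_j * w i j).
    rewrite -sumrB; apply: eq_bigr => i _; rewrite -sumrB; apply: eq_bigr => j _.
    by rewrite /Q' mulrBl.
  have wE i j : w i j = (chebyshev R ((i - j) + (j - i))).[(z + z^-1) / 2].
    rewrite chebyshev_joukowski// /w.
    have zV m n : (n <= m)%N -> z ^+ m * z^-1 ^+ n = z ^+ (m - n).
      by move=> nm; rewrite -{1}(subnK nm) exprD exprVn mulfK// expf_neq0.
    have zV' m n : (n <= m)%N -> z ^+ n * z^-1 ^+ m = z^-1 ^+ (m - n).
      move=> nm; rewrite -{1}(subnK nm) exprD mulrCA -exprMn mulfV//.
      by rewrite expr1n mulr1.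
    have [ij|/ltnW ij] := leqP i j.
      by rewrite (eqP (_ : i - j == 0)%N)// add0n (zV j i)// (zV' j i)// addrC.
    by rewrite (eqP (_ : j - i == 0)%N)// addn0 zV// zV'.
  have := pE z z0; rewrite /symbol horner_sum.
  under eq_bigr => i _ do rewrite horner_sum.
  under eq_bigr => i _ do under eq_bigr => j _ do rewrite hornerZ -wE.
  move=> ->; apply/eqP; rewrite subr_eq0; apply/eqP.
  rewrite !(horner_coef_wide _ szr) mulr_suml.
  pose S := \sum_(i < r.+1) \sum_(j < r.+1) p`_i * p`_j * (z ^+ i * z^-1 ^+ j).
  have SE : \sum_(i < r.+1) \sum_(j < r.+1) p`_i * p`_j * (z ^+ j * z^-1 ^+ i) = S.
    rewrite exchange_big /=; apply: eq_bigr => i _; apply: eq_bigr => j _; ring.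
  transitivity S.
    apply: eq_bigr => i _; rewrite mulr_sumr; apply: eq_bigr => j _; ring.
  transitivity (2^-1 * (S + S)); first by field.
  rewrite -{2}SE /S -big_split mulr_sumr; apply: eq_bigr => i _ /=.
  by rewrite -big_split mulr_sumr; apply: eq_bigr => j _ /=; rewrite /w; field.
have dsym i j : diag_sum Q' i j = diag_sum Q' j i.
  by rewrite /diag_sum minnC; apply: eq_bigr => l _; rewrite Q'sym.
exists (diag_sum Q'), (fun i => p`_i); split=> // k.
rewrite -diag_sum_telescope.
  rewrite -big_split; apply: eq_bigr => i _; rewrite -big_split.
  by apply: eq_bigr => j _; rewrite /= -mulrDl /Q' subrK.
move=> i ir; have d0 : diag_sum Q' i r = 0.
  by rewrite /diag_sum (minn_idPl ir) Q'0.
by split=> //; rewrite dsym.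
Qed.

(** * Stable linear recurrences *)

(** The polynomial [p] of the shift operator, applied to the sequence [X]. *)
Definition shift_apply (K : numFieldType) (p : {poly K}) (X : nat -> K) n : K :=
  \sum_(i < size p) p`_i * X (n + i)%N.

Lemma shift_apply_wide (K : numFieldType) (p : {poly K}) (X : nat -> K) n N :
  (size p <= N)%N -> shift_apply p X n = \sum_(i < N) p`_i * X (n + i)%N.
Proof.
move=> pN; rewrite /shift_apply (big_ord_widen N (fun i => p`_i * X (n + i)%N))//.
rewrite [RHS](bigID (fun i : 'I_N => (i < size p)%N)) /= [X in _ + X]big1 ?addr0//.
by move=> i; rewrite -leqNgt => ip; rewrite nth_default ?mul0r.
Qed.

Lemma shift_apply_mulXsubC (K : numFieldType) (p : {poly K}) (z : K) (X : nat -> K) n :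
  shift_apply (('X - z%:P) * p) X n =
  shift_apply p (fun m => X m.+1 - z * X m) n.
Proof.
rewrite (shift_apply_wide _ _ (N := (size p).+1)); last first.
  by rewrite (leq_trans (size_polyMleq _ _))// size_XsubC.
under eq_bigr => i _ do rewrite mulrBl coefB coefXM coefCM mulrBl.
rewrite sumrB big_ord_recl /= mul0r add0r [X in _ - X]big_ord_recr /=.
rewrite (nth_default _ (leqnn _)) mulr0 mul0r addr0 -sumrB.
by apply: eq_bigr => i _; rewrite mulrBr addnS [p`_i * (z * _)]mulrCA mulrA.
Qed.

Definition absolutely_summable (K : numFieldType) (X : nat -> K) : Prop :=
  exists C, forall n, \sum_(m < n) `|X m| <= C.

(** From [X_(m+1) = z X_m + Y_m], the partial sums satisfy
    [S <= |X_0| + |z| S + sum |Y_m|]. *)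
Lemma absolutely_summable_step (K : numFieldType) (z : K) (X : nat -> K) :
  `|z| < 1 -> absolutely_summable (fun m => X m.+1 - z * X m) ->
  absolutely_summable X.
Proof.
move=> z1 [C YC]; exists ((`|X 0%N| + C) / (1 - `|z|)) => n.
rewrite ler_pdivlMr ?subr_gt0// mulrBr mulr1 lerBlDr.
apply: (@le_trans _ _ (\sum_(m < n.+1) `|X m|)).
  by rewrite big_ord_recr /= lerDl.
rewrite big_ord_recl /= -addrA lerD2l.
apply: (@le_trans _ _ (\sum_(m < n) `|X m.+1 - z * X m| +
                       \sum_(m < n) `|X m| * `|z|)).
  rewrite -big_split /=; apply: ler_sum => m _.
  rewrite -[X in `|X| <= _](subrK (z * X m)) (le_trans (ler_normD _ _))//.
  by rewrite normrM [`|z| * _]mulrC.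
by rewrite -mulr_suml lerD2r.
Qed.

Lemma absolutely_summable_roots (K : numFieldType) (rs : seq K) (X : nat -> K) :
  (forall z, z \in rs -> `|z| < 1) ->
  (forall n, shift_apply (\prod_(z <- rs) ('X - z%:P)) X n = 0) ->
  absolutely_summable X.
Proof.
move=> rs1 X0.
have : absolutely_summable (shift_apply (\prod_(z <- rs) ('X - z%:P)) X).
  by exists 0 => n; rewrite big1// => m _; rewrite X0 normr0.
elim: rs rs1 X {X0} => [_|z rs IH rs1] X [C XC].
  exists C => n; apply: le_trans (XC n); rewrite le_eqVlt; apply/orP; left.
  apply/eqP/eq_bigr => i _.
  by rewrite big_nil /shift_apply size_poly1 big_ord1 coef1 mul1r addn0.
apply: (@absolutely_summable_step _ z); first by apply: rs1; rewrite mem_head.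
apply: IH; first by move=> w wrs; apply: rs1; rewrite in_cons wrs orbT.
exists C => n; apply: le_trans (XC n); rewrite le_eqVlt; apply/orP; left.
by apply/eqP/eq_bigr => i _; rewrite big_cons shift_apply_mulXsubC.
Qed.

(** The characteristic polynomial factors over the complex numbers, and each factor
    [shift - z] with [|z| < 1] can be inverted on summable sequences. *)
Lemma stable_recurrence_summable (R : realType) r (s X : nat -> R) :
  s 0%N != 0 ->
  (forall z : R[i], evalC (genpoly r s) z = 0 -> `|z| < 1) ->
  (forall n, \sum_(i < r.+1) s i * X (n + r - i)%N = 0) ->
  absolutely_summable X.
Proof.
move=> s0 sroot Xrec.
pose p : {poly R[i]} := map_poly (real_complex R) (genpoly r s).
have [rs pE] := closed_field_poly_normal p.
have szs : (size (genpoly r s) <= r.+1)%N.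
  rewrite /genpoly; apply: (big_ind (fun q : {poly R} => size q <= r.+1)%N); rewrite ?size_poly0//.
    by move=> q1 q2 h1 h2; rewrite (leq_trans (size_polyD _ _))// geq_max h1.
  by move=> i _; rewrite (leq_trans (size_scale_leq _ _))// size_polyXn ltnS leq_subr.
have coefs i : (i <= r)%N -> (genpoly r s)`_i = s (r - i)%N.
  move=> ir; rewrite /genpoly coef_sum (bigD1 (inord (r - i))) //= big1 ?addr0.
    by rewrite coefZ coefXn inordK ?subKn ?eqxx ?mulr1// ltnS leq_subr.
  move=> j /eqP ji; rewrite coefZ coefXn.
  rewrite (_ : (i == _) = false) ?mulr0//; apply/eqP => iE; apply: ji.
  by apply/val_inj; rewrite /= iE inordK ?ltnS ?leq_subr// subKn// -ltnS.
have pn0 : p != 0.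
  rewrite map_poly_eq0; apply: contraNneq s0 => g0.
  by rewrite -(subnn r) -coefs// g0 coef0.
have [C XC] : absolutely_summable (fun n => (X n)%:C%C).
  apply: (@absolutely_summable_roots _ rs).
    move=> z zrs; apply: sroot; rewrite /evalC -/p pE hornerZ.
    by rewrite (rootP _) ?mulr0// root_prod_XsubC.
  move=> n; apply: (mulfI (_ : lead_coef p != 0)); rewrite ?lead_coef_eq0// mulr0.
  transitivity (shift_apply p (fun n => (X n)%:C%C) n).
    rewrite [in RHS]pE [RHS](shift_apply_wide _ _
      (N := size (\prod_(z <- rs) ('X - z%:P)))) ?size_scale_leq//.
    by rewrite mulr_sumr; apply: eq_bigr => i _; rewrite coefZ mulrA.
  rewrite (shift_apply_wide _ _ (N := r.+1)) ?size_map_poly//.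
  rewrite -[RHS](rmorph0 (real_complex R)) -(Xrec n) rmorph_sum.
  rewrite (reindex_inj rev_ord_inj) /=; apply: eq_bigr => i _.
  have ir := ltnSE (ltn_ord i).
  rewrite coef_map /= subSS coefs ?leq_subr// subKn// rmorphM /=.
  by rewrite addnBA.
exists (complex.Re C) => n.
have XC' : (\sum_(m < n) `|X m|)%:C%C <= C.
  rewrite rmorph_sum /=; apply: le_trans (XC n); rewrite le_eqVlt; apply/orP; left.
  by apply/eqP/eq_bigr => i _; rewrite normc_def /= expr0n /= addr0 sqrtr_sqr.
by move: XC'; rewrite lecE /= => /andP[].
Qed.

Lemma absolutely_summable_cvg0 (R : realType) (X : nat -> R) :
  absolutely_summable X ->
  forall e, 0 < e -> exists N, forall n, (N <= n)%N -> `|X n| < e.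
Proof.
move=> [C XC] e e0.
have cv : cvgn (series (fun n => `|X n|)).
  apply: nondecreasing_is_cvgn.
    by apply/nondecreasing_seqP => n; rewrite /series /= big_nat_recr//= lerDl.
  exists C => _ [n _ <-]; rewrite /series /= big_mkord; exact: XC.
have := cvg_series_cvg_0 cv => /cvgrPdist_lt /(_ e e0)[N _ NP].
by exists N => n /NP /=; rewrite sub0r normrN normr_id.
Qed.

(** * Positivity of a quadratic form dissipated by a recurrence *)

(** A parabola through the origin that stays nonnegative is flat there. *)
Lemma linear_coef0_of_ge0 (R : realType) (c d : R) :
  (forall h, 0 <= c * h ^+ 2 + d * h) -> d = 0.
Proof.
move=> key; have := key 1; have := key (-1); rewrite sqrrN expr1n => k1 k2.
have [c0|c0] := eqVneq c 0; first by lra.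
have cp : 0 < c by rewrite lt_neqAle eq_sym c0; lra.
have := key (- d / (2 * c)).
have -> : c * (- d / (2 * c)) ^+ 2 + d * (- d / (2 * c)) = - (d ^+ 2 / (4 * c)) by field.
rewrite oppr_ge0 pmulr_lle0 ?invr_gt0; last by lra.
by move=> d2; apply/eqP; rewrite -sqrf_eq0 eq_le d2 sqr_ge0.
Qed.

(** The index runs over a window of [r + 1] entries, entry [0] being the newest. *)
Definition linear_form (R : realType) r (s x : nat -> R) : R :=
  \sum_(i < r.+1) s i * x i.

Definition quad_form (R : realType) r (G : nat -> nat -> R) (x : nat -> R) : R :=
  \sum_(i < r) \sum_(j < r) G i j * (x i * x j).

(** The window that follows [x] in the recurrence [linear_form r s = 0].  Windows are
    functions on all naturals, so that nothing is forgotten and old entries can be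
    read off from the tail. *)
Definition advance (R : realType) r (s x : nat -> R) : nat -> R :=
  fun i => if i is i'.+1 then x i' else - (\sum_(i < r) s i.+1 * x i) / s 0%N.

Lemma linear_form_cons (R : realType) r (s x : nat -> R) :
  linear_form r s x = s 0%N * x 0%N + \sum_(i < r) s i.+1 * x i.+1.
Proof. by rewrite /linear_form big_ord_recl. Qed.

Lemma linear_form_advance (R : realType) r (s x : nat -> R) :
  s 0%N != 0 -> linear_form r s (advance r s x) = 0.
Proof. by move=> s0; rewrite linear_form_cons /= mulrCA mulfV// mulr1 addNr. Qed.

Lemma iter_advance_shift (R : realType) r (s x : nat -> R) n i :
  iter (n + i) (advance r s) x i = iter n (advance r s) x 0%N.
Proof. by elim: i => [|i IH]; rewrite ?addn0// addnS /=. Qed.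

Lemma iter_advance_init (R : realType) r (s x : nat -> R) n i :
  iter n (advance r s) x (n + i)%N = x i.
Proof. by elim: n. Qed.

Lemma quad_form_near_const (R : realType) r (G : nat -> nat -> R) (x : nat -> R)
    (c e : R) :
  0 <= e -> (forall i, (i < r)%N -> `|x i - c| <= e) ->
  c ^+ 2 * quad_form r G (fun=> 1) -
  (2 * `|c| * e + e ^+ 2) * \sum_(i < r) \sum_(j < r) `|G i j| <= quad_form r G x.
Proof.
move=> e0 xc; rewrite /quad_form !mulr_sumr -sumrB; apply: ler_sum => i _.
rewrite !mulr_sumr -sumrB; apply: ler_sum => j _.
have /ler_normlP[h1 h2] := lexx `|G i j * (x i * x j - c * c)|.
suff : `|G i j * (x i * x j - c * c)| <= (2 * `|c| * e + e ^+ 2) * `|G i j| by lra.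
rewrite normrM mulrC ler_wpM2r//.
have -> : x i * x j - c * c = c * (x i - c) + c * (x j - c) + (x i - c) * (x j - c) by ring.
have hi := xc i (ltn_ord i); have hj := xc j (ltn_ord j).
rewrite (le_trans (ler_normD _ _))// lerD//.
  rewrite (le_trans (ler_normD _ _))// !normrM.
  by rewrite -mulrA [2 * _]mulr_natl mulr2n lerD// ler_wpM2l.
by rewrite normrM expr2 ler_pM.
Qed.

Section dissipation.
Variables (R : realType) (r : nat) (s t g : nat -> R) (G : nat -> nat -> R).
Variable pen : (nat -> R) -> R.
Hypothesis s0 : s 0%N != 0.
Hypothesis pen_ge0 : forall x, 0 <= pen x.
Hypothesis balance : forall x : nat -> R,
  linear_form r s x * linear_form r t x =
  quad_form r G x - quad_form r G (fun i => x i.+1) + pen x +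
  linear_form r g x ^+ 2.

Lemma quad_form_advance x : quad_form r G (advance r s x) <= quad_form r G x.
Proof.
have := balance (advance r s x).
rewrite linear_form_advance// mul0r.
rewrite (_ : quad_form r G (fun i => advance r s x i.+1) = quad_form r G x)//.
have := pen_ge0 (advance r s x); have := sqr_ge0 (linear_form r g (advance r s x)).
lra.
Qed.

Lemma quad_form_iter_advance x n :
  quad_form r G (iter n (advance r s) x) <= quad_form r G x.
Proof. by elim: n => //= n; apply: le_trans (quad_form_advance _). Qed.

(** [G] decreases along the trajectory of [x]; if the trajectory approaches constant
    windows, on which [G] is nonnegative, then [G x] is bounded below by every negative
    number. *)
Lemma quad_form_ge0 x :
  (exists C, forall e, 0 < e -> exists n c, [/\ `|c| <= C,
     0 <= c ^+ 2 * quad_form r G (fun=> 1) &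
     forall i, (i < r)%N -> `|iter n (advance r s) x i - c| <= e]) ->
  0 <= quad_form r G x.
Proof.
move=> [C xC]; rewrite leNgt; apply/negP => Gx0.
pose K := \sum_(i < r) \sum_(j < r) `|G i j|.
have K0 : 0 <= K by apply: sumr_ge0 => i _; apply: sumr_ge0.
have C0 : 0 <= C by have [//|n [c [cC _ _]]] := xC 1; apply: le_trans cC.
pose D := 1 + (2 * C + 1) * K.
have D0 : 0 < D by rewrite ltr_pwDl// mulr_ge0//; lra.
(* Small enough for the error of [quad_form_near_const] to be at most half of
   the supposed negative value. *)
pose e := Num.min 1 (- quad_form r G x / (2 * D)).
have e0 : 0 < e by rewrite lt_min ltr01 divr_gt0//; lra.
have e1 : e <= 1 by rewrite ge_min lexx.
have eD : e * (2 * D) <= - quad_form r G x.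
  by rewrite -ler_pdivlMr ?ge_min ?lexx ?orbT//; lra.
have [n [c [cC c0 xc]]] := xC e e0.
have := quad_form_near_const G (ltW e0) xc; rewrite -/K => h1.
have h2 := quad_form_iter_advance x n.
have : (2 * `|c| * e + e ^+ 2) * K <= e * D.
  have h3 : 2 * `|c| * e + e ^+ 2 <= e * (2 * C + 1) by nra.
  rewrite /D mulrDr mulr1 mulrA; apply: (@le_trans _ _ (e * (2 * C + 1) * K)).
    exact: ler_wpM2r.
  by rewrite lerDr ltW.
move: eD; rewrite [e * (2 * D)]mulrCA => eD h3.
have := le_trans h1 h2; rewrite -subr_ge0; move: c0 h3.
move: (c ^+ 2 * _) (_ * K) (e * D) eD Gx0 => a b ed; lra.
Qed.

Hypothesis G_ge0 : forall x, 0 <= quad_form r G x.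

(** Let the new entry of the window vary by [h] from the value chosen by the
    recurrence.  The left side of the balance is then [s_0 h (t_0 h + t.y)], and the
    right side is nonnegative because [G x = 0]; so [t.y = 0]. *)
Lemma quad_form_null_advance x : quad_form r G x = 0 ->
  [/\ quad_form r G (advance r s x) = 0, pen (advance r s x) = 0 &
      linear_form r t (advance r s x) = 0].
Proof.
move=> Gx0; pose y := advance r s x.
have b := balance y; rewrite linear_form_advance// mul0r in b.
rewrite (_ : quad_form r G (fun i => y i.+1) = quad_form r G x)// Gx0 in b.
have h1 := pen_ge0 y; have h2 := sqr_ge0 (linear_form r g y); have h3 := G_ge0 y.
split; rewrite -/y; first lra; first lra.
pose d := s 0%N * linear_form r t y; pose c := s 0%N * t 0%N.
have key h : 0 <= c * h ^+ 2 + d * h.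
  pose z i := if i is i'.+1 then x i' else y 0%N + h.
  have zl (u : nat -> R) : linear_form r u z = linear_form r u y + u 0%N * h.
    by rewrite !linear_form_cons /=; ring.
  have := balance z; rewrite !zl linear_form_advance// add0r.
  rewrite (_ : quad_form r G (fun i => z i.+1) = quad_form r G x)// Gx0.
  have := pen_ge0 z; have := sqr_ge0 (linear_form r g z); have := G_ge0 z.
  by rewrite /c /d !zl => ? ? ? ?; lra.
have /eqP := linear_coef0_of_ge0 key.
by rewrite mulf_eq0 (negbTE s0) => /eqP.
Qed.

Lemma quad_form_null_iter x n : quad_form r G x = 0 ->
  [/\ quad_form r G (iter n (advance r s) x) = 0,
      pen (iter n.+1 (advance r s) x) = 0,
      linear_form r s (iter n.+1 (advance r s) x) = 0 &
      linear_form r t (iter n.+1 (advance r s) x) = 0].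
Proof.
move=> Gx0; have Gn : quad_form r G (iter n (advance r s) x) = 0.
  by elim: n => // n /quad_form_null_advance[].
by have [] := quad_form_null_advance Gn; split=> //; rewrite /= linear_form_advance.
Qed.

(** Both recurrences hold along the trajectory and all new entries vanish.  When the
    newest nonzero entry of [x] has moved to the oldest position [r] of the window,
    the recurrences read [s_r x_j = 0] and [t_r x_j = 0]. *)
Lemma quad_form_definite x :
  (s r != 0) || (t r != 0) ->
  (forall n, iter n.+1 (advance r s) x 0%N = 0) ->
  quad_form r G x = 0 -> forall i, (i < r)%N -> x i = 0.
Proof.
move=> st x0 Gx0; elim/ltn_ind => j IH jr.
have e i : (i < r)%N -> iter (r - j) (advance r s) x i = 0.
  move=> ir; have [rji|rji] := leqP (r - j) i.
    rewrite -(subnKC rji) iter_advance_init IH//; lia.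
  have -> : (r - j = (r - j - i.+1).+1 + i)%N by lia.
  by rewrite iter_advance_shift x0.
have er : iter (r - j) (advance r s) x r = x j.
  by rewrite -[in X in _ X = _](subnK (ltnW jr)) iter_advance_init.
have lastE (u : nat -> R) : linear_form r u (iter (r - j) (advance r s) x) = u r * x j.
  by rewrite /linear_form big_ord_recr /= er big1 ?add0r// => i _; rewrite e ?mulr0.
have rj : (r - j = (r - j).-1.+1)%N by lia.
have [_ _] := quad_form_null_iter (r - j).-1 Gx0.
rewrite -rj !lastE => /eqP; rewrite mulf_eq0 => /orP[/eqP s00|/eqP //].
move=> /eqP; rewrite mulf_eq0 => /orP[/eqP t00|/eqP //].
by move: st; rewrite s00 t00 eqxx.
Qed.

End dissipation.

(** * Generating polynomials on the unit circle *)

Lemma expiX (R : realType) (theta : R) n : expi theta ^+ n = expi (n%:R * theta).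
Proof.
elim: n => [|n IH]; first by rewrite expr0 mul0r /expi cos0 sin0.
rewrite exprS IH -natr1 mulrDl mul1r addrC /expi cosD sinD.
by apply/eqP; rewrite eq_complex /=; apply/andP; split; apply/eqP; ring.
Qed.

Lemma expiM (R : realType) (x y : R) : expi x * expi y = expi (x + y).
Proof.
rewrite /expi cosD sinD.
by apply/eqP; rewrite eq_complex /=; apply/andP; split; apply/eqP; ring.
Qed.

Lemma evalC_genpoly (R : realType) r (s : nat -> R) (z : R[i]) :
  evalC (genpoly r s) z = \sum_(i < r.+1) (s i)%:C%C * z ^+ (r - i).
Proof.
rewrite /evalC /genpoly rmorph_sum horner_sum; apply: eq_bigr => i _.
by rewrite /= map_polyZ /= hornerZ map_polyXn hornerXn.
Qed.

Lemma Re_evalC_expi (R : realType) r (s t : nat -> R) (theta : R) :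
  complex.Re (evalC (genpoly r s) (expi theta) *
              evalC (genpoly r t) (expi (- theta))) =
  \sum_(i < r.+1) \sum_(j < r.+1) s i * t j * cos ((i%:R - j%:R) * theta).
Proof.
rewrite !evalC_genpoly mulr_suml raddf_sum /=; apply: eq_bigr => i _.
rewrite mulr_sumr raddf_sum /=; apply: eq_bigr => j _.
rewrite mulrACA !expiX expiM -rmorphM /=.
have -> : (r - i)%:R * theta + (r - j)%:R * - theta = - ((i%:R - j%:R) * theta) :> R.
  by rewrite (natrB _ (ltnSE (ltn_ord i))) (natrB _ (ltnSE (ltn_ord j))); ring.
by rewrite /expi cosN /= mul0r subr0.
Qed.

Lemma evalC_conj (R : realType) (p : {poly R}) (theta : R) :
  evalC p (expi theta) = 0 -> evalC p (expi (- theta)) = 0.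
Proof.
move=> p0; have -> : expi (- theta) = ((expi theta)^*)%C.
  by rewrite /expi cosN sinN.
apply/eqP; rewrite -/(root _ _) -complex_root_conj -map_poly_comp.
rewrite (eq_map_poly (g := real_complex R)); first exact/eqP.
by move=> x /=; rewrite oppr0.
Qed.

Lemma unit_circle_expi (R : realType) (z : R[i]) : `|z| = 1 ->
  exists2 theta, 0 <= theta <= pi & z = expi theta \/ z = expi (- theta).
Proof.
case: z => x y; rewrite normc_def /= => /(congr1 (@complex.Re R)) /= xy.
have xy1 : x ^+ 2 + y ^+ 2 = 1.
  by rewrite -[LHS]sqr_sqrtr ?xy ?expr1n// addr_ge0 ?sqr_ge0.
have x1 : -1 <= x <= 1.
  rewrite -ler_norml -(ler_pXn2r (n := 2))// ?nnegrE// real_normK ?num_real//.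
  by rewrite expr1n -xy1 lerDl sqr_ge0.
have cx : cos (acos x) = x by rewrite acosK ?in_itv /= ?x1.
have sx : sin (acos x) = `|y|.
  by rewrite sin_acos// -sqrtr_sqr; congr Num.sqrt; rewrite -xy1 addrAC subrr add0r.
exists (acos x); first by rewrite acos_ge0 ?acos_lepi.
rewrite /expi cosN sinN cx sx; case: ger0P => y0; first by left.
by right; rewrite opprK.
Qed.

(** At a root of [mu] on the unit circle, the real part in the positivity hypothesis
    vanishes. *)
Lemma root_in_disc (R : realType) r (a mu : nat -> R) (alpha : R) : 0 < alpha ->
  (forall z : R[i], 1 < `|z| -> evalC (genpoly r mu) z != 0) ->
  (forall theta : R, 0 <= theta <= pi -> alpha <=
     complex.Re (evalC (genpoly r a) (expi theta) *
                 evalC (genpoly r mu) (expi (- theta)))) ->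
  forall z : R[i], evalC (genpoly r mu) z = 0 -> `|z| < 1.
Proof.
move=> alpha0 mu1 Re_a z mz.
have [//|z1|z1] := real_ltgtP (normr_real z) (real1 _).
  by have := mu1 z z1; rewrite mz eqxx.
have [theta th zE] := unit_circle_expi z1.
have m0 : evalC (genpoly r mu) (expi (- theta)) = 0.
  case: zE => zE; rewrite zE in mz; last exact: mz.
  exact: evalC_conj mz.
by have := Re_a theta th; rewrite m0 mulr0 /=; lra.
Qed.

(** [G] is the energy matrix of the pair [(s, t)], [d] the penalized combination, and
    [g] the spectral factor. *)
Definition multiplier_identity (R : realType) r (s t d : nat -> R) (c : R)
    (G : nat -> nat -> R) (g : nat -> R) : Prop :=
  forall k : nat -> nat -> R, (forall i j, k i j = k j i) ->
    \sum_(i < r.+1) \sum_(j < r.+1) s i * t j * k i j =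
    \sum_(i < r) \sum_(j < r) G i j * k i j -
    \sum_(i < r) \sum_(j < r) G i j * k i.+1 j.+1 +
    c * \sum_(i < r.+1) \sum_(j < r.+1) d i * d j * k i j +
    \sum_(i < r.+1) \sum_(j < r.+1) g i * g j * k i j.

(** A symmetric [k] sees only the symmetric part of [s t^T], and so does the real part
    on the unit circle. *)
Lemma multiplier_telescope (R : realType) r (s t d : nat -> R) (c : R) :
  (forall theta, 0 <= theta <= pi ->
    c * \sum_(i < r.+1) \sum_(j < r.+1) d i * d j * cos ((i%:R - j%:R) * theta)
    <= \sum_(i < r.+1) \sum_(j < r.+1) s i * t j * cos ((i%:R - j%:R) * theta)) ->
  exists G g, (forall i j, G i j = G j i) /\ multiplier_identity r s t d c G g.
Proof.
move=> h; pose Q i j := (s i * t j + s j * t i) / 2 - c * (d i * d j).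
have QE k : (forall i j, k i j = k j i) ->
    \sum_(i < r.+1) \sum_(j < r.+1) Q i j * k i j =
    \sum_(i < r.+1) \sum_(j < r.+1) s i * t j * k i j -
    c * \sum_(i < r.+1) \sum_(j < r.+1) d i * d j * k i j.
  move=> ksym; pose A := \sum_(i < r.+1) \sum_(j < r.+1) s i * t j * k i j.
  have AE : \sum_(i < r.+1) \sum_(j < r.+1) s j * t i * k i j = A.
    rewrite exchange_big; apply: eq_bigr => i _; apply: eq_bigr => j _.
    by rewrite ksym.
  rewrite -/A (_ : A = (A + A) / 2); last by field.
  rewrite -{2}AE mulr_sumr -big_split mulr_suml -sumrB; apply: eq_bigr => i _ /=.
  rewrite mulr_sumr -big_split mulr_suml -sumrB; apply: eq_bigr => j _ /=.
  by rewrite /Q; field.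
have [||G [g [Gsym GE]]] := @spectral_telescope R r Q.
- by move=> i j; rewrite /Q [d i * _]mulrC [s i * _ + _]addrC.
- move=> theta th; rewrite symbol_cos QE ?subr_ge0 ?h// => i j.
  by rewrite -cosN; congr cos; ring.
exists G, g; split=> // k ksym.
have kE := GE k; rewrite QE// in kE; apply/eqP; rewrite addrAC -kE subrK; exact/eqP.
Qed.

(** The last coefficients are the values at zero of the generating polynomials. *)
Lemma coprimep_genpoly_last (R : realType) r (s t : nat -> R) :
  coprimep (genpoly r s) (genpoly r t) -> (s r != 0) || (t r != 0).
Proof.
have low (u : nat -> R) : u r = 0 -> 'X %| genpoly r u.
  move=> u0; rewrite -['X]subr0 -polyC0 dvdp_XsubCl; apply/rootP.
  rewrite /genpoly horner_sum big1// => i _; rewrite hornerZ hornerXn expr0n.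
  have [ri|] := eqVneq (r - i)%N 0%N; last by rewrite mulr0.
  have -> : (i : nat) = r by have := ltn_ord i; lia.
  by rewrite u0 mul0r.
move=> cop; apply: contraT; rewrite negb_or !negbK => /andP[/eqP sr /eqP tr].
have /size_poly1P[c c0 XE] : size (gcdp (genpoly r s) (genpoly r t)) == 1%N by [].
have : 'X %| gcdp (genpoly r s) (genpoly r t) by rewrite dvdp_gcd !low.
by rewrite XE => /dvdp_leq; rewrite polyC_eq0 c0 size_polyX size_polyC c0 => /(_ isT).
Qed.

Lemma genpoly_head (R : realType) r (s : nat -> R) :
  size (genpoly r s) = r.+1 -> s 0%N != 0.
Proof.
move=> sz; have : (genpoly r s)`_r != 0.
  by rewrite -[X in _`_X]/(r.+1.-1) -sz -/(lead_coef _) lead_coef_eq0 -size_poly_eq0 sz.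
rewrite /genpoly coef_sum big_ord_recl big1 /= ?addr0.
  by rewrite coefZ coefXn subn0 eqxx mulr1.
move=> i _; rewrite coefZ coefXn (_ : (r == _) = false) ?mulr0//.
by apply/eqP; have := ltn_ord i; rewrite /bump /=; lia.
Qed.

Lemma linear_form_sqr (R : realType) r (s t x : nat -> R) :
  linear_form r s x * linear_form r t x =
  \sum_(i < r.+1) \sum_(j < r.+1) s i * t j * (x i * x j).
Proof.
rewrite /linear_form mulr_suml; apply: eq_bigr => i _.
by rewrite mulr_sumr; apply: eq_bigr => j _; ring.
Qed.

(** * Existence of the two energy matrices *)

Definition energy_matrix (R : realType) r (s t d : nat -> R) (c : R)
    (G : nat -> nat -> R) (g : nat -> R) : Prop :=
  [/\ forall i j, G i j = G j i,
      multiplier_identity r s t d c G g,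
      forall x, 0 <= quad_form r G x &
      forall x, quad_form r G x = 0 -> forall i, (i < r)%N -> x i = 0].

Lemma energy_matrix_balance (R : realType) r (s t d g : nat -> R) (c : R)
    (G : nat -> nat -> R) :
  multiplier_identity r s t d c G g ->
  forall x, linear_form r s x * linear_form r t x =
  quad_form r G x - quad_form r G (fun i => x i.+1) +
  c * linear_form r d x ^+ 2 + linear_form r g x ^+ 2.
Proof.
move=> h x; rewrite !expr2 !linear_form_sqr.
by apply: (h (fun i j => x i * x j)) => i j; exact: mulrC.
Qed.

Definition delta0 (R : realType) i : R := (i == 0%N)%:R.
Definition delta01 (R : realType) i : R := (i == 0%N)%:R - (i == 1%N)%:R.

Lemma linear_form_delta0 (R : realType) r (x : nat -> R) :
  linear_form r (@delta0 R) x = x 0%N.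
Proof.
rewrite /linear_form big_ord_recl big1; first by rewrite addr0 /delta0 mul1r.
by move=> i _; rewrite /delta0 mul0r.
Qed.

Lemma linear_form_delta01 (R : realType) r (x : nat -> R) :
  linear_form r.+1 (@delta01 R) x = x 0%N - x 1%N.
Proof.
rewrite /linear_form 2!big_ord_recl big1; first by rewrite /delta01 /=; ring.
by move=> i _; rewrite /delta01 /= subrr mul0r.
Qed.

Lemma iter_advance_recurrence (R : realType) r (s x : nat -> R) n :
  (0 < r)%N -> s 0%N != 0 ->
  \sum_(i < r.+1) s i * iter (n + r - i) (advance r s) x 0%N = 0.
Proof.
move=> r0 s0; have := @linear_form_advance R r s (iter (n + r).-1 (advance r s) x) s0.
rewrite -iterS prednK ?addn_gt0 ?r0 ?orbT// => h.
rewrite -[RHS]h; apply: eq_bigr => i _; rewrite -(@iter_advance_shift _ _ _ _ _ i) subnK//.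
by rewrite (leq_trans (ltnSE (ltn_ord i)))// leq_addl.
Qed.

(** The trajectories of the recurrence of [mu] tend to zero. *)
Lemma exists_energy_matrix_a (R : realType) r (a mu : nat -> R) (alpha : R) :
  (0 < r)%N -> 0 < alpha -> size (genpoly r mu) = r.+1 ->
  coprimep (genpoly r a) (genpoly r mu) ->
  (forall z : R[i], 1 < `|z| -> evalC (genpoly r mu) z != 0) ->
  (forall theta : R, 0 <= theta <= pi -> alpha <=
     complex.Re (evalC (genpoly r a) (expi theta) *
                 evalC (genpoly r mu) (expi (- theta)))) ->
  exists G g, energy_matrix r mu a (@delta0 R) alpha G g.
Proof.
move=> r0 alpha0 szmu cop mu1 Re_a; have mu0 := genpoly_head szmu.
have disc := root_in_disc alpha0 mu1 Re_a.
have [|G [g [Gsym GE]]] := @multiplier_telescope R r mu a (@delta0 R) alpha.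
  move=> theta th; have := Re_a theta th; rewrite Re_evalC_expi.
  rewrite [X in _ * X](_ : _ = 1) ?mulr1.
    rewrite exchange_big /= => h; apply: le_trans h _; rewrite le_eqVlt; apply/orP; left.
    apply/eqP/eq_bigr => i _; apply: eq_bigr => j _; rewrite [a j * _]mulrC -cosN.
    by congr (_ * cos _); ring.
  rewrite big_ord_recl big_ord_recl !big1 ?addr0 /delta0 /=.
  - by rewrite subrr mul0r cos0 !mulr1.
  - by move=> i _; rewrite big1// => j _; rewrite !mul0r.
  - by move=> i _; rewrite !(mulr0, mul0r).
have bal := energy_matrix_balance GE.
pose pen x := alpha * linear_form r (@delta0 R) x ^+ 2.
have pen0 x : 0 <= pen x by rewrite mulr_ge0 ?sqr_ge0// ltW.
have psd x : 0 <= quad_form r G x.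
  apply: (quad_form_ge0 (pen := pen) mu0 pen0 bal).
  exists 0 => e e0.
  have sumX : absolutely_summable (fun n => iter n (advance r mu) x 0%N).
    apply: (stable_recurrence_summable mu0 disc) => n.
    exact: iter_advance_recurrence.
  have [N NP] := absolutely_summable_cvg0 sumX e0.
  exists (N + r)%N, 0; rewrite normr0 expr0n /= mul0r; split=> // i ir.
  rewrite subr0 -(subnK (leq_trans (ltnW ir) (leq_addl N r))) iter_advance_shift.
  by apply/ltW/NP; lia.
exists G, g; split=> // x Gx0.
apply: (quad_form_definite (pen := pen) mu0 pen0 bal psd _ _ Gx0).
  by rewrite orbC; exact: coprimep_genpoly_last cop.
move=> n; have [_ pn _ _] := quad_form_null_iter mu0 pen0 bal psd n Gx0.
move: pn; rewrite /pen linear_form_delta0 => /eqP.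
by rewrite mulf_eq0 gt_eqF//= sqrf_eq0 => /eqP.
Qed.

(** As generating polynomials, [nu] is [mu] times [z - 1]. *)
Lemma sum_nu (R : realType) (V : lmodType R) k (mu : nat -> R) (y : nat -> V) :
  (0 < k)%N ->
  \sum_(i < k.+1) nu k mu i *: y i = \sum_(i < k) mu i *: (y i - y i.+1).
Proof.
case: k => // r _; under [RHS]eq_bigr => i _ do rewrite scalerBr.
rewrite sumrB big_ord_recl [X in _ + X = _]big_ord_recr /=.
rewrite [X in _ = X - _]big_ord_recl [X in _ = _ - X]big_ord_recr /=.
rewrite opprD [RHS]addrA -[X in _ = X - _]addrA -sumrB -[RHS]addrA.
rewrite /nu /= eqxx scaleNr; congr (_ + (_ + _)); apply: eq_bigr => i _.
by rewrite /bump /= eqSS ltn_eqF// scalerBl.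
Qed.

(** Used to read off [G(1,...,1)] from three balances. *)
Lemma quad_form_second_difference (R : realType) r (G : nat -> nat -> R) (x : nat -> R) :
  quad_form r G (fun i => x i + 1) + quad_form r G (fun i => x i - 1) =
  2 * quad_form r G x + 2 * quad_form r G (fun=> 1).
Proof.
rewrite /quad_form -big_split !mulr_sumr -big_split; apply: eq_bigr => i _ /=.
rewrite -big_split !mulr_sumr -big_split; apply: eq_bigr => j _ /=; ring.
Qed.

(** The differences of a trajectory of [nu] solve the recurrence of [mu], so they are
    summable and the windows become constant in the limit.  On constant windows [G] is
    positive: the balance at the windows of an arithmetic progression gives
    [G(1,...,1) = 1/2]. *)
Lemma exists_energy_matrix_B (R : realType) k (B mu : nat -> R) (beta : R) :
  (0 < k)%N -> 0 < beta -> mu 0%N != 0 ->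
  coprimep (genpoly k B) (genpoly k (nu k mu)) ->
  \sum_(i < k) mu i = 1 -> \sum_(i < k.+1) B i = 1 ->
  (forall z : R[i], evalC (genpoly k.-1 mu) z = 0 -> `|z| < 1) ->
  (forall theta : R, 0 <= theta <= pi -> 2 * beta * (1 - cos theta) <=
     complex.Re (evalC (genpoly k B) (expi theta) *
                 evalC (genpoly k (nu k mu)) (expi (- theta)))) ->
  exists G g, energy_matrix k (nu k mu) B (@delta01 R) beta G g.
Proof.
case: k => // r _ beta0 mu0 cop sum_mu sum_B disc Re_B; set k := r.+1.
have [|G [g [Gsym GE]]] := @multiplier_telescope R k (nu k mu) B (@delta01 R) beta.
  move=> theta th; have := Re_B theta th; rewrite Re_evalC_expi => h.
  rewrite [X in _ * X](_ : _ = 2 * (1 - cos theta)).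
    rewrite mulrA [beta * 2]mulrC; apply: le_trans h _; rewrite exchange_big /=.
    rewrite le_eqVlt; apply/orP; left.
    apply/eqP/eq_bigr => i _; apply: eq_bigr => j _; rewrite [B j * _]mulrC -cosN.
    by congr (_ * cos _); ring.
  have sumd (f : nat -> R) : \sum_(j < k.+1) delta01 R j * f j = f 0%N - f 1%N.
    exact: linear_form_delta01.
  transitivity (\sum_(i < k.+1) delta01 R i *
     (cos (i%:R * theta) - cos ((i%:R - 1) * theta))).
    apply: eq_bigr => i _.
    rewrite -[cos (i%:R * theta)]/(cos (i%:R * theta)).
    under eq_bigr => j _ do rewrite -mulrA.
    rewrite -mulr_sumr; congr (_ * _).
    by rewrite (sumd (fun j => cos ((i%:R - j%:R) * theta))) subr0.
  rewrite (sumd (fun i => cos (i%:R * theta) - cos ((i%:R - 1) * theta))).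
  by rewrite sub0r mulN1r cosN mul0r cos0 subrr mul0r cos0 mul1r; ring.
have bal := energy_matrix_balance GE.
have nu0 : nu k mu 0%N != 0 by [].
pose pen x := beta * linear_form k (@delta01 R) x ^+ 2.
have pen0 x : 0 <= pen x by rewrite mulr_ge0 ?sqr_ge0// ltW.
have lin_nu (x : nat -> R) : linear_form k (nu k mu) x =
    \sum_(i < k) mu i * (x i - x i.+1).
  exact: (sum_nu (V := R^o)).
(* The progression [y], shifted by [1], has [nu.y = 1] and [B.y] increased by
   [1]; penalty and spectral term do not change. *)
have G1 : quad_form k G (fun=> 1) = 2^-1.
  have lin_shift (s : nat -> R) (x : nat -> R) (c : R) :
      linear_form k s (fun i => x i + c) = linear_form k s x + c * \sum_(i < k.+1) s i.
    rewrite /linear_form mulr_sumr -big_split; apply: eq_bigr => i _ /=; ring.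
  have g1 : \sum_(i < k.+1) g i = 0.
    have := bal (fun=> 1); rewrite lin_nu linear_form_delta01.
    rewrite big1 => [|i _]; last by rewrite subrr mulr0.
    rewrite !subrr mul0r expr0n /= mulr0 !add0r => /esym/eqP; rewrite sqrf_eq0.
    by rewrite /linear_form => /eqP gE; rewrite -[RHS]gE; apply: eq_bigr => i _; rewrite mulr1.
  pose y (i : nat) : R := - i%:R.
  have yS : (fun i => y i.+1) = (fun i => y i - 1).
    by apply/funext => i; rewrite /y -natr1; ring.
  have nuy (c : R) : linear_form k (nu k mu) (fun i => y i + c) = 1.
    rewrite lin_nu -[RHS]sum_mu; apply: eq_bigr => i _.
    by rewrite /y -natr1; ring.
  have b0 := bal y; have b1 := bal (fun i => y i + 1).
  rewrite nuy !linear_form_delta01 !lin_shift g1 sum_B mulr0 mulr1 addr0 in b1.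
  have nuy0 := nuy 0; rewrite lin_shift mul0r addr0 in nuy0.
  rewrite nuy0 linear_form_delta01 yS in b0.
  have yS' : (fun i => y i.+1 + 1) = y.
    by apply/funext => i; rewrite /y -natr1; ring.
  rewrite yS' in b1.
  have dE : y 0%N + 1 - (y 1%N + 1) = y 0%N - y 1%N by ring.
  rewrite dE in b1.
  have := quad_form_second_difference k G y; lra.
have psd x : 0 <= quad_form k G x.
  apply: (quad_form_ge0 (pen := pen) nu0 pen0 bal).
  pose X n := iter n (advance k (nu k mu)) x 0%N.
  pose D n := X n.+1 - X n.
  have sumD : absolutely_summable D.
    apply: (stable_recurrence_summable mu0 disc) => n.
    rewrite -[RHS](@iter_advance_recurrence R k (nu k mu) x n)//.
    rewrite (sum_nu (V := R^o) mu (fun i => X (n + k - i)%N))//.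
    apply: eq_bigr => i _; rewrite /D /k addnS subSS subSn//.
    by rewrite (leq_trans (ltnSE (ltn_ord i)))// leq_addl.
  have [C DC] := sumD.
  exists (`|X 0%N| + C) => e e0.
  have e'0 : 0 < e / k%:R by rewrite divr_gt0// ltr0n.
  have [N NP] := absolutely_summable_cvg0 sumD e'0.
  exists (N + k)%N, (X (N + k)%N); split.
  - have XE n : X n = X 0%N + \sum_(m < n) D m.
      elim: n => [|n IH]; first by rewrite big_ord0 addr0.
      by rewrite big_ord_recr /= addrA -IH /D addrC subrK.
    rewrite XE (le_trans (ler_normD _ _))// lerD2l.
    by rewrite (le_trans (ler_norm_sum _ _ _)).
  - by rewrite G1 mulr_ge0 ?sqr_ge0.
  - move=> i ik; rewrite -[in X in `|X - _|](subnK (leq_trans (ltnW ik) (leq_addl N k))).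
    rewrite iter_advance_shift -/(X _).
    have ki : `|X (N + k - i)%N - X (N + k)%N| <= i%:R * (e / k%:R).
      elim: i ik => [|i IH] ik; first by rewrite subn0 subrr normr0 mul0r.
      have E : (N + k - i = (N + k - i.+1).+1)%N by lia.
      have := NP (N + k - i.+1)%N; rewrite /D -E => /(_ ltac:(lia)) h1.
      have h2 := IH (ltnW ik).
      rewrite -natr1 mulrDl mul1r.
      rewrite -[X in `|X| <= _](subrKA (X (N + k - i)%N)) addrC.
      by rewrite (le_trans (ler_normD _ _))// lerD// distrC ltW.
    apply: le_trans ki _; rewrite mulrCA ler_piMr ?(ltW e0)//.
    by rewrite ler_pdivrMr ?ltr0n// mul1r ler_nat ltnW.
exists G, g; split=> // x Gx0.
(* The penalty [x_0 - x_1] of each advanced window vanishes: the entries stay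
   equal to [x_0], and [t.x = x_0] on a constant window. *)
have newest n : iter n (advance k (nu k mu)) x 0%N = x 0%N.
  elim: n => // n IH; rewrite -[RHS]IH.
  have [_ pn _ _] := quad_form_null_iter nu0 pen0 bal psd n Gx0.
  move: pn; rewrite /pen linear_form_delta01 => /eqP.
  by rewrite mulf_eq0 gt_eqF//= sqrf_eq0 subr_eq0 => /eqP.
have x00 : x 0%N = 0.
  have [_ _ _] := quad_form_null_iter nu0 pen0 bal psd k.-1 Gx0.
  rewrite -[X in iter X]/k => <-; rewrite -[LHS]mul1r -sum_B mulr_suml.
  apply: eq_bigr => i _; congr (_ * _); have ik : (i <= k)%N := ltnSE (ltn_ord i).
  have <- := newest (k - i)%N; rewrite -(iter_advance_shift _ _ _ _ i).
  by rewrite (subnK ik).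
apply: (quad_form_definite (pen := pen) nu0 pen0 bal psd _ _ Gx0).
  by rewrite orbC; exact: coprimep_genpoly_last cop.
by move=> n; rewrite newest.
Qed.

(** * The matrices as block matrices *)

Definition matrix_of (R : realType) r (G : nat -> nat -> R) : 'M[R]_r :=
  \matrix_(i, j) G i j.

Definition entry (R : realType) r (x : 'cV[R]_r) (i : nat) : R :=
  if insub i is Some o then x o 0 else 0.

Lemma entryE (R : realType) r (x : 'cV[R]_r) (i : 'I_r) : entry x i = x i 0.
Proof. by rewrite /entry valK. Qed.

Lemma quadE (R : realType) r (A : 'M[R]_r) (x : 'cV[R]_r) :
  quad A x = \sum_(i < r) \sum_(j < r) A i j * (entry x i * entry x j).
Proof.
rewrite /quad mxE exchange_big; apply: eq_bigr => j _; rewrite mxE mulr_suml.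
by apply: eq_bigr => i _; rewrite !mxE !entryE; ring.
Qed.

Lemma quad_matrix_of (R : realType) r (G : nat -> nat -> R) (x : 'cV[R]_r) :
  quad (matrix_of r G) x = quad_form r G (entry x).
Proof.
by rewrite quadE; apply: eq_bigr => i _; apply: eq_bigr => j _; rewrite mxE.
Qed.

Lemma posdefmx_matrix_of (R : realType) r (G : nat -> nat -> R) :
  (forall i j, G i j = G j i) -> (forall x, 0 <= quad_form r G x) ->
  (forall x, quad_form r G x = 0 -> forall i, (i < r)%N -> x i = 0) ->
  posdefmx (matrix_of r G).
Proof.
move=> Gsym G0 Gdef; split; first by apply/matrixP => i j; rewrite !mxE Gsym.
move=> x x0; rewrite quad_matrix_of lt_neqAle G0 andbT eq_sym.
apply: contraNneq x0 => Gx; apply/eqP/colP => i; rewrite mxE -entryE.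
exact: Gdef Gx _ (ltn_ord i).
Qed.

Lemma pad_upperE (R : realType) r (G : nat -> nat -> R) (i j : 'I_r.+1) :
  pad_upper (matrix_of r G) i j = if (i < r)%N && (j < r)%N then G i j else 0.
Proof.
rewrite /pad_upper castmxE /block_mx mxE; case: splitP => i' /= iE; rewrite !mxE;
  case: splitP => j' /= jE; rewrite !mxE iE jE ?ltn_ord //=.
- by rewrite ltnNge leq_addr.
- by rewrite ltnNge leq_addr.
- by rewrite ltnNge leq_addr.
Qed.

Lemma pad_lowerE (R : realType) r (G : nat -> nat -> R) (i j : 'I_r.+1) :
  pad_lower (matrix_of r G) i j =
  if (0 < i)%N && (0 < j)%N then G i.-1 j.-1 else 0.
Proof.
rewrite /pad_lower /block_mx mxE; case: splitP => i' /= iE; rewrite !mxE;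
  case: splitP => j' /= jE; rewrite !mxE iE jE ?ord1 //=.
Qed.

Lemma quad_Umx (R : realType) r (s t : nat -> R) (G : nat -> nat -> R)
    (x : 'cV[R]_r.+1) :
  quad (Umx s t (matrix_of r G)) x =
  linear_form r s (entry x) * linear_form r t (entry x) -
  quad_form r G (entry x) + quad_form r G (fun i => entry x i.+1).
Proof.
pose X := entry x.
have up : \sum_(i < r.+1) \sum_(j < r.+1)
    pad_upper (matrix_of r G) i j * (X i * X j) = quad_form r G X.
  rewrite big_ord_recr /= [X in _ + X]big1 ?addr0 => [|j _]; last first.
    by rewrite pad_upperE /= ltnn mul0r.
  apply: eq_bigr => i _; rewrite big_ord_recr /= pad_upperE /= ltnn andbF mul0r addr0.
  by apply: eq_bigr => j _; rewrite pad_upperE /= !ltn_ord.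
have low : \sum_(i < r.+1) \sum_(j < r.+1)
    pad_lower (matrix_of r G) i j * (X i * X j) =
    quad_form r G (fun i => X i.+1).
  rewrite big_ord_recl [X in X + _]big1 ?add0r => [|j _]; last first.
    by rewrite pad_lowerE /= mul0r.
  apply: eq_bigr => i _; rewrite big_ord_recl /= pad_lowerE /= mul0r add0r.
  by apply: eq_bigr => j _; rewrite pad_lowerE.
rewrite quadE -/X -up -low linear_form_sqr.
pose A := \sum_(i < r.+1) \sum_(j < r.+1) s i * t j * (X i * X j).
have AE : \sum_(i < r.+1) \sum_(j < r.+1) s j * t i * (X i * X j) = A.
  by rewrite exchange_big; apply: eq_bigr => i _; apply: eq_bigr => j _ /=; ring.
rewrite -/A (_ : A = 2^-1 * (A + A)); last by field.
rewrite -{2}AE -big_split mulr_sumr -sumrB -big_split; apply: eq_bigr => i _ /=.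
rewrite -big_split mulr_sumr -sumrB -big_split; apply: eq_bigr => j _ /=.
rewrite !mxE !big_ord1 !mxE; ring.
Qed.

Lemma quad_Umx_ge (R : realType) r (s t d : nat -> R) (c : R) G g
    (x : 'cV[R]_r.+1) : energy_matrix r s t d c G g ->
  c * linear_form r d (entry x) ^+ 2 <= quad (Umx s t (matrix_of r G)) x.
Proof.
move=> [_ /energy_matrix_balance bal _ _]; rewrite quad_Umx bal.
have := sqr_ge0 (linear_form r g (entry x)); lra.
Qed.

(** * Positive semidefinite forms on vector spaces *)

Record psd_form (R : realType) (V : lmodType R) (b : V -> V -> R) : Prop := {
  form_sym : forall u v, b u v = b v u;
  form_linear : forall (a : R) u v w, b (a *: u + v) w = a * b u w + b v w;
  form_ge0 : forall v, 0 <= b v v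
}.

Section psd_form_theory.
Variables (R : realType) (V : lmodType R) (b : V -> V -> R).
Hypothesis hb : psd_form b.

Lemma formDl u v w : b (u + v) w = b u w + b v w.
Proof. by have := form_linear hb 1 u v w; rewrite scale1r mul1r. Qed.

Lemma form0l w : b 0 w = 0.
Proof. by have := formDl 0 0 w; rewrite addr0; lra. Qed.

Lemma formZl a u w : b (a *: u) w = a * b u w.
Proof. by have := form_linear hb a u 0 w; rewrite addr0 form0l addr0. Qed.

Lemma formNl u w : b (- u) w = - b u w.
Proof. by rewrite -scaleN1r formZl mulN1r. Qed.

Lemma formBl u v w : b (u - v) w = b u w - b v w.
Proof. by rewrite formDl formNl. Qed.

Lemma formDr u v w : b w (u + v) = b w u + b w v.
Proof. by rewrite ![b w _](form_sym hb) formDl. Qed.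

Lemma formZr a u w : b w (a *: u) = a * b w u.
Proof. by rewrite ![b w _](form_sym hb) formZl. Qed.

Lemma formNr u w : b w (- u) = - b w u.
Proof. by rewrite ![b w _](form_sym hb) formNl. Qed.

Lemma formBr u v w : b w (u - v) = b w u - b w v.
Proof. by rewrite formDr formNr. Qed.

Lemma form_suml I (s : seq I) (P : pred I) (v : I -> V) w :
  b (\sum_(i <- s | P i) v i) w = \sum_(i <- s | P i) b (v i) w.
Proof.
apply: (big_morph (fun x => b x w)); last exact: form0l.
by move=> x y; exact: formDl.
Qed.

Lemma form_sumr I (s : seq I) (P : pred I) (v : I -> V) w :
  b w (\sum_(i <- s | P i) v i) = \sum_(i <- s | P i) b w (v i).
Proof. by rewrite form_sym// form_suml; apply: eq_bigr => i _; rewrite form_sym. Qed.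

Lemma form_combination r (s t : nat -> R) (v w : nat -> V) :
  b (\sum_(i < r) s i *: v i) (\sum_(j < r) t j *: w j) =
  \sum_(i < r) \sum_(j < r) s i * t j * b (v i) (w j).
Proof.
rewrite form_suml; apply: eq_bigr => i _; rewrite form_sumr.
by apply: eq_bigr => j _; rewrite formZl formZr mulrA.
Qed.

(** Positivity at [u + v] and [u - v]. *)
Lemma form_le_mean u v : `|b u v| <= (b u u + b v v) / 2.
Proof.
rewrite ler_norml; apply/andP; split.
  by have := form_ge0 hb (u + v); rewrite formDl !formDr (form_sym hb v u); lra.
by have := form_ge0 hb (u - v); rewrite formBl !formBr (form_sym hb v u); lra.
Qed.

Lemma form_sqrD_le u v : b (u + v) (u + v) <= 2 * (b u u + b v v).
Proof.
have /ler_normlP[_] := form_le_mean u v.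
by rewrite formDl !formDr (form_sym hb v u); lra.
Qed.

Lemma form_Cauchy_Schwarz u v : b u v ^+ 2 <= b u u * b v v.
Proof.
have [v0|v0] := eqVneq (b v v) 0.
  suff -> : b u v = 0 by rewrite v0 mulr0 expr0n.
  have key h : 0 <= b u u + h * b u v.
    have := form_ge0 hb (u + (h / 2) *: v).
    by rewrite formDl !formDr !formZl !formZr v0 (form_sym hb v u); lra.
  apply/eqP; apply: contraT => uv0.
  have := key (- (b u u + 1) / b u v); rewrite divfK//; lra.
have vp : 0 < b v v by rewrite lt_neqAle eq_sym v0 form_ge0.
have := form_ge0 hb (b v v *: u - b u v *: v).
rewrite formBl !formBr !formZl !formZr (form_sym hb v u).
have -> : b v v * (b v v * b u u) - b v v * (b u v * b u v) -
   (b u v * (b v v * b u v) - b u v * (b u v * b v v)) =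
   b v v * (b u u * b v v - b u v ^+ 2) by ring.
by rewrite pmulr_rge0// subr_ge0.
Qed.

Lemma form_weighted_sum_le r (c : nat -> R) (v : nat -> V) :
  b (\sum_(i < r) c i *: v i) (\sum_(i < r) c i *: v i) <=
  (\sum_(i < r) `|c i|) * \sum_(i < r) `|c i| * b (v i) (v i).
Proof.
rewrite form_combination.
apply: (@le_trans _ _ (\sum_(i < r) \sum_(j < r)
    `|c i| * `|c j| * ((b (v i) (v i) + b (v j) (v j)) / 2))).
  apply: ler_sum => i _; apply: ler_sum => j _.
  rewrite (le_trans (ler_norm _))// !normrM ler_wpM2l ?mulr_ge0//.
  exact: form_le_mean.
rewrite le_eqVlt; apply/orP; left; apply/eqP.
pose A := \sum_(i < r) \sum_(j < r) `|c i| * `|c j| * b (v j) (v j).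
have AE : \sum_(i < r) \sum_(j < r) `|c i| * `|c j| * b (v i) (v i) = A.
  by rewrite exchange_big; apply: eq_bigr => i _; apply: eq_bigr => j _ /=; ring.
transitivity ((A + A) / 2).
  rewrite -{1}AE -big_split mulr_suml; apply: eq_bigr => i _ /=.
  by rewrite -big_split mulr_suml; apply: eq_bigr => j _ /=; field.
rewrite (_ : (A + A) / 2 = A); last by field.
rewrite /A mulr_suml; apply: eq_bigr => i _; rewrite mulr_sumr.
by apply: eq_bigr => j _; rewrite mulrA.
Qed.

(** One step of the Cholesky elimination, carried out on the vectors. *)
Lemma form_complete_square r (G : nat -> nat -> R) (v : nat -> V) :
  (forall i j, G i j = G j i) -> G 0%N 0%N != 0 ->
  let w := v 0%N + \sum_(j < r) (G 0%N j.+1 / G 0%N 0%N) *: v j.+1 in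
  \sum_(i < r.+1) \sum_(j < r.+1) G i j * b (v i) (v j) =
  G 0%N 0%N * b w w + \sum_(i < r) \sum_(j < r)
    (G i.+1 j.+1 - G 0%N i.+1 * G 0%N j.+1 / G 0%N 0%N) *
    b (v i.+1) (v j.+1).
Proof.
move=> Gsym G00 w; rewrite (sum_corner r (fun i j => G i j * b (v i) (v j))).
pose z := \sum_(j < r) (G 0%N j.+1 / G 0%N 0%N) *: v j.+1.
have zz : b z z = \sum_(i < r) \sum_(j < r)
    (G 0%N i.+1 / G 0%N 0%N) * (G 0%N j.+1 / G 0%N 0%N) * b (v i.+1) (v j.+1).
  exact: (form_combination r (fun j => G 0%N j.+1 / G 0%N 0%N)
            (fun j => G 0%N j.+1 / G 0%N 0%N) (fun j => v j.+1) (fun j => v j.+1)).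
have vz : G 0%N 0%N * b (v 0%N) z = \sum_(j < r) G 0%N j.+1 * b (v 0%N) (v j.+1).
  rewrite form_sumr mulr_sumr; apply: eq_bigr => j _; rewrite formZr.
  by field.
have zv : \sum_(i < r) G i.+1 0%N * b (v i.+1) (v 0%N) = G 0%N 0%N * b (v 0%N) z.
  by rewrite vz; apply: eq_bigr => i _; rewrite Gsym (form_sym hb (v i.+1)).
rewrite zv -vz /w -/z formDl !formDr (form_sym hb z (v 0%N)).
have -> : \sum_(i < r) \sum_(j < r)
    (G i.+1 j.+1 - G 0%N i.+1 * G 0%N j.+1 / G 0%N 0%N) *
    b (v i.+1) (v j.+1) =
    \sum_(i < r) \sum_(j < r) G i.+1 j.+1 * b (v i.+1) (v j.+1) -
    G 0%N 0%N * b z z.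
  rewrite zz mulr_sumr -sumrB; apply: eq_bigr => i _.
  rewrite mulr_sumr -sumrB; apply: eq_bigr => j _; field.
  exact: G00.
ring.
Qed.

End psd_form_theory.

Lemma psd_form_mul (R : realType) : psd_form (V := R^o) (fun x y : R => x * y).
Proof.
split; [exact: mulrC| |by move=> v; rewrite -expr2 sqr_ge0].
by move=> a u v w; rewrite mulrDl mulrA.
Qed.

(** Tests of [G] on two coordinates: a zero pivot forces a zero row. *)
Lemma quad_form_two_entries (R : realType) r (G : nat -> nat -> R) i j (a c : R) :
  (forall i j, G i j = G j i) -> (i < r)%N -> (j < r)%N ->
  quad_form r G (fun l => a * (l == i)%:R + c * (l == j)%:R) =
  a ^+ 2 * G i i + 2 * a * c * G i j + c ^+ 2 * G j j.
Proof.
move=> Gsym ir jr.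
have pick (f : nat -> R) m : (m < r)%N -> \sum_(l < r) f l * (l == m :> nat)%:R = f m.
  move=> mr; rewrite (bigD1 (Ordinal mr))//= eqxx mulr1 big1 ?addr0// => l.
  by rewrite -val_eqE /= => /negbTE ->; rewrite mulr0.
have pick2 (f : nat -> R) :
    \sum_(l < r) f l * (a * (l == i :> nat)%:R + c * (l == j :> nat)%:R) =
    a * f i + c * f j.
  rewrite -(pick f i ir) -(pick f j jr) !mulr_sumr -big_split.
  by apply: eq_bigr => l _ /=; ring.
rewrite /quad_form.
transitivity (\sum_(l < r) (a * G l i + c * G l j) *
    (a * (l == i :> nat)%:R + c * (l == j :> nat)%:R)).
  apply: eq_bigr => l _; rewrite -(pick2 (G l)) mulr_suml.
  by apply: eq_bigr => m _; ring.
by rewrite (pick2 (fun l => a * G l i + c * G l j)) (Gsym j i); ring.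
Qed.

(** The product of a nonnegative matrix with the Gram matrix of a nonnegative form,
    by elimination of the first vector.  Applied to the multiplication of real
    numbers, the same elimination shows that the Schur complement is nonnegative. *)
Lemma psd_tensor_ge0 (R : realType) (V : lmodType R) (b : V -> V -> R) r
    (G : nat -> nat -> R) (v : nat -> V) :
  psd_form b -> (forall i j, G i j = G j i) ->
  (forall x, 0 <= quad_form r G x) ->
  0 <= \sum_(i < r) \sum_(j < r) G i j * b (v i) (v j).
Proof.
move=> hb; elim: r G v => [|r IH] G v Gsym G0; first by rewrite big_ord0.
have two j a c : (j < r.+1)%N ->
    0 <= a ^+ 2 * G 0%N 0%N + 2 * a * c * G 0%N j + c ^+ 2 * G j j.
  by move=> jr; rewrite -(@quad_form_two_entries _ r.+1).
have G00ge : 0 <= G 0%N 0%N by have := two 0%N 1 0 isT; lra.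
have [G00|G00] := eqVneq (G 0%N 0%N) 0.
  have G0j j : (j < r)%N -> G 0%N j.+1 = 0.
    move=> jr; apply/eqP; apply: contraT => n0.
    have := two j.+1 (- (G j.+1 j.+1 + 1) / (2 * G 0%N j.+1)) 1 jr.
    rewrite G00 mulr0 add0r mulr1 expr1n mul1r.
    have -> : 2 * (- (G j.+1 j.+1 + 1) / (2 * G 0%N j.+1)) * G 0%N j.+1 =
      - (G j.+1 j.+1 + 1) by field.
    lra.
  have drop (k : nat -> nat -> R) : \sum_(i < r.+1) \sum_(j < r.+1) G i j * k i j =
      \sum_(i < r) \sum_(j < r) G i.+1 j.+1 * k i.+1 j.+1.
    rewrite (sum_corner r (fun i j => G i j * k i j)) G00 mul0r add0r.
    rewrite [X in X + _ + _]big1 ?add0r => [|j _]; last by rewrite G0j ?mul0r.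
    rewrite [X in X + _]big1 ?add0r => [//|i _]; by rewrite Gsym G0j ?mul0r.
  rewrite (drop (fun i j => b (v i) (v j))).
  apply: (IH (fun i j => G i.+1 j.+1) (fun i => v i.+1)) => [i j|x]; first exact: Gsym.
  have := G0 (fun i => x i.-1); rewrite /quad_form.
  by rewrite (drop (fun i j => x i.-1 * x j.-1)).
rewrite (form_complete_square hb)//.
rewrite addr_ge0 ?mulr_ge0 ?form_ge0//.
apply: (IH (fun i j => G i.+1 j.+1 - G 0%N i.+1 * G 0%N j.+1 / G 0%N 0%N)
            (fun i => v i.+1)) => [i j|x].
  by rewrite Gsym [G 0%N i.+1 * _]mulrC.
pose y i := if i is i'.+1 then x i' else
  - \sum_(j < r) (G 0%N j.+1 / G 0%N 0%N) * x j.
have := G0 y; rewrite /quad_form.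
rewrite (form_complete_square (psd_form_mul R) r y Gsym G00).
set w := (X in _ * (X * X)); have -> : w = 0 by rewrite /w /= addNr.
by rewrite mul0r mulr0 add0r.
Qed.

(** The eigenvalue bound passes from numbers to vectors by subtracting
    [lambda] times the identity. *)
Lemma psd_tensor_ge (R : realType) (V : lmodType R) (b : V -> V -> R) r
    (G : nat -> nat -> R) (lambda : R) (v : nat -> V) :
  psd_form b -> (forall i j, G i j = G j i) ->
  (forall x : nat -> R, lambda * \sum_(i < r) x i ^+ 2 <= quad_form r G x) ->
  lambda * \sum_(i < r) b (v i) (v i) <=
  \sum_(i < r) \sum_(j < r) G i j * b (v i) (v j).
Proof.
move=> hb Gsym Gl.
pose G' i j := G i j - lambda * (i == j)%:R.
have G'E (k : nat -> nat -> R) : \sum_(i < r) \sum_(j < r) G' i j * k i j =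
    \sum_(i < r) \sum_(j < r) G i j * k i j - lambda * \sum_(i < r) k i i.
  rewrite mulr_sumr -sumrB; apply: eq_bigr => i _.
  under eq_bigr => j _ do rewrite mulrBl.
  rewrite sumrB; congr (_ - _); rewrite (bigD1 i)//= eqxx mulr1 big1 ?addr0//.
  by move=> j; rewrite -val_eqE eq_sym => /negbTE ->; rewrite mulr0 mul0r.
rewrite -subr_ge0 -(G'E (fun i j => b (v i) (v j))).
apply: (@psd_tensor_ge0 R V b r G' v) => // [i j|x]; first by rewrite /G' Gsym eq_sym.
by rewrite /quad_form (G'E (fun i j => x i * x j)) subr_ge0; exact: Gl.
Qed.

(** * Representation of functionals by coercive forms *)

Lemma psd_form_dotp (R : realType) (H : hilbertType R) :
  psd_form (@dotp R H).
Proof.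
split; [exact: dotpC|exact: dotpDl|].
by move=> v; rewrite -normr_dotp sqr_ge0.
Qed.

Lemma dotp_Cauchy_Schwarz (R : realType) (H : hilbertType R) (u v : H) :
  `|dotp u v| <= `|u| * `|v|.
Proof.
rewrite -(ler_pXn2r (n := 2))// ?nnegrE ?mulr_ge0//.
rewrite exprMn !normr_dotp real_normK ?num_real//.
exact: (form_Cauchy_Schwarz (psd_form_dotp H)).
Qed.

(** The functional [J v = b v v - 2 phi v] is bounded below, and a minimizing sequence
    is a Cauchy sequence by the parallelogram identity and coercivity.  At the limit
    the first variation of [J] vanishes. *)
Lemma Riesz_representation (R : realType) (V : hilbertType R) (b : V -> V -> R)
    (phi : V -> R) (c C K : R) :
  psd_form b -> 0 < c -> (forall v, c * `|v| ^+ 2 <= b v v) ->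
  0 <= C -> (forall u v, `|b u v| <= C * `|u| * `|v|) ->
  (forall a v w, phi (a *: v + w) = a * phi v + phi w) ->
  (forall v, `|phi v| <= K * `|v|) ->
  exists w, forall v, b w v = phi v.
Proof.
move=> hb c0 coer C0 bnd lin phiK.
pose J v := b v v - 2 * phi v.
have phiD u v : phi (u + v) = phi u + phi v.
  by have := lin 1 u v; rewrite scale1r mul1r.
have phi0 : phi 0 = 0 by have := phiD 0 0; rewrite addr0; lra.
have phiZ a v : phi (a *: v) = a * phi v.
  by have := lin a v 0; rewrite addr0 phi0 addr0.
have J_lb v : - (K ^+ 2 / c) <= J v.
  have h1 := coer v; have /ler_normlP[_ h2] := phiK v.
  apply: (@le_trans _ _ (c * `|v| ^+ 2 - 2 * (K * `|v|))); last by rewrite /J; lra.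
  rewrite -subr_ge0.
  have -> : c * `|v| ^+ 2 - 2 * (K * `|v|) - - (K ^+ 2 / c) =
    c * (`|v| - K / c) ^+ 2 by field; rewrite gt_eqF.
  by rewrite mulr_ge0 ?sqr_ge0// ltW.
pose m := inf (range J).
have has_infJ : has_inf (range J).
  split; first by exists (J 0); exists 0.
  by exists (- (K ^+ 2 / c)) => _ [v _ <-].
have Jm v : m <= J v by apply: ge_inf; [exact: has_infJ.2 | exists v].
have /choice[w wP] n : exists w, J w < m + n.+1%:R^-1.
  have [|_ [w _ <-] wn] := @inf_adherent R (range J) n.+1%:R^-1 _ has_infJ.
    by rewrite invr_gt0 ltr0n.
  by exists w.
have par u v : J u + J v - 2 * J (2^-1 *: (u + v)) = 2^-1 * b (u - v) (u - v).
  rewrite /J phiZ phiD (formBl hb) !(formBr hb) (formZl hb) (formZr hb) (formDl hb).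
  by rewrite !(formDr hb) (form_sym hb v u); field.
have dist n p : (n <= p)%N -> c * `|w n - w p| ^+ 2 <= 4 * n.+1%:R^-1.
  move=> np; apply: le_trans (coer _) _.
  have := par (w n) (w p); have := Jm (2^-1 *: (w n + w p)).
  have := wP n; have := wP p.
  have : p.+1%:R^-1 <= n.+1%:R^-1 :> R.
    by rewrite lef_pV2 ?posrE ?ltr0n// ler_nat ltnS.
  clearbody m J; move: (n.+1%:R^-1) (p.+1%:R^-1) => x y; lra.
have small e : 0 < e -> exists N, N.+1%:R^-1 < e :> R.
  move=> e0; exists (Num.truncn e^-1); rewrite invf_plt ?posrE ?ltr0n//.
  exact: truncnS_gt.
have cau : cauchy (w @ \oo).
  apply: cauchy_exP => e e0.
  have [N NP] := small (c * e ^+ 2 / 4) ltac:(by rewrite divr_gt0 ?mulr_gt0 ?exprn_gt0).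
  exists (w N); exists N => // n /= Nn; rewrite -ball_normE /=.
  rewrite -(ltr_pXn2r (n := 2))// ?nnegrE ?(ltW e0)//.
  rewrite -(ltr_pM2l c0); apply: le_lt_trans (dist _ _ Nn) _.
  by move: NP; move: (N.+1%:R^-1) => x; lra.
have /cvg_ex[/= w0 cvw] : cvg (w @ \oo) by exact: cauchy_cvg.
exists w0 => v; apply/eqP; rewrite -subr_eq0; apply/eqP.
suff /linear_coef0_of_ge0 h : forall h, 0 <= b v v * h ^+ 2 + (2 * (b w0 v - phi v)) * h by lra.
move=> t; rewrite leNgt; apply/negP => neg.
set q := _ + _ in neg.
have [N1 NP] := small (- q / 2) ltac:(by lra).
pose e := - q / 2 / (2 * `|t| * C * `|v| + 1).
have D0 : 0 < 2 * `|t| * C * `|v| + 1 by rewrite ltr_wpDl// !mulr_ge0.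
have e0 : 0 < e by rewrite divr_gt0//; lra.
have /cvgrPdist_lt /(_ e e0)[N2 _ N2P] := cvw.
pose n := maxn N1 N2.
have h1 : n.+1%:R^-1 < - q / 2.
  apply: le_lt_trans NP; rewrite lef_pV2 ?posrE ?ltr0n// ler_nat ltnS leq_maxl//.
have h2 : `|w0 - w n| < e by apply: N2P; rewrite /= leq_maxr.
have h3 := Jm (w n + t *: v); have h4 := wP n.
have : `|2 * t * b (w0 - w n) v| < - q / 2.
  rewrite !normrM ger0_norm//.
  apply: (@le_lt_trans _ _ (2 * `|t| * (C * `|w0 - w n| * `|v|))).
    by rewrite ler_wpM2l.
  apply: (@le_lt_trans _ _ ((2 * `|t| * C * `|v|) * e)).
    have -> : 2 * `|t| * (C * `|w0 - w n| * `|v|) = (2 * `|t| * C * `|v|) * `|w0 - w n| by ring.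
    by rewrite ler_wpM2l ?(ltW h2)// !mulr_ge0.
  have eE : (2 * `|t| * C * `|v| + 1) * e = - q / 2.
    by rewrite /e mulrC divfK// gt_eqF.
  by rewrite -eE ltr_pM2r// ltrDl ltr01.
move=> /ltr_normlP[+ _]; rewrite (formBl hb).
move: h3; rewrite /J phiD phiZ (formDl hb) !(formDr hb) !(formZl hb) !(formZr hb).
rewrite (form_sym hb v (w n)).
move: h4; rewrite /J; move: h1; rewrite /q; move: (n.+1%:R^-1) => x.
clearbody m; lra.
Qed.

(** * The forms of the gradient flow and the Taylor bound of the potential *)

Lemma bounded_linear_le (R : realType) (V W : normedModType R) (f : {linear V -> W}) :
  continuous f -> exists2 C, 0 <= C & forall v, `|f v| <= C * `|v|.
Proof.
move=> /linear_bounded_continuous/linear_boundedP[C [_ CP]].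
exists (Num.max C 0 + 1); first by rewrite addr_ge0// le_max lexx orbT.
by move=> v; apply: CP; rewrite ltr_pwDr// le_max lexx.
Qed.

Section mobility.
Variables (R : realType) (H V S : hilbertType R).
Variables (iSV : {linear S -> V}) (iVH : {linear V -> H}) (M : V -> V -> R).
Hypothesis hSVH : gelfand_triple iSV iVH.
Hypothesis hM : negative_operator M.

Lemma psd_form_neg_operator : psd_form (fun u v => - M u v).
Proof.
split => [u v|a u v w|v] /=.
- by rewrite (M_sym hM).
- by rewrite (M_linear hM); ring.
- have [c c0 cP] := M_coercive hM; apply: le_trans (cP v).
  by rewrite mulr_ge0 ?sqr_ge0// ltW.
Qed.

Lemma Minv_gelfand (h : H) (v : V) :
  M (Minv M (gelfand iVH h)) v = dotp h (iVH v).
Proof.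
suff /xgetPex : exists w, M w = gelfand iVH h by move=> /(_ 0) /= ->.
have [c c0 cP] := M_coercive hM; have [C C0 CP] := M_bounded hM.
have [K K0 KP] := bounded_linear_le (embedding_continuous (gelfand_VH hSVH)).
have [|a u w|u|w wP] := @Riesz_representation R V (fun u v => - M u v)
  (fun u => - dotp h (iVH u)) c C (`|h| * K)
  psd_form_neg_operator c0 cP (ltW C0).
- by move=> u w; rewrite normrN; exact: CP.
- rewrite linearP (formDr (psd_form_dotp H)) (formZr (psd_form_dotp H)); ring.
- rewrite normrN (le_trans (dotp_Cauchy_Schwarz _ _))// -mulrA.
  by rewrite ler_wpM2l.
by exists w; apply/funext => u; apply: oppr_inj; exact: wP.
Qed.

Lemma neg_operator_inj (u w : V) : (forall v, M u v = M w v) -> u = w.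
Proof.
move=> uw; have [c c0 cP] := M_coercive hM; have := cP (u - w).
have -> : M (u - w) (u - w) = 0.
  rewrite -[u - w]addrC -scaleN1r (M_linear hM) uw; ring.
rewrite oppr0 => h; apply/eqP; rewrite -subr_eq0 -normr_eq0 -sqrf_eq0.
by rewrite eq_le sqr_ge0 andbT -(pmulr_rle0 _ c0).
Qed.

Lemma Minv_gelfand_linear (a : R) (h g : H) :
  Minv M (gelfand iVH (a *: h + g)) =
  a *: Minv M (gelfand iVH h) + Minv M (gelfand iVH g).
Proof.
apply: neg_operator_inj => v; rewrite (M_linear hM) !Minv_gelfand.
exact: form_linear (psd_form_dotp H) _ _ _ _.
Qed.

(** The inner product [(h, -M^-1 g)] behind the norm [|(-M)^(-1/2) h|]. *)
Definition mobility_form (h g : H) : R := - dotp h (MinvH iVH M g).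

Lemma mobility_formE h g : mobility_form h g =
  - M (Minv M (gelfand iVH h)) (Minv M (gelfand iVH g)).
Proof. by rewrite Minv_gelfand. Qed.

Lemma psd_form_mobility : psd_form mobility_form.
Proof.
split=> [u v|a u v w|v]; rewrite ?mobility_formE.
- by rewrite (M_sym hM).
- by rewrite Minv_gelfand_linear (M_linear hM); ring.
- exact: (form_ge0 psd_form_neg_operator).
Qed.

Lemma norm_Minv_halfE h : norm_Minv_half iVH M h = Num.sqrt (mobility_form h h).
Proof.
by rewrite /norm_Minv_half (formNr (psd_form_dotp H)).
Qed.

Variable L : {linear S -> V}.
Hypothesis hL : symmetric_nonneg iSV iVH L.

(** The form behind the seminorm [|L^(1/2) u|]. *)
Definition stiffness_form (u v : S) : R := dotp (iVH (L u)) (iSH iSV iVH v).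

Lemma psd_form_stiffness : psd_form stiffness_form.
Proof.
split=> [u v|a u v w|v]; rewrite /stiffness_form.
- by rewrite (L_sym hL) dotpC.
- by rewrite !linearP (form_linear (psd_form_dotp H)).
- exact: L_ge0 hL v.
Qed.

End mobility.

(** The mean value theorem is applied to [s phi] minus its tangent and the parabola
    [K t^2 / 2], for both signs [s]; applied to [phi] alone it would lose a factor 2. *)
Lemma quadratic_taylor (R : realType) (phi dphi : R -> R) (K : R) :
  (forall t, is_derive t (1 : R) (phi : R -> R^o) (dphi t)) ->
  (forall t, 0 <= t -> `|dphi t - dphi 0| <= K * t) ->
  `|phi 1 - phi 0 - dphi 0| <= K / 2.
Proof.
move=> dP lip.
(* The sign [s] treats the two inequalities at once. *)
have side s : s ^+ 2 = 1 -> s * (phi 1 - phi 0 - dphi 0) <= K / 2.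
  move=> s2.
  pose f2 := (- (s * dphi 0)) \*: (id : R^o -> R^o).
  pose f3 := (- (K / 2)) \*: ((id : R^o -> R^o) ^+ 2).
  pose psi : R^o -> R^o := (s \*: (phi : R^o -> R^o)) + (f2 + f3).
  have psiD t : is_derive (t : R^o) (1 : R^o) psi (s * dphi t - s * dphi 0 - K * t).
    have h1 := is_deriveZ s (dP t).
    have h2 := is_deriveZ (- (s * dphi 0)) (is_derive_id (t : R^o) (1 : R^o)).
    have h3 := is_deriveZ (- (K / 2)) (is_deriveX 2 (is_derive_id (t : R^o) (1 : R^o))).
    apply: is_derive_eq (is_deriveD h1 (is_deriveD h2 h3)) _.
    by rewrite /GRing.scale /=; field.
  have [|c] := @MVT_segment R psi _ 0 1 ler01 (fun t _ => psiD t).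
    by apply: derivable_within_continuous => t _; have [] := psiD t.
  rewrite in_itv /= => /andP[c0 _].
  have psiE t : psi t = s * phi t - s * dphi 0 * t - K / 2 * t ^+ 2.
    rewrite /psi /f2 /f3 !fctE /=.
    change (s * phi t + (- (s * dphi 0) * t + - (K / 2) * (t : R) ^+ 2) =
      s * phi t - s * dphi 0 * t - K / 2 * t ^+ 2).
    by ring.
  rewrite !psiE subr0 mulr1 expr1n expr0n /= !mulr0 mulr1 !subr0.
  suff : s * dphi c - s * dphi 0 <= K * c by lra.
  rewrite -mulrBr (le_trans (ler_norm _))// normrM.
  have -> : `|s| = 1.
    by apply/eqP; rewrite -(eqrXn2 (n := 2))// expr1n real_normK ?num_real// s2.
  by rewrite mul1r lip.
rewrite ler_norml; apply/andP; split.
  by have := side (-1); rewrite sqrrN expr1n => /(_ erefl); lra.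
by have := side 1; rewrite expr1n mul1r => /(_ erefl).
Qed.

Section taylor.
Variables (R : realType) (d : nat) (H V S : hilbertType R).
Variables (iSV : {linear S -> V}) (iVH : {linear V -> H}).
Variables (F : S -> d.-tuple R -> R) (f : S -> V) (lf : R).
Hypothesis lf_ge0 : 0 <= lf.
Hypothesis hf : lipschitz_gradient iSV iVH F f lf.
Local Notation iS := (iSH iSV iVH).

Lemma iSH_linear (a : R) (u v : S) : iS (a *: u + v) = a *: iS u + iS v.
Proof. by rewrite /iS /iSH !linearP. Qed.

Lemma lipschitz_dotp (u v : S) (h : H) :
  `|dotp (iVH (f u) - iVH (f v)) h| <= lf * `|iS u - iS v| * `|h|.
Proof.
by rewrite (le_trans (dotp_Cauchy_Schwarz _ _))// ler_wpM2r// (f_lipschitz hf).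
Qed.

Lemma is_derive_potential_line (u w : S) (t : R) :
  is_derive t 1 (fun t : R => potential_energy F (u + t *: w) : R^o)
    (dotp (iVH (f (u + t *: w))) (iS w)).
Proof.
have qE : (fun s : R => s^-1 *: (((fun t : R => potential_energy F (u + t *: w) : R^o)
      \o shift t) (s *: (1 : R)) - potential_energy F (u + t *: w))) =
    (fun s : R => s^-1 *: (((potential_energy F : S -> R^o) \o shift (u + t *: w)) (s *: w)
      - potential_energy F (u + t *: w))).
  apply/funext => s /=; congr (_ *: (potential_energy F _ - _)).
  by rewrite [s *: 1]mulr1 scalerDl addrCA.
have [hd he] := F_derive hf (u + t *: w) w; split.
  by rewrite /derivable qE.
by rewrite -he /derive qE.
Qed.

Lemma potential_taylor (u v : S) :
  `|potential_energy F u - potential_energy F v - dotp (iVH (f v)) (iS u - iS v)|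
  <= lf / 2 * `|iS u - iS v| ^+ 2.
Proof.
have wE : iS (u - v) = iS u - iS v.
  by have := iSH_linear (-1) v u; rewrite !scaleN1r addrC => ->; rewrite addrC.
rewrite -wE; set w := u - v.
have := @quadratic_taylor R (fun t => potential_energy F (v + t *: w))
  (fun t => dotp (iVH (f (v + t *: w))) (iS w)) (lf * `|iS w| ^+ 2).
rewrite scale1r scale0r addr0 [v + w]addrC subrK mulrAC; apply.
  by move=> t; exact: is_derive_potential_line.
move=> t t0; rewrite -(formBl (psd_form_dotp H)).
apply: le_trans (lipschitz_dotp _ _ _) _.
have -> : iS (v + t *: w) - iS v = t *: iS w.
  by rewrite addrC -[iS (v + _)]/(iS _) [v + _]addrC iSH_linear addrC addrK.
by rewrite normrZ ger0_norm// le_eqVlt; apply/orP; left; apply/eqP; ring.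
Qed.

End taylor.

(** * Absorption by interpolation *)

(** Young's inequality with the exponents [1 / eta] and [1 / (1 - eta)]. *)
Lemma weighted_AM_GM (R : realType) (x y eta : R) :
  0 <= x -> 0 <= y -> 0 < eta < 1 ->
  x `^ eta * y `^ (1 - eta) <= eta * x + (1 - eta) * y.
Proof.
move=> x0 y0 /andP[eta0 eta1]; have eta1' : 0 < 1 - eta by lra.
have := @conjugate_powR R (x `^ eta) (y `^ (1 - eta)) eta^-1 (1 - eta)^-1
  (powR_ge0 _ _) (powR_ge0 _ _).
rewrite !invr_gt0 !invrK => /(_ eta0 eta1' ltac:(by rewrite addrC subrK)).
rewrite -!powRrM !mulfV ?gt_eqF// !powRr1//.
by rewrite [x * _]mulrC [y * _]mulrC.
Qed.

(** The right side is [eta (A X) + (1 - eta) (B Y)] with [A = alpha / (tau eta)] and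
    [B = beta / (1 - eta)], hence at least [(A X)^eta (B Y)^(1 - eta)].  The bound on
    [tau] is [c zeta^2 <= A^eta B^(1 - eta)], raised to the power [1 / eta] and solved
    for [tau].  At [eta = 1] the second factor is absent. *)
Lemma interpolation_absorb (R : realType) (alpha beta c zeta eta tau X Y n : R) :
  0 < alpha -> 0 < beta -> 0 < c -> 0 < zeta -> 0 < eta -> eta <= 1 -> 0 < tau ->
  0 <= X -> 0 <= Y -> 0 <= n ->
  tau <= alpha * beta `^ etabar eta /
    (c `^ (1 + etabar eta) * eta * (1 - eta) `^ etabar eta *
     zeta `^ (2 + 2 * etabar eta)) ->
  n <= zeta * Num.sqrt X `^ eta * Num.sqrt Y `^ (1 - eta) ->
  c * n ^+ 2 <= alpha / tau * X + beta * Y.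
Proof.
move=> a0 b0 c0 z0 e0 e1 t0 X0 Y0 n0 tauP nP.
have sq (x r : R) : 0 <= x -> (Num.sqrt x `^ r) ^+ 2 = x `^ r.
  by move=> x0; rewrite -powR12_sqrt// -powR_mulrn ?powR_ge0// -!powRrM; congr (_ `^ _); field.
have n2 : n ^+ 2 <= zeta ^+ 2 * (X `^ eta * Y `^ (1 - eta)).
  apply: (@le_trans _ _ ((zeta * Num.sqrt X `^ eta * Num.sqrt Y `^ (1 - eta)) ^+ 2)).
    by rewrite ler_pXn2r// ?nnegrE ?mulr_ge0 ?powR_ge0// ltW.
  by rewrite !exprMn !sq// mulrA.
have [eE|eN] := eqVneq eta 1.
  move: tauP n2; rewrite eE /etabar subrr mul0r !powRr0 addr0 !powRr1 ?(ltW c0)// !mulr1.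
  rewrite mulr0 addr0 powR_mulrn ?(ltW z0)// => tauP n2.
  apply: (@le_trans _ _ (alpha / tau * X)); last by rewrite lerDl mulr_ge0// ltW.
  apply: (@le_trans _ _ (c * (zeta ^+ 2 * X))); first by rewrite ler_pM2l.
  rewrite mulrA ler_wpM2r// ler_pdivlMr// mulrC -ler_pdivlMr//.
  by rewrite mulr_gt0// exprn_gt0.
have e1' : eta < 1 by rewrite lt_neqAle eN.
have d0 : 0 < 1 - eta by lra.
set h := etabar eta in tauP.
have hE : h * eta = 1 - eta by rewrite /h /etabar divfK// gt_eqF.
pose A := alpha / (tau * eta); pose B := beta / (1 - eta).
have A0 : 0 < A by rewrite divr_gt0// mulr_gt0.
have B0 : 0 < B by rewrite divr_gt0.
have h0 : 0 <= h by rewrite /h /etabar divr_ge0// ltW.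
have key : c `^ (1 + h) * zeta `^ (2 + 2 * h) <= A * B `^ h.
  rewrite /B powRM ?(ltW b0)// ?invr_ge0 ?(ltW d0)//.
  have -> : (1 - eta)^-1 `^ h = ((1 - eta) `^ h)^-1.
    by rewrite -powR_inv1 ?ltW// -powRrM mulN1r powRN.
  have d1 : 0 < (1 - eta) `^ h by rewrite powR_gt0.
  have D0 : 0 < c `^ (1 + h) * eta * (1 - eta) `^ h * zeta `^ (2 + 2 * h).
    by rewrite !mulr_gt0// powR_gt0.
  move: tauP; rewrite ler_pdivlMr// => tauP.
  have -> : A * (beta `^ h / (1 - eta) `^ h) =
    alpha * beta `^ h / (tau * eta * (1 - eta) `^ h).
    by rewrite /A; field; rewrite !gt_eqF.
  rewrite ler_pdivlMr ?mulr_gt0//; apply: le_trans tauP.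
  by rewrite le_eqVlt; apply/orP; left; apply/eqP; ring.
have key2 : c * zeta ^+ 2 <= A `^ eta * B `^ (1 - eta).
  have := ge0_ler_powR (ltW e0) _ _ key.
  rewrite !nnegrE => /(_ (mulr_ge0 (powR_ge0 _ _) (powR_ge0 _ _))
                          (mulr_ge0 (ltW A0) (powR_ge0 _ _))).
  rewrite (powRM _ (powR_ge0 _ _) (powR_ge0 _ _)) (powRM _ (ltW A0) (powR_ge0 _ _)).
  rewrite -!powRrM hE.
  have -> : (1 + h) * eta = 1 by rewrite mulrDl mul1r hE addrC subrK.
  have -> : (2 + 2 * h) * eta = 2 by rewrite mulrDl -mulrA hE; ring.
  by rewrite powRr1 ?(ltW c0)// powR_mulrn ?(ltW z0).
have := weighted_AM_GM (mulr_ge0 (ltW A0) X0) (mulr_ge0 (ltW B0) Y0) (eta := eta).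
rewrite e0 e1' => /(_ isT) AG.
apply: (@le_trans _ _ (c * (zeta ^+ 2 * (X `^ eta * Y `^ (1 - eta))))).
  by rewrite ler_pM2l.
apply: (@le_trans _ _ ((A * X) `^ eta * (B * Y) `^ (1 - eta))).
  rewrite (powRM _ (ltW A0) X0) (powRM _ (ltW B0) Y0) [leLHS]mulrA [leRHS]mulrACA.
  by rewrite ler_wpM2r// mulr_ge0 ?powR_ge0.
apply: le_trans AG _; rewrite le_eqVlt; apply/orP; left; apply/eqP.
by rewrite /A /B; field; rewrite !gt_eqF.
Qed.

(** * Decay of the energy in one step *)

Lemma sum_nat_indicator (R : realType) k m n (F : nat -> R) : (n <= k)%N ->
  \sum_(m <= i < n) F i = \sum_(i < k) ((m <= i) && (i < n))%N%:R * F i.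
Proof.
move=> nk; rewrite big_geq_mkord (big_ord_widen_cond k (fun i => m <= i)%N F)//.
rewrite big_mkcond; apply: eq_bigr => i _.
by case: ifP => _; rewrite ?mul1r ?mul0r.
Qed.

(** [chat_i - chat_(i+1) = ctilde_i], summed by parts. *)
Lemma chat_telescope (R : realType) r (Bh mu x : nat -> R) :
  \sum_(1 <= i < r.+1) chat r.+1 Bh mu i * x i.-1 -
  \sum_(1 <= i < r.+1) chat r.+1 Bh mu i * x i =
  chat r.+1 Bh mu 0 * x 0%N - \sum_(i < r.+1) ctilde r.+1 Bh mu i * x i.
Proof.
have rec i : (i < r.+1)%N ->
    ctilde r.+1 Bh mu i = chat r.+1 Bh mu i - chat r.+1 Bh mu i.+1.
  by move=> ir; rewrite /chat (big_ltn ir) addrK.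
have last0 : chat r.+1 Bh mu r.+1 = 0 by rewrite /chat big_geq.
under [X in _ = _ - X]eq_bigr => i _ do rewrite rec// mulrBl.
rewrite !big_add1 !big_mkord /= sumrB big_ord_recl [X in _ - (_ - X)]big_ord_recr /=.
rewrite last0 mul0r addr0; ring.
Qed.

Section one_step.
Variables (R : realType) (S : lmodType R) (K Lf D : S -> S -> R).
Variables (E : S -> R) (fS : S -> S -> R) (lf : R).
Hypothesis hK : psd_form K.
Hypothesis hLf : psd_form Lf.
Hypothesis hD : psd_form D.
Hypothesis lf_ge0 : 0 <= lf.
Hypothesis fS_linear : forall u a v w, fS u (a *: v + w) = a * fS u v + fS u w.
Hypothesis taylor : forall u v,
  `|E u - E v - fS v (u - v)| <= lf / 2 * D (u - v) (u - v).
Hypothesis lip : forall u v w,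
  `|fS u w - fS v w| <= lf / 2 * (D (u - v) (u - v) + D w w).

Lemma gradientD u v w : fS u (v + w) = fS u v + fS u w.
Proof. by have := fS_linear u 1 v w; rewrite scale1r mul1r. Qed.

Lemma gradient0 u : fS u 0 = 0.
Proof. by have := gradientD u 0 0; rewrite addr0; lra. Qed.

Lemma gradientZ u a v : fS u (a *: v) = a * fS u v.
Proof. by have := fS_linear u a v 0; rewrite addr0 gradient0 addr0. Qed.

Lemma gradientN u v : fS u (- v) = - fS u v.
Proof. by rewrite -scaleN1r gradientZ mulN1r. Qed.

Lemma gradient_sum u r (c : nat -> R) (v : nat -> S) :
  fS u (\sum_(i < r) c i *: v i) = \sum_(i < r) c i * fS u (v i).
Proof.
rewrite (big_morph (fS u) (gradientD u) (gradient0 u)).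
by apply: eq_bigr => i _; rewrite gradientZ.
Qed.

Lemma formN_sqr (b : S -> S -> R) u : psd_form b -> b (- u) (- u) = b u u.
Proof. by move=> hb; rewrite (formNl hb) (formNr hb) opprK. Qed.

Section sequence.
Variable v : nat -> S.
Let e i := v i - v i.+1.
Let x i := D (e i) (e i).

Let x_ge0 i : 0 <= x i. Proof. exact: form_ge0 hD _. Qed.

(** Each step of the walk from [v_1] to [v_(j+1)] costs one Lipschitz bound. *)
Lemma gradient_walk j w :
  `|fS (v j.+1) w - fS (v 1%N) w| <= lf / 2 * \sum_(1 <= i < j.+1) (x i + D w w).
Proof.
elim: j => [|j IH]; first by rewrite subrr normr0 big_geq// mulr0.
rewrite big_nat_recr//= mulrDr.
rewrite -(subrKA (fS (v j.+1) w)) (le_trans (ler_normD _ _))// addrC lerD//.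
by rewrite distrC; exact: lip.
Qed.

(** For [j = 0] the Taylor bound is centred at [v_1].  For [j > 0] it is centred at
    [v_j], and the gradient is then carried from [v_j] to [v_1]. *)
Lemma potential_increment j :
  `|E (v j) - E (v j.+1) - fS (v 1%N) (e j)| <=
  lf / 2 * (x j + (j != 0%N)%:R * x j + \sum_(1 <= i < j.+1) j%:R * x i).
Proof.
case: j => [|j].
  by rewrite eqxx mul0r addr0 big_geq// addr0; exact: taylor.
have h1 : `|E (v j.+1) - E (v j.+2) - fS (v j.+1) (e j.+1)| <= lf / 2 * x j.+1.
  rewrite /x -(formN_sqr (e j.+1) hD).
  have := taylor (v j.+2) (v j.+1); rewrite -[v j.+2 - v j.+1]opprB gradientN opprK.
  by rewrite -normrN -/(e _); congr (`|_| <= _); ring.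
rewrite -(subrKA (fS (v j.+1) (e j.+1))) (le_trans (ler_normD _ _))//.
rewrite mul1r -[x _ + x _ + _]addrA mulrDr lerD//.
apply: le_trans (gradient_walk j (e j.+1)) _; rewrite ler_wpM2l ?divr_ge0//.
rewrite -/(x _) big_split /= sumr_const_nat subn1 /= -mulr_natl.
rewrite [X in _ <= _ + X]big_nat_recr//= addrCA addrC.
have s0 : 0 <= \sum_(1 <= i < j.+1) x i by apply: sumr_ge0.
rewrite -mulr_sumr -natr1.
have j0 : 0 <= j%:R :> R by rewrite ler0n.
have := x_ge0 j.+1; nra.
Qed.

(** The weights [ctilde_i] collect the coefficient of each squared increment: the first
    two terms come from the extrapolation coefficients, the others from
    [potential_increment]. *)
Lemma nonlinear_bound k (Bh mu : nat -> R) (w : S) :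
  w = \sum_(i < k) mu i *: e i ->
  \sum_(i < k) mu i * (E (v i) - E (v i.+1)) -
  (fS (v 1%N) w + \sum_(1 <= i < k) coef_bh Bh i * (fS (v i) w - fS (v i.+1) w))
  <= lf / 2 * \sum_(i < k) ctilde k Bh mu i * x i.
Proof.
move=> wE.
have fw u : fS u w = \sum_(i < k) mu i * fS u (e i) by rewrite wE gradient_sum.
have P1 : \sum_(i < k) mu i * (E (v i) - E (v i.+1)) - fS (v 1%N) w <=
    lf / 2 * \sum_(j < k) `|mu j| *
      (x j + (j != 0%N :> nat)%:R * x j + \sum_(1 <= i < j.+1) j%:R * x i).
  rewrite fw -sumrB mulr_sumr; apply: ler_sum => j _.
  rewrite -mulrBr (le_trans (ler_norm _))// normrM [leRHS]mulrCA ler_wpM2l//.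
  exact: potential_increment.
have P2 : - \sum_(1 <= i < k) coef_bh Bh i * (fS (v i) w - fS (v i.+1) w) <=
    lf / 2 * \sum_(1 <= i < k) \sum_(j < k)
      `|coef_bh Bh i| * `|mu j| * (x i + x j).
  rewrite -sumrN mulr_sumr; apply: ler_sum => i _.
  rewrite (le_trans (ler_norm _))// normrN normrM.
  have -> : fS (v i) w - fS (v i.+1) w =
      \sum_(j < k) mu j * (fS (v i) (e j) - fS (v i.+1) (e j)).
    by rewrite !fw -sumrB; apply: eq_bigr => j _; rewrite mulrBr.
  apply: (@le_trans _ _ (`|coef_bh Bh i| * \sum_(j < k) `|mu j| * (lf / 2 * (x i + x j)))).
    rewrite ler_wpM2l// (le_trans (ler_norm_sum _ _ _))//.
    apply: ler_sum => j _; rewrite normrM ler_wpM2l//; exact: lip.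
  rewrite le_eqVlt; apply/orP; left; apply/eqP.
  by rewrite !mulr_sumr; apply: eq_bigr => j _; ring.
apply: (@le_trans _ _ (lf / 2 * (\sum_(j < k) `|mu j| *
      (x j + (j != 0%N :> nat)%:R * x j + \sum_(1 <= i < j.+1) j%:R * x i) +
    \sum_(1 <= i < k) \sum_(j < k) `|coef_bh Bh i| * `|mu j| * (x i + x j)))).
  by rewrite mulrDr opprD addrA lerD.
rewrite ler_wpM2l ?divr_ge0// le_eqVlt; apply/orP; left; apply/eqP.
pose Mu := \sum_(j < k) `|mu j|.
pose Bt := \sum_(1 <= j < k) `|coef_bh Bh j|.
have s1 : \sum_(1 <= i < k) \sum_(j < k) `|coef_bh Bh i| * `|mu j| * (x i + x j) =
    \sum_(i < k) ((i != 0%N :> nat)%:R * `|coef_bh Bh i| * Mu + `|mu i| * Bt) * x i.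
  under [RHS]eq_bigr => i _ do rewrite mulrDl.
  rewrite big_split /=.
  transitivity (\sum_(1 <= i < k) `|coef_bh Bh i| * Mu * x i + Bt * \sum_(j < k) `|mu j| * x j).
    rewrite /Bt mulr_suml -big_split; apply: eq_bigr => i _ /=.
    rewrite /Mu mulr_sumr mulr_suml mulr_sumr -big_split.
    by apply: eq_bigr => j _ /=; ring.
  congr (_ + _); last by rewrite mulr_sumr; apply: eq_bigr => j _; ring.
  rewrite (sum_nat_indicator 1 (fun i => `|coef_bh Bh i| * Mu * x i) (leqnn k)).
  by apply: eq_bigr => i _; rewrite ltn_ord andbT lt0n; ring.
have s2 : \sum_(j < k) `|mu j| * \sum_(1 <= i < j.+1) j%:R * x i =
    \sum_(i < k) (\sum_(i <= j < k) j%:R * `|mu j|) * (i != 0%N :> nat)%:R * x i.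
  transitivity (\sum_(j < k) \sum_(i < k)
      ((0 < i) && (i < j.+1))%N%:R * (`|mu j| * j%:R * x i)).
    apply: eq_bigr => j _.
    rewrite (sum_nat_indicator 1 (fun i => j%:R * x i) (ltn_ord j)) mulr_sumr.
    by apply: eq_bigr => i _; ring.
  rewrite exchange_big; apply: eq_bigr => i _ /=.
  rewrite (sum_nat_indicator i (fun j => j%:R * `|mu j|) (leqnn k)) !mulr_suml.
  apply: eq_bigr => j _; rewrite ltn_ord andbT ltnS lt0n.
  by case: (i != 0%N :> nat); rewrite ?andbF /=; ring.
rewrite s1; under [X in X + _ = _]eq_bigr => j _ do rewrite mulrDr.
rewrite big_split /= s2 -!big_split; apply: eq_bigr => i _ /=.
by rewrite /ctilde -/Mu -/Bt; ring.
Qed.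

(** Tested with [sum_i mu_i e_i], the scheme balances the two quadratic energies against the
    explicit terms; the squares of the spectral factors have the good sign and are
    dropped, and the penalties are the values of the forms at the new increment
    [e_0]. *)
Lemma energy_step r (A B Bh mu : nat -> R) (Ga ga GB gB : _) (alpha beta tau : R) :
  0 < tau ->
  energy_matrix r mu A (@delta0 R) alpha Ga ga ->
  energy_matrix r.+1 (nu r.+1 mu) B (@delta01 R) beta GB gB ->
  (forall w, tau^-1 * \sum_(i < r.+1) A i * K (e i) w +
     \sum_(i < r.+2) B i * Lf (v i) w + (fS (v 1%N) w +
     \sum_(1 <= i < r.+1) coef_bh Bh i * (fS (v i) w - fS (v i.+1) w)) = 0) ->
  lf * chat r.+1 Bh mu 0 / 2 * x 0%N <=
    alpha / tau * K (e 0%N) (e 0%N) + beta * Lf (e 0%N) (e 0%N) ->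
  tau^-1 * \sum_(i < r) \sum_(j < r) Ga i j * K (e i) (e j) +
  \sum_(i < r.+1) \sum_(j < r.+1) GB i j * Lf (v i) (v j) +
  \sum_(i < r.+1) mu i * E (v i) +
  lf / 2 * \sum_(1 <= i < r.+1) chat r.+1 Bh mu i * x i.-1 <=
  tau^-1 * \sum_(i < r) \sum_(j < r) Ga i j * K (e i.+1) (e j.+1) +
  \sum_(i < r.+1) \sum_(j < r.+1) GB i j * Lf (v i.+1) (v j.+1) +
  \sum_(i < r.+1) mu i * E (v i.+1) +
  lf / 2 * \sum_(1 <= i < r.+1) chat r.+1 Bh mu i * x i.
Proof.
move=> tau0 [_ idA _ _] [_ idB _ _] eqn absorb.
pose w := \sum_(i < r.+1) mu i *: e i.
have wE : w = \sum_(i < r.+2) nu r.+1 mu i *: v i by rewrite sum_nu.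
have d0E : \sum_(i < r.+1) delta0 R i *: e i = e 0%N.
  rewrite big_ord_recl big1 => [|i _]; last by rewrite /delta0 /= scale0r.
  by rewrite /delta0 /= scale1r addr0.
have d1E : \sum_(i < r.+2) delta01 R i *: v i = e 0%N.
  rewrite 2!big_ord_recl big1 => [|i _]; last by rewrite /delta01 /= subrr scale0r.
  by rewrite /delta01 /= subr0 sub0r scale1r scaleN1r addr0.
have bK := idA (fun i j => K (e i) (e j)) (fun i j => form_sym hK _ _).
rewrite -!(form_combination hK r.+1) d0E -/w in bK.
have bL := idB (fun i j => Lf (v i) (v j)) (fun i j => form_sym hLf _ _).
rewrite -!(form_combination hLf r.+2) d1E -wE in bL.
have := eqn w.
have -> : \sum_(i < r.+1) A i * K (e i) w = K w (\sum_(j < r.+1) A j *: e j).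
  by rewrite (form_sumr hK); apply: eq_bigr => i _; rewrite (formZr hK) (form_sym hK w).
have -> : \sum_(i < r.+2) B i * Lf (v i) w = Lf w (\sum_(j < r.+2) B j *: v j).
  by rewrite (form_sumr hLf); apply: eq_bigr => i _; rewrite (formZr hLf) (form_sym hLf w).
rewrite bK bL.
have gK := form_ge0 hK (\sum_(i < r.+1) ga i *: e i).
have gL := form_ge0 hLf (\sum_(i < r.+2) gB i *: v i).
have nl := nonlinear_bound Bh (erefl w).
have tel := chat_telescope r Bh mu x.
have muE : \sum_(i < r.+1) mu i * (E (v i) - E (v i.+1)) =
    \sum_(i < r.+1) mu i * E (v i) - \sum_(i < r.+1) mu i * E (v i.+1).
  by rewrite -sumrB; apply: eq_bigr => i _; rewrite mulrBr.
rewrite muE in nl.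
have tgK : 0 <= tau^-1 * K (\sum_(i < r.+1) ga i *: e i) (\sum_(i < r.+1) ga i *: e i).
  by rewrite mulr_ge0// invr_ge0 ltW.
move: nl absorb tel tgK gL; rewrite -!/(x _).
move: (fS _ w + _) => Nl.
move: (\sum_(1 <= i < r.+1) chat r.+1 Bh mu i * x i.-1) => c1.
move: (\sum_(1 <= i < r.+1) chat r.+1 Bh mu i * x i) => c2.
move: (\sum_(i < r.+1) ctilde r.+1 Bh mu i * x i) => c3.
move: (x 0%N) (chat r.+1 Bh mu 0) => x0 c0.
have -> : alpha / tau * K (e 0%N) (e 0%N) = tau^-1 * (alpha * K (e 0%N) (e 0%N)) by ring.
move: (tau^-1) => it; nra.
Qed.

End sequence.
End one_step.

(** * Nonnegativity of the energy *)

Section nonnegativity.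
Variables (R : realType) (S : lmodType R) (K Lf D : S -> S -> R).
Variables (E : S -> R) (fS : S -> S -> R) (lf : R).
Hypothesis hK : psd_form K.
Hypothesis hLf : psd_form Lf.
Hypothesis hD : psd_form D.
Hypothesis lf_ge0 : 0 <= lf.
Hypothesis E_ge0 : forall u, 0 <= E u.
Hypothesis fS_linear : forall u a v w, fS u (a *: v + w) = a * fS u v + fS u w.
Hypothesis taylor : forall u v,
  `|E u - E v - fS v (u - v)| <= lf / 2 * D (u - v) (u - v).
Variable p : nat -> S.
Let y i := D (p i.-1 - p i) (p i.-1 - p i).

Let y_ge0 i : 0 <= y i. Proof. exact: form_ge0 hD _. Qed.

(** The first-order terms of the Taylor bounds around the weighted mean [m] cancel,
    even though the weights may be negative. *)
Lemma affine_potential_ge k (mu : nat -> R) (m : S) :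
  \sum_(i < k) mu i = 1 -> m = \sum_(i < k) mu i *: p i ->
  - (lf / 2 * \sum_(q < k) `|mu q| * D (p q - m) (p q - m)) <=
  \sum_(q < k) mu q * E (p q).
Proof.
move=> mu1 mE.
have cancel0 : \sum_(q < k) mu q * fS m (p q - m) = 0.
  rewrite -(gradient_sum fS_linear m k mu (fun q => p q - m)).
  rewrite (_ : \sum_(q < k) _ = 0) ?(gradient0 fS_linear)//.
  under eq_bigr => q _ do rewrite scalerBr.
  by rewrite sumrB -mE -scaler_suml mu1 scale1r subrr.
have -> : \sum_(q < k) mu q * E (p q) =
    E m + \sum_(q < k) mu q * (E (p q) - E m - fS m (p q - m)).
  under [X in _ = _ + X]eq_bigr => q _ do rewrite !mulrBr.
  by rewrite !sumrB cancel0 subr0 -mulr_suml mu1 mul1r addrC subrK.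
apply: (@le_trans _ _ (\sum_(q < k) mu q * (E (p q) - E m - fS m (p q - m)))); last first.
  by rewrite lerDr.
rewrite mulr_sumr -sumrN; apply: ler_sum => q _.
by rewrite lerNl (le_trans (ler_norm _))// normrN normrM mulrCA ler_wpM2l.
Qed.

(** Convexity of the square along the path from [p_m] to [p_(m+n)]. *)
Lemma path_form_le m n :
  D (p m - p (m + n)%N) (p m - p (m + n)%N) <=
  n%:R * \sum_(i < n) y (m + i).+1.
Proof.
have -> : p m - p (m + n)%N = \sum_(i < n) (1 : R) *: (p (m + i)%N - p (m + i).+1).
  elim: n => [|n IH]; first by rewrite addn0 subrr big_ord0.
  by rewrite big_ord_recr /= -IH scale1r subrKA addnS.
apply: le_trans (form_weighted_sum_le hD n (fun=> 1) (fun i => p (m + i)%N - p (m + i).+1)) _.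
rewrite normr1 sumr_const card_ord ler_wpM2l// ?ler0n//.
by apply: ler_sum => i _; rewrite mul1r.
Qed.

Let h i m j : R := ((m < i) && (i < j.+1))%N%:R * (j%:R - m%:R).

Let h_ge0 i m j : 0 <= h i m j.
Proof.
rewrite /h; have [/andP[mi ij]|_] := boolP ((m < i) && (i < j.+1))%N; last by rewrite mul0r.
by rewrite mul1r subr_ge0 ler_nat; lia.
Qed.

Lemma pair_form_le k m j : (m < k)%N -> (j < k)%N ->
  D (p m - p j) (p m - p j) <= \sum_(i < k) (h i m j + h i j m) * y i.
Proof.
wlog mj : m j / (m <= j)%N => [wl mk jk|mk jk].
  have [mj|/ltnW jm] := leqP m j; first exact: wl.
  rewrite -opprB (formN_sqr _ hD) (le_trans (wl j m jm jk mk))//.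
  by apply: ler_sum => i _; rewrite addrC.
have := path_form_le m (j - m); rewrite subnKC// => /le_trans; apply.
rewrite (_ : \sum_(i < j - m) _ = \sum_(m.+1 <= i < j.+1) y i); last first.
  rewrite -[m.+1]add0n big_addn subSS big_mkord; apply: eq_bigr => i _.
  by rewrite addnS addnC.
rewrite (sum_nat_indicator _ _ jk) mulr_sumr; apply: ler_sum => i _.
rewrite mulrA ler_wpM2r// (le_trans (_ : _ <= h i m j)) ?lerDl//.
by rewrite /h natrB// mulrC.
Qed.

(** Convexity bounds [|p_q - m|^2] by the distances [|p_q - p_j|^2] with the weights
    [|mu_j|], and each distance by the increments between [q] and [j].  The number
    [cbar_i] weighs the pairs whose path crosses the increment [i]. *)
Lemma variance_le k (mu : nat -> R) (m : S) :
  \sum_(i < k) mu i = 1 -> m = \sum_(i < k) mu i *: p i ->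
  \sum_(q < k) `|mu q| * D (p q - m) (p q - m) <=
  2 * \sum_(i < k) cbar k mu i * y i.
Proof.
move=> mu1 mE; pose Mu := \sum_(q < k) `|mu q|.
have Mu0 : 0 <= Mu by apply: sumr_ge0.
have one q : D (p q - m) (p q - m) <=
    Mu * \sum_(j < k) `|mu j| * D (p q - p j) (p q - p j).
  have -> : p q - m = \sum_(j < k) mu j *: (p q - p j).
    under eq_bigr => j _ do rewrite scalerBr.
    by rewrite sumrB -mE -scaler_suml mu1 scale1r.
  exact: (form_weighted_sum_le hD k mu (fun j => p q - p j)).
apply: (@le_trans _ _ (\sum_(q < k) `|mu q| * (Mu * \sum_(j < k)
    `|mu j| * \sum_(i < k) (h i q j + h i j q) * y i))).
  apply: ler_sum => q _; rewrite ler_wpM2l// (le_trans (one q))// ler_wpM2l//.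
  by apply: ler_sum => j _; rewrite ler_wpM2l// pair_form_le.
rewrite le_eqVlt; apply/orP; left; apply/eqP.
pose T i := \sum_(q < k) \sum_(j < k) `|mu q| * `|mu j| * h i q j.
have TE i : (i < k)%N -> cbar k mu i = Mu * T i.
  move=> ik; rewrite /cbar -mulr_suml -/Mu; congr (_ * _).
  rewrite -(big_mkord xpredT (fun m => \sum_(i <= j < k) `|mu m| * `|mu j| * (j%:R - m%:R))).
  rewrite (sum_nat_indicator 0 _ (ltnW ik)); apply: eq_bigr => q _ /=.
  rewrite (sum_nat_indicator i _ (leqnn k)) mulr_sumr; apply: eq_bigr => j _.
  rewrite /h ltn_ord andbT ltnS.
  by case: (q < i)%N; case: (i <= j)%N; rewrite /=; ring.
under [in RHS]eq_bigr => i _ do rewrite TE//.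
have Tsym i : \sum_(q < k) \sum_(j < k) `|mu q| * `|mu j| * h i j q = T i.
  rewrite exchange_big; apply: eq_bigr => q _; apply: eq_bigr => j _ /=; ring.
transitivity (\sum_(i < k) \sum_(q < k) \sum_(j < k)
    `|mu q| * `|mu j| * (h i q j + h i j q) * (Mu * y i)).
  rewrite exchange_big; apply: eq_bigr => q _ /=; rewrite exchange_big /=.
  rewrite !mulr_sumr; apply: eq_bigr => j _; rewrite !mulr_sumr.
  by apply: eq_bigr => i _; ring.
rewrite mulr_sumr; apply: eq_bigr => i _.
transitivity ((T i + T i) * (Mu * y i)); last by ring.
rewrite -{2}(Tsym i) /T -big_split [RHS]mulr_suml; apply: eq_bigr => q _ /=.
by rewrite -big_split [RHS]mulr_suml; apply: eq_bigr => j _ /=; ring.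
Qed.

Lemma cmin_le k (Bh mu : nat -> R) i : (1 <= i < k)%N ->
  cmin k Bh mu <= chat k Bh mu i / 2 - cbar k mu i.
Proof.
move=> ik; rewrite /cmin.
pose c j := chat k Bh mu j / 2 - cbar k mu j.
have ir : i \in index_iota 1 k by rewrite mem_index_iota.
exact: (ge_bigmin_seq (c 1%N) i xpredT c ir).
Qed.

(** The potential part loses at most [lf cbar_i] times each squared increment, while the
    last term of the energy offers [lf chat_i / 2]. *)
Lemma energy_ge0 r (Bh mu : nat -> R) (Ga GB : nat -> nat -> R)
    (la lB tau : R) :
  0 < tau -> 0 < la -> 0 < lB ->
  (forall i j, Ga i j = Ga j i) -> (forall i j, GB i j = GB j i) ->
  (forall x : nat -> R, la * \sum_(i < r) x i ^+ 2 <= quad_form r Ga x) ->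
  (forall x : nat -> R, lB * \sum_(i < r.+1) x i ^+ 2 <= quad_form r.+1 GB x) ->
  \sum_(i < r.+1) mu i = 1 ->
  (cmin r.+1 Bh mu < 0 -> forall u,
    lf * `|cmin r.+1 Bh mu| * D u u <= la / tau * K u u + lB / 4 * Lf u u) ->
  0 <= tau^-1 * \sum_(i < r) \sum_(j < r) Ga i j * K (p i - p i.+1) (p j - p j.+1) +
  \sum_(i < r.+1) \sum_(j < r.+1) GB i j * Lf (p i) (p j) +
  \sum_(i < r.+1) mu i * E (p i) +
  lf / 2 * \sum_(1 <= i < r.+1) chat r.+1 Bh mu i * y i.
Proof.
move=> tau0 la0 lB0 Gasym GBsym Gala GBlB mu1 absorb.
have hA := psd_tensor_ge (fun i => p i - p i.+1) hK Gasym Gala.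
have hB := psd_tensor_ge p hLf GBsym GBlB.
have hE := affine_potential_ge mu1 erefl.
have hV := variance_le mu1 erefl.
set V := \sum_(q < r.+1) `|mu q| * _ in hE hV.
pose Y := \sum_(1 <= i < r.+1) y i.
have Y0 : 0 <= Y by apply: sumr_ge0.
have cb0 : \sum_(i < r.+1) cbar r.+1 mu i * y i = \sum_(1 <= i < r.+1) cbar r.+1 mu i * y i.
  rewrite -(big_mkord xpredT (fun i => cbar r.+1 mu i * y i)) big_ltn//.
  rewrite [cbar _ _ 0%N](_ : _ = 0) ?mul0r ?add0r//.
  by rewrite /cbar big1// => q _; rewrite big_ord0 mulr0.
have hc : cmin r.+1 Bh mu * Y <= \sum_(1 <= i < r.+1) chat r.+1 Bh mu i * y i / 2 -
    \sum_(1 <= i < r.+1) cbar r.+1 mu i * y i.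
  rewrite /Y mulr_sumr -sumrB !big_nat; apply: ler_sum => i ir.
  by have := ler_wpM2r (y_ge0 i) (cmin_le Bh mu ir); lra.
have hL4 : \sum_(i < r) Lf (p i - p i.+1) (p i - p i.+1) <= 4 * \sum_(i < r.+1) Lf (p i) (p i).
  apply: (@le_trans _ _ (\sum_(i < r) (2 * Lf (p i) (p i) + 2 * Lf (p i.+1) (p i.+1)))).
    apply: ler_sum => i _; rewrite -mulrDr -[Lf (p i.+1) _](formN_sqr _ hLf).
    exact: form_sqrD_le.
  rewrite big_split /= -!mulr_sumr.
  have e1 : \sum_(i < r) Lf (p i) (p i) <= \sum_(i < r.+1) Lf (p i) (p i).
    by rewrite big_ord_recr /= lerDl form_ge0.
  have e2 : \sum_(i < r) Lf (p i.+1) (p i.+1) <= \sum_(i < r.+1) Lf (p i) (p i).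
    by rewrite big_ord_recl /= lerDr form_ge0.
  lra.
have KS0 : 0 <= \sum_(i < r) K (p i - p i.+1) (p i - p i.+1).
  by apply: sumr_ge0 => i _; exact: form_ge0.
have LS0 : 0 <= \sum_(i < r.+1) Lf (p i) (p i).
  by apply: sumr_ge0 => i _; exact: form_ge0.
have key : 0 <= la / tau * \sum_(i < r) K (p i - p i.+1) (p i - p i.+1) +
    lB * \sum_(i < r.+1) Lf (p i) (p i) + lf * (cmin r.+1 Bh mu * Y).
  have [c0|c0] := leP 0 (cmin r.+1 Bh mu).
    by rewrite !addr_ge0 ?mulr_ge0// ?invr_ge0// ltW.
  have ab := absorb c0.
  have : lf * `|cmin r.+1 Bh mu| * Y <=
      la / tau * \sum_(i < r) K (p i - p i.+1) (p i - p i.+1) +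
      lB / 4 * \sum_(i < r) Lf (p i - p i.+1) (p i - p i.+1).
    rewrite /Y big_add1 big_mkord !mulr_sumr -big_split /=.
    by apply: ler_sum => i _; exact: ab.
  rewrite ltr0_norm// => ab'.
  have : lB / 4 * \sum_(i < r) Lf (p i - p i.+1) (p i - p i.+1) <=
     lB * \sum_(i < r.+1) Lf (p i) (p i).
    by rewrite -mulrA ler_pM2l// mulrC ler_pdivrMr// mulrC.
  lra.
have hA' : la / tau * \sum_(i < r) K (p i - p i.+1) (p i - p i.+1) <=
    tau^-1 * \sum_(i < r) \sum_(j < r) Ga i j * K (p i - p i.+1) (p j - p j.+1).
  by rewrite -[la / tau]mulrC -mulrA ler_pM2l ?invr_gt0.
have hV' : lf / 2 * V <= lf * \sum_(1 <= i < r.+1) cbar r.+1 mu i * y i.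
  by rewrite -cb0 -mulrA ler_wpM2l// mulrC ler_pdivrMr// mulrC.
have hc' : lf * (cmin r.+1 Bh mu * Y) <=
    lf / 2 * \sum_(1 <= i < r.+1) chat r.+1 Bh mu i * y i -
    lf * \sum_(1 <= i < r.+1) cbar r.+1 mu i * y i.
  apply: le_trans (ler_wpM2l lf_ge0 hc) _.
  by rewrite mulrBr -mulr_suml; lra.
lra.
Qed.

End nonnegativity.

(** * The modified energy of the scheme *)

Lemma quad_form_ext (R : realType) r (G : nat -> nat -> R) (x y : nat -> R) :
  (forall i, (i < r)%N -> x i = y i) -> quad_form r G x = quad_form r G y.
Proof.
by move=> xy; apply: eq_bigr => i _; apply: eq_bigr => j _; rewrite !xy.
Qed.

Lemma matrix_of_lower_bound (R : realType) r (G : nat -> nat -> R) (lambda : R) :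
  (forall x : 'cV[R]_r, lambda * (x^T *m x) 0 0 <= quad (matrix_of r G) x) ->
  forall x : nat -> R, lambda * \sum_(i < r) x i ^+ 2 <= quad_form r G x.
Proof.
move=> Gl x; have := Gl (col_of r x); rewrite quad_matrix_of mxE.
rewrite (@quad_form_ext R r G _ x) => [|i ir]; last first.
  by rewrite (entryE _ (Ordinal ir)) mxE.
by under eq_bigr => i _ do rewrite !mxE -expr2.
Qed.

(** Summation by parts turns the coefficients [A] into their partial sums. *)
Lemma Abel_summation (R : realType) (V : lmodType R) k (A : nat -> R) (v : nat -> V) :
  \sum_(i < k.+1) A i *: v i =
  \sum_(i < k) coef_a A i *: (v i - v i.+1) + coef_a A k *: v k.
Proof.
elim: k => [|k IH]; first by rewrite big_ord0 add0r big_ord1 /coef_a big_ord1.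
rewrite big_ord_recr /= IH [in RHS]big_ord_recr /= -!addrA; congr (_ + _).
rewrite [coef_a A k.+1]/coef_a big_ord_recr /= -/(coef_a A k).
by rewrite scalerBr scalerDl addrA subrK.
Qed.

Lemma Abel_summation_explicit (R : realType) r (Bh y : nat -> R) :
  \sum_(1 <= i < r.+2) Bh i * y i =
  y 1%N + \sum_(1 <= i < r.+1) coef_bh Bh i * (y i - y i.+1) +
  coef_bh Bh r.+1 * y r.+1.
Proof.
elim: r => [|r IH].
  by rewrite [in RHS]big_geq// addr0 /coef_bh !big_nat1; ring.
rewrite big_nat_recr//= IH [in RHS]big_nat_recr//=.
have -> : coef_bh Bh r.+2 = coef_bh Bh r.+1 + Bh r.+2.
  by rewrite /coef_bh big_nat_recr//= addrAC.
ring.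
Qed.

Section scheme.
Variables (R : realType) (d : nat) (H V S : hilbertType R).
Variables (iSV : {linear S -> V}) (iVH : {linear V -> H}).
Variables (L : {linear S -> V}) (M : V -> V -> R).
Variables (F : S -> d.-tuple R -> R) (f : S -> V) (lf : R).
Hypothesis hSVH : gelfand_triple iSV iVH.
Hypothesis hM : negative_operator M.
Hypothesis hL : symmetric_nonneg iSV iVH L.
Hypothesis lf_gt0 : 0 < lf.
Hypothesis hf : lipschitz_gradient iSV iVH F f lf.

Local Notation iS := (iSH iSV iVH).
Let K (u v : S) : R := mobility_form iVH M (iS u) (iS v).
Let Lf := stiffness_form iSV iVH L.
Let D (u v : S) : R := dotp (iS u) (iS v).
Let fS (u w : S) : R := dotp (iVH (f u)) (iS w).

Let hK : psd_form K.
Proof.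
have h := psd_form_mobility hSVH hM; split=> [u v|a u v w|v].
- exact: form_sym h _ _.
- by rewrite /K iSH_linear (form_linear h).
- exact: form_ge0 h _.
Qed.

Let hLf : psd_form Lf := psd_form_stiffness hL.

Let hD : psd_form D.
Proof.
have h := psd_form_dotp H; split=> [u v|a u v w|v].
- exact: form_sym h _ _.
- by rewrite /D iSH_linear (form_linear h).
- exact: form_ge0 h _.
Qed.

Let fS_linear u a v w : fS u (a *: v + w) = a * fS u v + fS u w.
Proof.
have h := psd_form_dotp H.
by rewrite /fS iSH_linear (formDr h) (formZr h).
Qed.

Let iSB u v : iS (u - v) = iS u - iS v.
Proof. by rewrite -scaleN1r addrC iSH_linear scaleN1r addrC. Qed.

Let lf_ge0 : 0 <= lf. Proof. exact: ltW. Qed.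

Let taylor u v :
  `|potential_energy F u - potential_energy F v - fS v (u - v)| <=
  lf / 2 * D (u - v) (u - v).
Proof.
by rewrite /fS /D -normr_dotp iSB; exact: potential_taylor.
Qed.

Let lip u v w : `|fS u w - fS v w| <= lf / 2 * (D (u - v) (u - v) + D w w).
Proof.
rewrite /fS -(formBl (psd_form_dotp H)) (le_trans (lipschitz_dotp hf _ _ _))//.
rewrite /D -!normr_dotp iSB -!mulrA ler_pM2l//.
have := sqr_ge0 (`|iS u - iS v| - `|iS w|); rewrite -/iS; nra.
Qed.

(** The scheme determines [M^-1] of the discrete time derivative; pairing with [w] in [H]
    and summing by parts gives an identity between forms on [S]. *)
Lemma imex_lmm_tested r (A B Bh : nat -> R) (tau : R) N (u : nat -> S) n :
  0 < tau -> \sum_(i < r.+2) A i = 0 -> \sum_(1 <= i < r.+2) Bh i = 1 ->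
  imex_lmm iSV iVH L M r.+1 A B Bh f tau N u -> (r <= n < N)%N ->
  let v i := u (n.+1 - i)%N in forall w,
  tau^-1 * \sum_(i < r.+1) coef_a A i * K (v i - v i.+1) w +
     \sum_(i < r.+2) B i * Lf (v i) w + (fS (v 1%N) w +
     \sum_(1 <= i < r.+1) coef_bh Bh i * (fS (v i) w - fS (v i.+1) w)) = 0.
Proof.
move=> tau0 A0 Bh1 scheme nN v w.
pose X := \sum_(i < r.+2) A i *: v i.
pose Z := \sum_(i < r.+2) B i *: L (v i) + \sum_(1 <= i < r.+2) Bh i *: f (v i).
have XZ : Minv M (gelfand iVH (iS X)) = tau *: Z.
  apply: (neg_operator_inj hM) => z; rewrite (Minv_gelfand hSVH hM).
  rewrite -[tau *: Z]addr0 (M_linear hM) (_ : M 0 z = 0) ?addr0.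
    exact: scheme nN z.
  by have := M_linear hM 1 0 0 z; rewrite scale1r addr0 mul1r; lra.
have KX : K X w = - tau * dotp (iVH Z) (iS w).
  rewrite (form_sym hK) /K /mobility_form /MinvH XZ linearZ /=.
  by rewrite dotpC (formZl (psd_form_dotp H)) mulNr.
have KXE : K X w = \sum_(i < r.+1) coef_a A i * K (v i - v i.+1) w.
  rewrite /X Abel_summation [coef_a A r.+1]/coef_a A0 scale0r addr0.
  by rewrite (form_suml hK); apply: eq_bigr => i _; rewrite (formZl hK).
have ZE : dotp (iVH Z) (iS w) =
    \sum_(i < r.+2) B i * Lf (v i) w + \sum_(1 <= i < r.+2) Bh i * fS (v i) w.
  have h := psd_form_dotp H.
  rewrite /Z linearD !linear_sum (formDl h) !(form_suml h); congr (_ + _).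
    by apply: eq_bigr => i _; rewrite linearZ (formZl h).
  by apply: eq_bigr => i _; rewrite linearZ (formZl h).
rewrite -KXE KX ZE (Abel_summation_explicit r Bh (fun i => fS (v i) w)).
rewrite [coef_bh Bh r.+1]/coef_bh Bh1 subrr mul0r addr0.
by rewrite mulNr mulrN mulKf ?gt_eqF//; ring.
Qed.

(** Indices count backwards from [n], so that consecutive energies are evaluated on
    shifts of the same sequence. *)
Lemma modified_energyE r (Bh mu : nat -> R) (Ga GB : nat -> nat -> R) (tau : R)
    (u : nat -> S) n :
  modified_energy iSV iVH L M F lf (k := r.+1) Bh mu (matrix_of r Ga)
    (matrix_of r.+1 GB) tau u n =
  let p i := u (n - i)%N in
  tau^-1 * \sum_(i < r) \sum_(j < r) Ga i j * K (p i - p i.+1) (p j - p j.+1) +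
  \sum_(i < r.+1) \sum_(j < r.+1) GB i j * Lf (p i) (p j) +
  \sum_(i < r.+1) mu i * potential_energy F (p i) +
  lf / 2 * \sum_(1 <= i < r.+1)
    chat r.+1 Bh mu i * D (p i.-1 - p i) (p i.-1 - p i).
Proof.
rewrite /modified_energy /=; congr (_ + _ + _ + _).
- rewrite mulNr -mulrN /dotpG -sumrN; congr (_ * _); apply: eq_bigr => i _.
  rewrite -sumrN; apply: eq_bigr => j _; rewrite mxE -mulrN.
  by rewrite /delta -!subnS.
- apply: eq_bigr => i _; apply: eq_bigr => j _; rewrite mxE.
  by rewrite (form_sym hLf) /Lf /stiffness_form dotpC.
- congr (_ * _); rewrite !big_nat; apply: eq_bigr => -[//|i] _.
  by rewrite normr_dotp /delta subSS -subnS.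
Qed.

Lemma modified_energy_decreasing r (A B Bh mu : nat -> R) Ga ga GB gB
    (alpha beta zeta eta tau : R) N (u : nat -> S) n :
  0 < alpha -> 0 < beta -> 0 < zeta -> 0 < eta -> eta <= 1 ->
  (forall v : S, `|iS v| <= zeta * norm_Minv_half iVH M (iS v) `^ eta *
     norm_L_half iSV iVH L v `^ (1 - eta)) ->
  \sum_(i < r.+2) A i = 0 -> \sum_(1 <= i < r.+2) Bh i = 1 ->
  energy_matrix r mu (coef_a A) (@delta0 R) alpha Ga ga ->
  energy_matrix r.+1 (nu r.+1 mu) B (@delta01 R) beta GB gB ->
  imex_lmm iSV iVH L M r.+1 A B Bh f tau N u ->
  0 < tau -> tau <= tau_max r.+1 Bh mu lf alpha beta zeta eta ->
  (r <= n < N)%N ->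
  modified_energy iSV iVH L M F lf (k := r.+1) Bh mu (matrix_of r Ga)
    (matrix_of r.+1 GB) tau u n.+1 <=
  modified_energy iSV iVH L M F lf (k := r.+1) Bh mu (matrix_of r Ga)
    (matrix_of r.+1 GB) tau u n.
Proof.
move=> a0 b0 z0 e0 e1 interp A0 Bh1 ema emb scheme tau0 tauP nN.
have eqn := imex_lmm_tested tau0 A0 Bh1 scheme nN.
rewrite !modified_energyE /=.
have [K0 L0] : (forall v, 0 <= K v v) /\ (forall v, 0 <= Lf v v).
  by split=> v; apply: form_ge0.
have absorb w : lf * chat r.+1 Bh mu 0 / 2 * D w w <=
    alpha / tau * K w w + beta * Lf w w.
  have [c0|c0] := leP (lf * chat r.+1 Bh mu 0 / 2) 0.
    apply: (@le_trans _ _ 0); first by rewrite mulr_le0_ge0// form_ge0.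
    by rewrite addr_ge0 ?mulr_ge0 ?invr_ge0// ltW.
  rewrite /D -normr_dotp; apply: (interpolation_absorb a0 b0 c0 z0 e0 e1 tau0) => //.
  by have := interp w; rewrite norm_Minv_halfE.
pose v i := u (n.+1 - i)%N.
have := @energy_step R S K Lf D (potential_energy F) fS lf hK hLf hD lf_ge0
  fS_linear taylor lip v r (coef_a A) B Bh mu Ga ga GB gB
  alpha beta tau tau0 ema emb eqn (absorb _).
rewrite /= => step.
have <- : \sum_(1 <= i < r.+1) chat r.+1 Bh mu i *
      D (v i.-1 - v i.-1.+1) (v i.-1 - v i.-1.+1) =
    \sum_(1 <= i < r.+1) chat r.+1 Bh mu i * D (v i.-1 - v i) (v i.-1 - v i).
  by rewrite !big_nat; apply: eq_bigr => -[//|i] _.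
have <- : \sum_(1 <= i < r.+1) chat r.+1 Bh mu i * D (v i - v i.+1) (v i - v i.+1) =
    \sum_(1 <= i < r.+1) chat r.+1 Bh mu i *
      D (u (n - i.-1)%N - u (n - i)%N) (u (n - i.-1)%N - u (n - i)%N).
  by rewrite !big_nat; apply: eq_bigr => -[//|i] _.
exact: step.
Qed.

Lemma modified_energy_ge0 r (Bh mu : nat -> R) (Ga GB : nat -> nat -> R)
    (la lB zeta eta tau : R) (u : nat -> S) n :
  0 < zeta -> 0 < eta -> eta <= 1 -> 0 < la -> 0 < lB -> 0 < tau ->
  (forall v : S, `|iS v| <= zeta * norm_Minv_half iVH M (iS v) `^ eta *
     norm_L_half iSV iVH L v `^ (1 - eta)) ->
  \sum_(i < r.+1) mu i = 1 ->
  (forall i j, Ga i j = Ga j i) -> (forall i j, GB i j = GB j i) ->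
  (forall x : nat -> R, la * \sum_(i < r) x i ^+ 2 <= quad_form r Ga x) ->
  (forall x : nat -> R, lB * \sum_(i < r.+1) x i ^+ 2 <= quad_form r.+1 GB x) ->
  (tau%:E <= taubar_max r.+1 Bh mu lf la lB zeta eta)%E ->
  0 <= modified_energy iSV iVH L M F lf (k := r.+1) Bh mu (matrix_of r Ga)
    (matrix_of r.+1 GB) tau u n.
Proof.
move=> z0 e0 e1 la0 lB0 tau0 interp mu1 Gasym GBsym Gala GBlB tauP.
rewrite modified_energyE /=.
apply: (energy_ge0 hK hLf hD lf_ge0 (F_ge0 hf) fS_linear taylor (fun i => u (n - i)%N)
  tau0 la0 lB0 Gasym GBsym Gala GBlB mu1) => c0 w.
have lB4 : 0 < lB / 4 by lra.
have cp : 0 < lf * `|cmin r.+1 Bh mu| by rewrite mulr_gt0// normr_gt0 lt_eqF.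
rewrite /D -normr_dotp.
apply: (interpolation_absorb la0 lB4 cp z0 e0 e1 tau0) => //.
- exact: form_ge0 hK _.
- exact: form_ge0 hLf _.
- move: tauP; rewrite /taubar_max ifF ?lee_fin; last by apply/negbTE; rewrite -ltNge.
  rewrite (_ : (lB / 4) `^ etabar eta = lB `^ etabar eta * 4^-1 `^ etabar eta); last first.
    by rewrite powRM ?invr_ge0 ?(ltW lB0).
  have -> : 4^-1 `^ etabar eta = 4 `^ (- etabar eta) :> R.
    by rewrite -powR_inv1// -powRrM mulN1r.
  by rewrite -[la * _ * _]mulrA [4 `^ _ * _]mulrC.
- by have := interp w; rewrite norm_Minv_halfE.
Qed.

End scheme.

Unset Implicit Arguments.
Set Strict Implicit.
Theorem theorem3p7 (R : realType) (d : nat) (hd : (1 <= d <= 3)%N)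
  (H V S : hilbertType R)
  (rep : H -> d.-tuple R -> R) (hrep : L2_function_space rep)
  (iSV : {linear S -> V}) (iVH : {linear V -> H})
  (hSVH : gelfand_triple iSV iVH)
  (L : {linear S -> V}) (hL : symmetric_nonneg iSV iVH L)
  (M : V -> V -> R) (hM : negative_operator M)
  (F : S -> d.-tuple R -> R) (f : S -> V) (lf : R) (lf_gt0 : 0 < lf)
  (hf : lipschitz_gradient iSV iVH F f lf)
  (zeta eta : R) (zeta_gt0 : 0 < zeta) (eta_gt0 : 0 < eta) (eta_le1 : eta <= 1)
  (hinterp : forall v : S, `|iSH iSV iVH v| <=
     zeta * norm_Minv_half iVH M (iSH iSV iVH v) `^ eta *
     norm_L_half iSV iVH L v `^ (1 - eta))
  (T : R) (T_gt0 : 0 < T) (k : nat) (k_ge2 : (2 <= k)%N)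
  (A B Bh : nat -> R) (hAB : order_conditions k A B Bh)
  (mu : nat -> R) (sum_mu : \sum_(i < k) mu i = 1)
  (deg_a : size (genpoly k.-1 (coef_a A)) = k)
  (deg_mu : size (genpoly k.-1 mu) = k)
  (deg_B : size (genpoly k B) = k.+1)
  (coprime_a : coprimep (genpoly k.-1 (coef_a A)) (genpoly k.-1 mu))
  (coprime_B : coprimep (genpoly k B) (genpoly k (nu k mu)))
  (root_mu : forall z : R[i], 1 < `|z| -> evalC (genpoly k.-1 mu) z != 0)
  (alpha beta : R) (alpha_gt0 : 0 < alpha) (beta_gt0 : 0 < beta)
  (Re_a : forall theta : R, 0 <= theta <= pi ->
     alpha <= complex.Re (evalC (genpoly k.-1 (coef_a A)) (expi theta) *
                          evalC (genpoly k.-1 mu) (expi (- theta))))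
  (Re_B : forall theta : R, 0 <= theta <= pi ->
     2 * beta * (1 - cos theta) <=
     complex.Re (evalC (genpoly k B) (expi theta) *
                 evalC (genpoly k (nu k mu)) (expi (- theta)))) :
  exists (Ga : 'M[R]_k.-1) (GB : 'M[R]_k),
    let E := modified_energy iSV iVH L M F lf Bh mu Ga GB in
    [/\ posdefmx Ga /\ posdefmx GB,
        forall x : 'cV[R]_k.-1.+1,
          alpha * x ord0 ord0 ^+ 2 <= quad (Umx mu (coef_a A) Ga) x,
        forall y : 'cV[R]_k.+1,
          beta * (y ord0 ord0 - y (inord 1) ord0) ^+ 2 <=
          quad (Umx (nu k mu) B GB) y,
        forall (N : nat) (u : nat -> S), (0 < N)%N ->
          let tau := T / N%:R in
          imex_lmm iSV iVH L M k A B Bh f tau N u ->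
          0 < tau <= tau_max k Bh mu lf alpha beta zeta eta ->
          forall n, (k.-1 <= n < N)%N -> E tau u n.+1 <= E tau u n
      & forall lambda_a lambda_B : R, 0 < lambda_a -> 0 < lambda_B ->
          (forall x : 'cV[R]_k.-1, lambda_a * (x^T *m x) 0 0 <= quad Ga x) ->
          (forall y : 'cV[R]_k, lambda_B * (y^T *m y) 0 0 <= quad GB y) ->
          forall (N : nat) (u : nat -> S), (0 < N)%N ->
          let tau := T / N%:R in
          imex_lmm iSV iVH L M k A B Bh f tau N u ->
          0 < tau ->
          (tau%:E <= mine
             (tau_max k Bh mu lf alpha beta zeta eta)%:E
             (taubar_max k Bh mu lf lambda_a lambda_B zeta eta))%E ->
          (forall n, (k.-1 <= n < N)%N -> E tau u n.+1 <= E tau u n) /\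
          (forall n, (k.-1 <= n <= N)%N -> 0 <= E tau u n)].
Proof.
case: k k_ge2 hAB sum_mu deg_a deg_mu deg_B coprime_a coprime_B root_mu Re_a Re_B
  => [//|r] /= k_ge2 hAB sum_mu deg_a deg_mu deg_B coprime_a coprime_B root_mu Re_a Re_B.
have [Ga [ga ema]] := exists_energy_matrix_a k_ge2 alpha_gt0 deg_mu coprime_a root_mu Re_a.
have [GB [gB emb]] := exists_energy_matrix_B (ltn0Sn r) beta_gt0 (genpoly_head deg_mu)
  coprime_B sum_mu (normal_B hAB) (root_in_disc alpha_gt0 root_mu Re_a) Re_B.
have [Gasym _ Ga0 Gadef] := ema; have [GBsym _ GB0 GBdef] := emb.
have dissip tau N u n := @modified_energy_decreasing R d H V S iSV iVH L M F f lf
  hSVH hM hL lf_gt0 hf r A B Bh mu Ga ga GB gB alpha beta zeta eta tau N u n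
  alpha_gt0 beta_gt0 zeta_gt0 eta_gt0 eta_le1 hinterp (sum_A hAB) (normal_Bh hAB) ema emb.
exists (matrix_of r Ga), (matrix_of r.+1 GB); split.
- by split; exact: posdefmx_matrix_of.
- move=> x; have := quad_Umx_ge x ema.
  by rewrite linear_form_delta0 (entryE x ord0).
- move=> y; have := quad_Umx_ge y emb.
  rewrite linear_form_delta01 (entryE y ord0).
  by rewrite -[X in entry y X](@inordK r.+1 1)// entryE.
- move=> N u N0 scheme /andP[tau0 tauP] n nN.
  exact: dissip scheme tau0 tauP nN.
- move=> la lB la0 lB0 Gala GBlB N u N0 scheme tau0.
  rewrite le_min lee_fin => /andP[tauP tauP2]; split=> [n nN|n _].
    exact: dissip scheme tau0 tauP nN.
  exact: (modified_energy_ge0 hSVH hM hL lf_gt0 hf u n zeta_gt0 eta_gt0 eta_le1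
    la0 lB0 tau0 hinterp sum_mu Gasym GBsym (matrix_of_lower_bound Gala)
    (matrix_of_lower_bound GBlB) tauP2).
Qed.
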